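(* Let $H$ be an operator on a complex Banach space $\mathcal{B}$ satisfying the standing hypothesis stated in the context. If $\phi\in\hat{\mathcal{A}}$, then $$\sigma(\phi(H))\subseteq\overline{\phi(\sigma(H))}.$$
   Context: Write $\langle z\rangle:=(1+|z|^2)^{1/2}$ for $z\in\mathbf{C}$. Standing hypothesis on $H$: $H$ is a closed densely defined operator on a complex Banach space $\mathcal{B}$ with spectrum $\sigma(H)\subseteq\mathbf{R}$, and there are constants $c>0$, $\alpha\ge 0$ such that $\|(z-H)^{-1}\|\le c\,|\mathrm{Im}\,z|^{-1}\left(\frac{\langle z\rangle}{|\mathrm{Im}\,z|}\right)^{\alpha}$ for all $z\notin\mathbf{R}$. Algebra $\mathcal{A}$: for $\beta\in\mathbf{R}$, $S^\beta$ is the set of smooth $f:\mathbf{R}\to\mathbf{C}$ such that for every $n\ge 0$ there is $c_n>0$ with $|f^{(n)}(x)|\le c_n\langle x\rangle^{\beta-n}$ for all $x$; $\mathcal{A}:=\bigcup_{\beta<0}S^\beta$, an algebra under pointwise multiplication. Functional calculus: let $\tau(x,y)=\tau_0(y/\langle x\rangle)$ with $\tau_0\in C^\infty(\mathbf{R})$, $\tau_0(t)=1$ for $|t|\le1$, $\tau_0(t)=0$ for $|t|\ge2$. For $f\in\mathcal{A}$ and an integer $n>\alpha$ put $\tilde f(x,y):=\left(\sum_{r=0}^n f^{(r)}(x)\frac{(iy)^r}{r!}\right)\tau(x,y)$, $\frac{\partial\tilde f}{\partial\bar z}:=\frac12\left(\frac{\partial\tilde f}{\partial x}+i\frac{\partial\tilde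 f}{\partial y}\right)$, and $$f(H):=-\frac1\pi\iint_{\mathbf{C}}\frac{\partial\tilde f}{\partial\bar z}(z-H)^{-1}\,dx\,dy,\qquad z=x+iy.$$ The integral is norm convergent and independent of the choice of $n>\alpha$ and of $\tau$. Extended algebra: $\hat{\mathcal{A}}:=\{(z,f): z\in\mathbf{C},\ f\in\mathcal{A}\}$, where $\phi=(z,f)$ is regarded as the function $\phi(x)=z+f(x)$ on $\mathbf{R}$, with pointwise addition and multiplication. For $\phi=(z,f)$ one sets $\phi(H):=f(H)+zI$. Also $\phi(\sigma(H)):=\{\phi(x):x\in\sigma(H)\}$. *)

(* Defs.v *)
From HB Require Import structures.
From mathcomp Require Import all_boot all_order all_algebra.
From mathcomp Require Export complex.
From mathcomp Require Import all_classical all_reals all_analysis.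
Set Implicit Arguments.
Unset Strict Implicit.
Unset Printing Implicit Defensive.
Import Order.TTheory GRing.Theory Num.Theory.
Import numFieldNormedType.Exports.
Local Open Scope classical_set_scope.
Local Open Scope ring_scope.
Local Open Scope complex_scope.

(* A complex Banach space is a [completeNormedModType R[i]].  Its norm takes
   values in [R[i]] (nonnegative reals); [rnorm] is the same norm in [R]. *)
Section BoundedOperators.
Context {R : realType} {B : normedModType R[i]}.

Definition rnorm (v : B) : R := complex.Re `|v|.

Definition opnorm (T : B -> B) : \bar R :=
  ereal_sup [set (rnorm (T v))%:E | v in [set v | rnorm v <= 1]].

Definition opdist (S T : B -> B) : \bar R := opnorm (fun v => S v - T v).

Definition bounded_linear (T : B -> B) : Prop :=
  linear T /\ (opnorm T < +oo)%E.

End BoundedOperators.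

(* Bochner integral of operator-valued functions, in the operator norm. *)
Section Bochner.
Context {R : realType} {B : normedModType R[i]}.
Context {d : measure_display} {T : measurableType d}.
Variable mu : {measure set T -> \bar R}.

(* The sets [os_set i] need not be disjoint. *)
Record opsimple := OpSimple {
  os_size : nat ;
  os_set : 'I_os_size -> set T ;
  os_val : 'I_os_size -> B -> B ;
  os_measurable : forall i, measurable (os_set i) ;
  os_finite : forall i, (mu (os_set i) < +oo)%E ;
  os_bounded : forall i, bounded_linear (os_val i) }.

Definition os_fun (s : opsimple) (t : T) : B -> B :=
  fun v => \sum_(i < os_size s) (\1_(os_set i) t : R)%:C *: os_val i v.

Definition os_int (s : opsimple) : B -> B :=
  fun v => \sum_(i < os_size s) (fine (mu (os_set i)))%:C *: os_val i v.

Definition is_opint (F : T -> B -> B) (I : B -> B) : Prop :=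
  bounded_linear I /\
  exists s : nat -> opsimple,
    [/\ {ae mu, forall t, opdist (F t) (os_fun (s k) t) @[k --> \oo] --> 0%E},
        (\int[mu]_t opdist (F t) (os_fun (s k) t))%E @[k --> \oo] --> 0%E &
        opdist I (os_int (s k)) @[k --> \oo] --> 0%E].

(* Junk value 0 when the integral does not converge. *)
Definition opint (F : T -> B -> B) : B -> B := xget (fun=> 0) (is_opint F).

End Bochner.

Section UnboundedOperators.
Context {R : realType} {B : normedModType R[i]}.

(* The values of [app] outside [dom] are irrelevant. *)
Record operator := Operator { dom : set B ; app : B -> B }.

Definition linear_operator (H : operator) : Prop :=
  [/\ dom H 0,
      forall (a : R[i]) u v, dom H u -> dom H v -> dom H (a *: u + v) &
      forall (a : R[i]) u v, dom H u -> dom H v ->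
        app H (a *: u + v) = a *: app H u + app H v].

Definition densely_defined (H : operator) : Prop := dense (dom H).

Definition closed_operator (H : operator) : Prop :=
  closed ([set (v, app H v) | v in dom H] : set (B * B)).

Definition is_resolvent (H : operator) (z : R[i]) (T : B -> B) : Prop :=
  [/\ bounded_linear T,
      forall v, dom H (T v) /\ z *: T v - app H (T v) = v &
      forall v, dom H v -> T (z *: v - app H v) = v].

Definition spectrum (H : operator) : set R[i] :=
  [set z | ~ exists T, is_resolvent H z T].

(* $(z - H)^{-1}$, with junk value 0 on the spectrum. *)
Definition resolvent (H : operator) (z : R[i]) : B -> B :=
  xget (fun=> 0) (is_resolvent H z).

(* An everywhere defined operator, seen as an [operator]. *)
Definition total_operator (T : B -> B) : operator := Operator setT T.

End UnboundedOperators.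
Arguments operator {R} B.

Section FunctionalCalculus.
Context {R : realType}.

Definition jap (z : R[i]) : R := Num.sqrt (1 + complex.Re `|z| ^+ 2).

Definition standing_hypothesis {B : normedModType R[i]} (H : operator B)
    (c alpha : R) : Prop :=
  [/\ [/\ linear_operator H, densely_defined H & closed_operator H],
      forall z, spectrum H z -> complex.Im z = 0,
      0 < c, 0 <= alpha &
      forall z : R[i], complex.Im z != 0 ->
        (opnorm (resolvent H z) <=
         (c * `|complex.Im z|^-1 *
          (jap z / `|complex.Im z|) `^ alpha)%:E)%E].

Definition cderive (g : R -> R[i]) : R -> R[i] := fun x =>
  derive1 (fun t => complex.Re (g t)) x +i* derive1 (fun t => complex.Im (g t)) x.

Definition cderiven (n : nat) (g : R -> R[i]) : R -> R[i] := iter n cderive g.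

Definition csmooth (g : R -> R[i]) : Prop := forall (n : nat) (x : R),
  derivable (fun t => complex.Re (cderiven n g t)) x 1 /\
  derivable (fun t => complex.Im (cderiven n g t)) x 1.

Definition symbol (beta : R) : set (R -> R[i]) :=
  [set f | csmooth f /\
    forall n : nat, exists2 cn : R, 0 < cn &
      forall x : R, complex.Re `|cderiven n f x| <= cn * jap x%:C `^ (beta - n%:R)].

Definition calA : set (R -> R[i]) :=
  [set f | exists2 beta : R, beta < 0 & symbol beta f].

Definition cutoff (tau0 : R -> R[i]) : Prop :=
  [/\ csmooth tau0,
      forall t : R, `|t| <= 1 -> tau0 t = 1 &
      forall t : R, 2 <= `|t| -> tau0 t = 0].

Definition almost_analytic (n : nat) (tau0 f : R -> R[i]) (x y : R) : R[i] :=
  (\sum_(r < n.+1) cderiven r f x * (('i%C * y%:C) ^+ r / r`!%:R)) *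
  tau0 (y / jap x%:C).

Definition dbar (F : R -> R -> R[i]) (x y : R) : R[i] :=
  2%:R^-1 * (cderive (fun u => F u y) x + 'i%C * cderive (fun v => F x v) y).

(* $f(H)$, computed with the parameters [n] and [tau0]. *)
Definition fcalc {B : normedModType R[i]} (H : operator B) (n : nat)
    (tau0 f : R -> R[i]) : B -> B := fun v =>
  - (pi^-1)%:C *:
    opint (lebesgue_measure \x lebesgue_measure)%E
      (fun p : measurableTypeR R * measurableTypeR R => fun u : B =>
        dbar (almost_analytic n tau0 f) p.1 p.2 *:
        resolvent H (p.1 +i* p.2) u) v.

Definition calAhat : set (R[i] * (R -> R[i])) := [set phi | calA phi.2].

Definition hat_fun (phi : R[i] * (R -> R[i])) (x : R) : R[i] :=
  phi.1 + phi.2 x.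

Definition hat_calc {B : normedModType R[i]} (H : operator B) (n : nat)
    (tau0 : R -> R[i]) (phi : R[i] * (R -> R[i])) : B -> B := fun v =>
  fcalc H n tau0 phi.2 v + phi.1 *: v.

End FunctionalCalculus.

(* Main.v *)
Require Import Defs.
From HB Require Import structures.
From mathcomp Require Import all_boot all_order all_algebra.
From mathcomp Require Import complex ring lra.
From mathcomp Require Import all_classical all_reals all_analysis.
From mathcomp Require Import measurable_realfun.
Import Order.TTheory GRing.Theory Num.Theory.
Import numFieldNormedType.Exports.
Local Open Scope classical_set_scope.
Local Open Scope ring_scope.
Local Open Scope complex_scope.

Set Implicit Arguments.
Unset Strict Implicit.
Unset Printing Implicit Defensive.

(** The proof is the one of Gelfand theory, but with a linear functional in the
   place of a character, since only its values on the resolvents matter.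

   Let [A] be the algebra of the bounded operators that commute with every
   operator commuting with the resolvents [R z] of [H]. It is commutative, it is
   stable under inverses, and it contains the resolvents and, as an integral of
   multiples of them, [f(H)] ([fcalc_bicommuting]). If [mu] is in the spectrum
   of [phi(H)], then [a = mu - phi(H)] generates a proper ideal of [A].  Fix
   [T = R z0].  For some complex [t] the ideal generated by [a] and [T - t] is
   still proper: otherwise [T - t] would have an inverse [c t] modulo [a A] for
   every [t], and a functional vanishing on [a A] would turn it into an entire
   function equivalent to [- 1 / t] at infinity ([no_global_inverse]). A proper
   ideal is at distance at least [1] from the identity, so that the
   Hahn-Banach theorem gives a bounded functional [L] with [L id = 1] that
   vanishes on this ideal ([spectral_functional]).

   The resolvent identity [R z = T + (z0 - z) T (R z)] now determines [L] on the
   resolvents: [L (R z) (1 - t (z0 - z)) = t].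

   If [t <> 0], put [x = z0 - 1 / t].  Then [x] cannot be in the resolvent set,
   so it is a real point of the spectrum, and [L (R z) = 1 / (z - x)].  Since
   [f(H)] is a norm convergent integral, [L (f(H))] is the scalar integral
   obtained by replacing [R z] by [1 / (z - x)], and this is [f x] by Green's
   formula ([scalar_formula]).  As [L a = 0], we get [mu = phi x].

   If [t = 0], then [L] vanishes on all resolvents, hence on [f(H)], and [mu] is
   the constant part of [phi].  When the spectrum of [H] is unbounded, [mu] is
   the limit of the values of [phi] along it.  When it is bounded, this case is
   impossible: by Cauchy's formula ([contour_formula]) the identity is a norm
   limit of linear combinations of resolvents, so that [L id] would be [0]
   ([kills_identity]).

   Contour integrals are taken along squares, and only their real parts are
   needed, because a complex number [w] is known from the real parts of its
   multiples.  Bochner integrals are reached through real functionals of the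
   operators: their values determine an operator, and commute with integrals
   ([rf_opint]). *)

(** * Moduli, norms and linear forms with real values *)

(** The modulus [`|z|] lives in [R[i]]; inequalities are simpler with its real value. *)
Definition cabs {R : realType} (z : R[i]) : R := complex.Re `|z|.

Section Cabs.
Context {R : realType}.
Implicit Types (z w : R[i]) (r : R).

Lemma normc_cabs z : `|z| = (cabs z)%:C.
Proof. by case: z => a b; rewrite /cabs normc_def. Qed.

Lemma cabs_ge0 z : 0 <= cabs z.
Proof. by rewrite -lecR -normc_cabs; exact: normr_ge0. Qed.

Lemma cabs0 : cabs (0 : R[i]) = 0. Proof. by rewrite /cabs normr0. Qed.

Lemma cabs1 : cabs (1 : R[i]) = 1. Proof. by rewrite /cabs normr1. Qed.

Lemma cabs_eq0 z : (cabs z == 0) = (z == 0).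
Proof. by rewrite -[RHS]normr_eq0 normc_cabs -(inj_eq (@complexI R)). Qed.

Lemma cabs_gt0 z : (0 < cabs z) = (z != 0).
Proof. by rewrite lt_def cabs_ge0 andbT cabs_eq0. Qed.

Lemma cabsM z w : cabs (z * w) = cabs z * cabs w.
Proof. by apply: complexI; rewrite -normc_cabs normrM !normc_cabs rmorphM. Qed.

Lemma cabsV z : cabs z^-1 = (cabs z)^-1.
Proof. by apply: complexI; rewrite -normc_cabs normfV !normc_cabs fmorphV. Qed.

Lemma cabsX z n : cabs (z ^+ n) = cabs z ^+ n.
Proof. by elim: n => [|n IH]; rewrite ?expr0 ?cabs1 // !exprS cabsM IH. Qed.

Lemma cabsN z : cabs (- z) = cabs z. Proof. by rewrite /cabs normrN. Qed.

Lemma cabsD z w : cabs (z + w) <= cabs z + cabs w.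
Proof. by rewrite -lecR rmorphD /= -!normc_cabs ler_normD. Qed.

Lemma cabsB z w : cabs (z - w) <= cabs z + cabs w.
Proof. by rewrite -(cabsN w) cabsD. Qed.

Lemma cabs_distC z w : cabs (z - w) = cabs (w - z).
Proof. by rewrite -cabsN opprB. Qed.

Lemma cabsR r : cabs r%:C = `|r|.
Proof. by rewrite /cabs normc_def /= expr0n addr0 sqrtr_sqr. Qed.

Lemma cabsi : cabs ('i%C : R[i]) = 1.
Proof. by rewrite /cabs normc_def /= expr0n add0r expr1n sqrtr1. Qed.

Lemma sqr_cabs z : cabs z ^+ 2 = complex.Re z ^+ 2 + complex.Im z ^+ 2.
Proof.
case: z => a b; rewrite /cabs normc_def /= sqr_sqrtr //.
by rewrite addr_ge0 // sqr_ge0.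
Qed.

Lemma Re_le_cabs z : `|complex.Re z| <= cabs z.
Proof.
by rewrite -ler_sqr ?nnegrE ?cabs_ge0 // sqr_cabs real_normK ?num_real // lerDl sqr_ge0.
Qed.

Lemma Im_le_cabs z : `|complex.Im z| <= cabs z.
Proof.
by rewrite -ler_sqr ?nnegrE ?cabs_ge0 // sqr_cabs real_normK ?num_real // lerDr sqr_ge0.
Qed.

Lemma cabs_le z : cabs z <= `|complex.Re z| + `|complex.Im z|.
Proof.
rewrite {1}(complexE z) (le_trans (cabsD _ _))//.
by rewrite cabsM cabsi !cabsR mul1r.
Qed.

Lemma ReM_real r z : complex.Re (r%:C * z) = r * complex.Re z.
Proof. by case: z => a b /=; rewrite mul0r subr0. Qed.

Lemma Im_ReN z : complex.Im z = - complex.Re ('i%C * z).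
Proof. by case: z => a b /=; rewrite !(mul0r, mul1r) sub0r opprK. Qed.

End Cabs.

Section Rnorm.
Context {R : realType} {B : normedModType R[i]}.
Implicit Types (v w : B) (a : R[i]).

Lemma norm_rnorm v : `|v| = (rnorm v)%:C.
Proof.
rewrite /rnorm; have := normr_ge0 v; case: `|v| => x y.
by rewrite lecE /= => /andP[/eqP -> _].
Qed.

Lemma rnorm_ge0 v : 0 <= rnorm v.
Proof. by rewrite -lecR -norm_rnorm; exact: normr_ge0. Qed.

Lemma rnorm0 : rnorm (0 : B) = 0. Proof. by rewrite /rnorm normr0. Qed.

Lemma rnorm_eq0 v : (rnorm v == 0) = (v == 0).
Proof. by rewrite -[RHS]normr_eq0 norm_rnorm -(inj_eq (@complexI R)). Qed.

Lemma rnormD v w : rnorm (v + w) <= rnorm v + rnorm w.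
Proof. by rewrite -lecR rmorphD /= -!norm_rnorm ler_normD. Qed.

Lemma rnormN v : rnorm (- v) = rnorm v. Proof. by rewrite /rnorm normrN. Qed.

Lemma rnormB v w : rnorm (v - w) <= rnorm v + rnorm w.
Proof. by rewrite -(rnormN w) rnormD. Qed.

Lemma rnorm_distC v w : rnorm (v - w) = rnorm (w - v).
Proof. by rewrite -rnormN opprB. Qed.

Lemma rnormZ a v : rnorm (a *: v) = cabs a * rnorm v.
Proof.
by apply: complexI; rewrite -norm_rnorm normrZ normc_cabs norm_rnorm rmorphM.
Qed.

End Rnorm.

Section LinearForm.
Context {R : realType} {V : lmodType R[i]} (l : V -> R[i]).
Hypothesis l_lin : forall a u w, l (a *: u + w) = a * l u + l w.

Lemma lform0 : l 0 = 0.
Proof. by have := l_lin (-1) 0 0; rewrite scaleN1r addr0 oppr0 mulN1r addNr. Qed.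

Lemma lformD u w : l (u + w) = l u + l w.
Proof. by rewrite -{1}[u]scale1r l_lin mul1r. Qed.

Lemma lformZ a u : l (a *: u) = a * l u.
Proof. by rewrite -[a *: u]addr0 l_lin lform0 addr0. Qed.

Lemma lformB u w : l (u - w) = l u - l w.
Proof. by rewrite lformD -scaleN1r lformZ mulN1r. Qed.

End LinearForm.

(** * The Hahn-Banach theorem *)

Section HahnBanach.
Context {R : realType} {V : lmodType R[i]}.
Variables (D : set V) (q : V -> R).
Hypothesis D0 : D 0.
Hypothesis DD : forall a u v, D u -> D v -> D (a *: u + v).
Hypothesis qD : forall u v, D u -> D v -> q (u + v) <= q u + q v.
Hypothesis qZ : forall a u, D u -> q (a *: u) = cabs a * q u.

Let DZ a u : D u -> D (a *: u).
Proof. by move=> Du; have := DD a Du D0; rewrite addr0. Qed.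

Let DP u v : D u -> D v -> D (u + v).
Proof. by move=> Du; have := DD 1 Du; rewrite scale1r; apply. Qed.

Let q0 : q 0 = 0.
Proof. by have := qZ 0 D0; rewrite scale0r cabs0 mul0r. Qed.

(** Functionals are handled through their graphs, to which Zorn's lemma applies for
   inclusion. *)
Definition dominated_graph (G : set (V * R)) :=
  [/\ forall p, G p -> D p.1 /\ p.2 <= q p.1 &
      forall (a : R) p p', G p -> G p' -> G (a%:C *: p.1 + p'.1, a * p.2 + p'.2)].

Let graph_fun G v r s : dominated_graph G -> G (v, r) -> G (v, s) -> r = s.
Proof.
move=> [G1 G2].
have le x y : G (v, x) -> G (v, y) -> x <= y.
  move=> Gx Gy; have /G1[_ /=] := G2 (-1) _ _ Gy Gx.
  by rewrite rmorphN /= scaleN1r addNr q0 mulN1r addrC subr_le0.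
by move=> Gr Gs; apply/eqP; rewrite eq_le !le.
Qed.

(** The value at [v] may be chosen between two families of bounds, which do not cross
   because [q] is subadditive. *)
Let extend_graph G v : dominated_graph G -> G (0, 0) -> D v ->
  (forall r, ~ G (v, r)) -> exists G', [/\ dominated_graph G', G `<=` G' &
   exists r, G' (v, r)].
Proof.
move=> dG G0 Dv nv; have [G1 G2] := dG.
pose A := [set p.2 - q (p.1 - v) | p in G].
have GB p p' : G p -> G p' -> G (p.1 + p'.1, p.2 + p'.2).
  by move=> Gp Gp'; have := G2 1 _ _ Gp Gp'; rewrite scale1r mul1r.
have GZ a p : G p -> G (a%:C *: p.1, a * p.2).
  by move=> Gp; have := G2 a _ _ Gp G0; rewrite /= !addr0.
have DN u : D u -> D (- u) by move=> /(DZ (-1)); rewrite scaleN1r.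
have key p p' : G p -> G p' -> p.2 - q (p.1 - v) <= q (p'.1 + v) - p'.2.
  move=> Gp Gp'; rewrite lerBlDr addrAC lerBrDr.
  have [_ /= h] := G1 _ (GB _ _ Gp Gp').
  apply: (le_trans h).
  have [Dp _] := G1 _ Gp; have [Dp' _] := G1 _ Gp'.
  have -> : p.1 + p'.1 = (p'.1 + v) + (p.1 - v).
    by rewrite addrACA subrr addr0 addrC.
  by apply: qD; apply: DP => //; exact: DN.
have A0 : A !=set0 by exists (0 - q (0 - v)), (0, 0).
have ubA p' : G p' -> ubound A (q (p'.1 + v) - p'.2).
  by move=> Gp' _ [p Gp <-]; exact: key.
have hsA : has_sup A by split => //; exists (q (0 + v) - 0); exact: (ubA (0, 0)).
pose c := sup A.
have c1 p : G p -> p.2 - c <= q (p.1 - v).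
  move=> Gp; rewrite lerBlDr -lerBlDl; apply: sup_ubound; last by exists p.
  by case: hsA.
have c2 p : G p -> p.2 + c <= q (p.1 + v).
  by move=> Gp; rewrite -lerBrDl; apply: ge_sup => //; exact: ubA.
exists [set x | exists2 p, G p & exists t : R, x = (p.1 + t%:C *: v, p.2 + t * c)].
split.
- split.
  + move=> _ [p Gp [t ->]] /=; have [Dp qp] := G1 _ Gp.
    split; first by apply: DP => //; exact: DZ.
    have [t0|t0|->] := ltgtP t 0; last by rewrite scale0r !(mul0r, addr0).
    * have : p.1 + t%:C *: v = (- t)%:C *: ((- t^-1)%:C *: p.1 - v).
        rewrite scalerBr scalerA -rmorphM /= mulrNN mulfV ?lt_eqF// scale1r.
        by rewrite rmorphN scaleNr opprK.
      move=> ->; rewrite qZ; last first.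
        by apply: DP; [exact: DZ|exact: DN].
      rewrite cabsR normrN ltr0_norm//.
      have := c1 _ (GZ (- t^-1) _ Gp) => /=.
      rewrite -(ler_pM2l (_ : 0 < - t)) ?oppr_gt0// => /(le_trans _); apply.
      by rewrite mulrBr mulrA mulrNN mulfV ?lt_eqF// mul1r mulNr opprK.
    * have : p.1 + t%:C *: v = t%:C *: ((t^-1)%:C *: p.1 + v).
        by rewrite scalerDr scalerA -rmorphM /= mulfV ?gt_eqF// scale1r.
      move=> ->; rewrite qZ; last by apply: DP => //; exact: DZ.
      rewrite cabsR gtr0_norm//.
      have := c2 _ (GZ t^-1 _ Gp) => /=.
      rewrite -(ler_pM2l t0) => /(le_trans _); apply.
      by rewrite mulrDr mulrA mulfV ?gt_eqF// mul1r.
  + move=> a _ _ [p Gp [t ->]] [p' Gp' [t' ->]] /=.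
    exists (a%:C *: p.1 + p'.1, a * p.2 + p'.2); first exact: G2.
    exists (a * t + t'); congr pair => /=.
      rewrite rmorphD rmorphM /= scalerDr scalerDl !scalerA -!addrA.
      by congr (_ + _); rewrite addrCA.
    by rewrite mulrDr mulrDl !mulrA -!addrA; congr (_ + _); rewrite addrCA.
- move=> [u r] Gp; exists (u, r) => //; exists 0.
  by rewrite /= scale0r mul0r !addr0.
- exists c, (0, 0) => //; exists 1.
  by rewrite /= scale1r mul1r !add0r.
Qed.

(** The functional [j + t v0 |-> t] on [J + R v0] is dominated by [q].  Its real-linear
   extension [Lam] is complexified into [Lam u - i Lam (i u)], whose value at [v0] has
   real part [1]; dividing by that value only decreases the bound. *)
Theorem hahn_banach_separation (J : set V) (v0 : V) :
  J 0 -> (forall a u v, J u -> J v -> J (a *: u + v)) -> J `<=` D -> D v0 ->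
  (forall j, J j -> 1 <= q (v0 - j)) ->
  exists L : V -> R[i],
    [/\ forall a u v, D u -> D v -> L (a *: u + v) = a * L u + L v,
        forall u, J u -> L u = 0, L v0 = 1 &
        forall u, D u -> cabs (L u) <= 2 * q u].
Proof.
move=> J0 JD JsD Dv0 qJ.
have q_ge0 u : D u -> 0 <= q u.
  move=> Du; have := qD Du (DZ (-1) Du).
  by rewrite qZ// scaleN1r subrr q0 cabsN cabs1 mul1r -mulr2n pmulrn_lge0.
have JZ a u : J u -> J (a *: u) by move=> Ju; rewrite -[_ *: _]addr0; exact: JD.
pose G0 : set (V * R) := [set x | exists2 j, J j & exists t : R, x = (j + t%:C *: v0, t)].
have G00 : G0 (0, 0) by exists 0 => //; exists 0; rewrite scale0r addr0.
have dG0 : dominated_graph G0.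
  split=> [_ [j Jj [t ->]]|a _ _ [j Jj [t ->]] [j' Jj' [t' ->]]] /=.
  - have Djt : D (j + t%:C *: v0) by apply: DP; [exact: JsD|exact: DZ].
    split => //; have [t0|t0] := lerP t 0; first exact/(le_trans t0)/q_ge0.
    have -> : j + t%:C *: v0 = t%:C *: (v0 - (- t^-1)%:C *: j).
      rewrite scalerBr scalerA -rmorphM /= mulrN mulfV ?gt_eqF//.
      by rewrite rmorphN scaleN1r opprK addrC.
    rewrite qZ; last first.
      by apply: DP => //; rewrite -scaleN1r; apply: DZ; apply: JsD; exact: JZ.
    by rewrite cabsR gtr0_norm//; apply: ler_peMr; [exact: ltW|apply: qJ; exact: JZ].
  - exists (a%:C *: j + j'); first exact: JD.
    exists (a * t + t'); congr pair.
    by rewrite rmorphD rmorphM /= scalerDr scalerDl !scalerA addrACA.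
pose P := [set G | dominated_graph G /\ (G = set0 \/ G0 `<=` G)].
have [F FP totF|G [[dG GG0] Gmax]] := @Zorn_bigcup _ P.
  have [[G FG GG0]|noG] := pselect (exists2 G, F G & G0 `<=` G); last first.
    have -> : \bigcup_(X in F) X = set0.
      rewrite -subset0 => x [X FX Xx]; have [_ [X0|XG0]] := FP _ FX.
        by move: Xx; rewrite X0.
      by case: noG; exists X.
    by split; [split|left].
  split; last by right => x /GG0 Gx; exists G.
  split=> [p [X FX Xp]|a p p' [X FX Xp] [X' FX' Xp']].
    by have [[+ _] _] := FP _ FX; exact.
  have [XX'|X'X] := totF _ _ FX FX'.
    by exists X' => //; have [[_ +] _] := FP _ FX'; apply => //; exact: XX'.
  by exists X => //; have [[_ +] _] := FP _ FX; apply => //; exact: X'X.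
have {}GG0 : G0 `<=` G.
  case: GG0 => // G0E; case: (Gmax G0); last by split => //; right.
  by rewrite G0E; split => // /(_ _ G00).
have G_tot v : D v -> exists r, G (v, r).
  move=> Dv; apply: contrapT => /forallNP nr.
  have [G' [dG' GG' [r G'r]]] := extend_graph dG (GG0 _ G00) Dv nr.
  apply: (Gmax G'); last by split => //; right; exact: subset_trans GG0 GG'.
  by split => // /(_ _ G'r); exact: nr.
pose Lam v := xget 0 [set r | G (v, r)].
have LamP v : D v -> G (v, Lam v).
  by move=> /G_tot[r Gr]; rewrite /Lam; case: xgetP => [s _ //|/(_ r)].
have LamE v r : D v -> G (v, r) -> Lam v = r.
  by move=> Dv; apply: graph_fun => //; exact: LamP.
have LamL (a : R) u v : D u -> D v -> Lam (a%:C *: u + v) = a * Lam u + Lam v.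
  move=> Du Dv; apply: LamE; first exact: DD.
  by have := dG.2 a _ _ (LamP _ Du) (LamP _ Dv).
have LamJ u : J u -> Lam u = 0.
  move=> Ju; apply: LamE; first exact: JsD.
  by apply: GG0; exists u => //; exists 0; rewrite scale0r addr0.
have Lam1 : Lam v0 = 1.
  apply: LamE => //; apply: GG0; exists 0 => //; exists 1.
  by rewrite scale1r add0r.
have Lam0 : Lam 0 = 0 by apply: LamJ.
have Lamq u : D u -> `|Lam u| <= q u.
  move=> Du; have le v : D v -> Lam v <= q v by move=> /LamP /dG.1[].
  rewrite ler_norml le// andbT lerNl.
  have -> : - Lam u = Lam ((- 1)%:C *: u + 0) by rewrite LamL// Lam0 addr0 mulN1r.
  apply: le_trans (le _ _) _; first by apply: DD.
  by rewrite addr0 qZ// cabsR normrN1 mul1r.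
pose L0 v : R[i] := (Lam v)%:C - 'i%C * (Lam ('i%C *: v))%:C.
have L0D u v : D u -> D v -> L0 (u + v) = L0 u + L0 v.
  move=> Du Dv; rewrite /L0 scalerDr -{1}[u]scale1r -{1}['i%C *: u]scale1r.
  rewrite !(LamL 1) ?mul1r ?rmorphD//=; [|exact: DZ..].
  by rewrite mulrDr opprD addrACA.
have L0R (a : R) u : D u -> L0 (a%:C *: u) = a%:C * L0 u.
  move=> Du; rewrite /L0 (_ : 'i%C *: (a%:C *: u) = a%:C *: ('i%C *: u)); last first.
    by rewrite !scalerA mulrC.
  rewrite -[a%:C *: u]addr0 -[a%:C *: ('i%C *: u)]addr0 !LamL//; last exact: DZ.
  by rewrite Lam0 !addr0 !rmorphM /= mulrBr [in RHS]mulrCA.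
have ii : 'i%C * 'i%C = -1 :> R[i] by rewrite -expr2 sqr_i.
have L0i u : D u -> L0 ('i%C *: u) = 'i%C * L0 u.
  move=> Du; rewrite /L0 scalerA ii -[- 1 *: u]addr0 -(rmorphN1 (real_complex R)) LamL//.
  by rewrite Lam0 addr0 mulN1r rmorphN mulrBr mulrN opprK mulrA ii mulN1r opprK addrC.
have L0Z a u : D u -> L0 (a *: u) = a * L0 u.
  move=> Du; rewrite (complexE a) scalerDl L0D; [|exact: DZ..].
  by rewrite -scalerA L0i ?L0R ?mulrDl ?mulrA//; exact: DZ.
have L01 : L0 v0 != 0.
  rewrite /L0 Lam1; apply/eqP => /(congr1 (fun z => complex.Re z)) /=.
  by rewrite !(mul0r, mulr0) subr0 subr0; apply/eqP/oner_neq0.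
exists (fun v => (L0 v0)^-1 * L0 v); split.
- move=> a u v Du Dv; rewrite L0D ?L0Z//; last exact: DZ.
  by rewrite [LHS]mulrDr mulrCA.
- by move=> u Ju; rewrite /L0 (LamJ _ Ju) (LamJ _ (JZ _ _ Ju)) mulr0 subr0 mulr0.
- by rewrite mulVf.
- move=> u Du; have L0v0 : 1 <= cabs (L0 v0).
    apply: le_trans (Re_le_cabs _).
    by rewrite /L0 Lam1 /= !(mul0r, mulr0) !subr0 normr1.
  rewrite cabsM cabsV mulrC ler_pdivrMr ?(lt_le_trans ltr01)//.
  apply: (@le_trans _ _ (2 * q u)); last by rewrite ler_peMr// mulr_ge0// q_ge0.
  rewrite /L0 (le_trans (cabsB _ _))// cabsM cabsi mul1r !cabsR mulr_natl mulr2n.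
  rewrite lerD ?Lamq// (le_trans (Lamq _ _))//; first exact: DZ.
  by rewrite qZ// cabsi mul1r.
Qed.

End HahnBanach.

(** * Bounded operators *)

Section BoundedOps.
Context {R : realType} {B : normedModType R[i]}.
Implicit Types (S T : B -> B) (v w : B) (a : R[i]) (K : R).

(** On bounded operators, [opnorm] is finite and equal to this real number. *)
Definition opn T : R := fine (opnorm T).

Lemma blin_lin T : bounded_linear T -> forall a u v, T (a *: u + v) = a *: T u + T v.
Proof. by case=> + _ a u v => ->. Qed.

Lemma lin0 T : linear T -> T 0 = 0.
Proof. by move=> l; have := l (-1) 0 0; rewrite !scaleN1r addNr => ->; rewrite addNr. Qed.

Lemma linZ T : linear T -> forall a u, T (a *: u) = a *: T u.
Proof. by move=> l a u; have := l a u 0; rewrite !addr0 lin0// addr0. Qed.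

Lemma linD T : linear T -> forall u v, T (u + v) = T u + T v.
Proof. by move=> l u v; have := l 1 u v; rewrite !scale1r. Qed.

Lemma linB T : linear T -> forall u v, T (u - v) = T u - T v.
Proof. by move=> l u v; rewrite linD// -scaleN1r linZ// scaleN1r. Qed.

Lemma opnorm_ge0 T : linear T -> (0 <= opnorm T)%E.
Proof.
move=> l; apply: ereal_sup_ubound; exists 0; first by rewrite /= rnorm0.
by rewrite lin0// rnorm0.
Qed.

Lemma opnorm_le T K : 0 <= K -> (forall v, rnorm (T v) <= K * rnorm v) ->
  (opnorm T <= K%:E)%E.
Proof.
move=> K0 h; apply: ge_ereal_sup => _ [v /= v1 <-].
by rewrite lee_fin (le_trans (h v))// ler_piMr.
Qed.

Lemma opnP T K : linear T -> (opnorm T <= K%:E)%E ->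
  forall v, rnorm (T v) <= K * rnorm v.
Proof.
move=> l h v; have [->|v0] := eqVneq v 0; first by rewrite lin0// rnorm0 mulr0.
have n0 : 0 < rnorm v by rewrite lt_def rnorm_ge0 rnorm_eq0 v0.
have : ((rnorm (T (((rnorm v)^-1)%:C *: v)))%:E <= K%:E)%E.
  apply: le_trans h; apply: ereal_sup_ubound; exists (((rnorm v)^-1)%:C *: v) => //=.
  by rewrite rnormZ cabsR ger0_norm ?invr_ge0 ?rnorm_ge0// mulVf// gt_eqF.
rewrite lee_fin linZ// rnormZ cabsR ger0_norm ?invr_ge0 ?rnorm_ge0//.
by rewrite mulrC ler_pdivrMr.
Qed.

Lemma blinP T K : linear T -> 0 <= K ->
  (forall v, rnorm (T v) <= K * rnorm v) -> bounded_linear T.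
Proof. by move=> l K0 h; split => //; exact: (le_lt_trans (opnorm_le K0 h) (ltry _)). Qed.

Lemma opnormE T : bounded_linear T -> opnorm T = (opn T)%:E.
Proof.
move=> [l fin]; rewrite /opn fineK// ge0_fin_numE//; exact: opnorm_ge0.
Qed.

Lemma opn_ge0 T : bounded_linear T -> 0 <= opn T.
Proof. by move=> [l _]; rewrite /opn fine_ge0// opnorm_ge0. Qed.

Lemma rnorm_opn T v : bounded_linear T -> rnorm (T v) <= opn T * rnorm v.
Proof. by move=> bT; apply: opnP; [case: bT|rewrite opnormE]. Qed.

Lemma opn_le T K : bounded_linear T -> 0 <= K ->
  (forall v, rnorm (T v) <= K * rnorm v) -> opn T <= K.
Proof. by move=> bT K0 h; rewrite -lee_fin -opnormE//; exact: opnorm_le. Qed.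

Lemma blinD a S T : bounded_linear S -> bounded_linear T ->
  bounded_linear (a *: S + T).
Proof.
move=> bS bT; apply: (@blinP _ (cabs a * opn S + opn T)).
- move=> b u v; rewrite !fctE !(blin_lin bS) !(blin_lin bT).
  rewrite !scalerDr !scalerA [a * b]mulrC -!addrA; congr (_ + _).
  by rewrite addrCA.
- by rewrite addr_ge0 ?mulr_ge0 ?cabs_ge0 ?opn_ge0.
- move=> v; rewrite (le_trans (rnormD _ _))// mulrDl.
  by rewrite lerD ?rnorm_opn// rnormZ -mulrA ler_wpM2l ?cabs_ge0 ?rnorm_opn.
Qed.

Lemma blin0 : bounded_linear (0 : B -> B).
Proof.
apply: (@blinP _ 0) => //; first by move=> a u v; rewrite /= scaler0 addr0.
by move=> v; rewrite rnorm0 mul0r.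
Qed.

Lemma blinZ a S : bounded_linear S -> bounded_linear (a *: S).
Proof. by move=> bS; have := blinD a bS blin0; rewrite addr0. Qed.

Lemma blinA S T : bounded_linear S -> bounded_linear T -> bounded_linear (S + T).
Proof. by move=> bS; have := blinD 1 bS; rewrite scale1r; apply. Qed.

Lemma blinB S T : bounded_linear S -> bounded_linear T -> bounded_linear (S - T).
Proof. by move=> bS bT; rewrite -scaleN1r; apply: blinA => //; exact: blinZ. Qed.

Lemma blin_id : bounded_linear (id : B -> B).
Proof. by apply: (@blinP _ 1) => // v; rewrite mul1r. Qed.

Lemma blin_comp S T : bounded_linear S -> bounded_linear T -> bounded_linear (S \o T).
Proof.
move=> bS bT; apply: (@blinP _ (opn S * opn T)).
- by move=> a u v /=; rewrite (blin_lin bT) (blin_lin bS).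
- by rewrite mulr_ge0 ?opn_ge0.
- move=> v /=; rewrite (le_trans (rnorm_opn _ bS))// -mulrA.
  by rewrite ler_wpM2l ?opn_ge0 ?rnorm_opn.
Qed.

Lemma blin_sum (I : Type) (r : seq I) (F : I -> B -> B) :
  (forall i, bounded_linear (F i)) -> bounded_linear (\sum_(i <- r) F i).
Proof.
move=> bF; elim/big_ind : _ => [|x y|i _]; [exact: blin0|exact: blinA|exact: bF].
Qed.

Lemma opnD S T : bounded_linear S -> bounded_linear T -> opn (S + T) <= opn S + opn T.
Proof.
move=> bS bT; apply: opn_le; first exact: blinA.
  by rewrite addr_ge0 ?opn_ge0.
by move=> v; rewrite (le_trans (rnormD _ _))// mulrDl lerD ?rnorm_opn.
Qed.

Lemma opnZ_le a S : bounded_linear S -> opn (a *: S) <= cabs a * opn S.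
Proof.
move=> bS; apply: opn_le; first exact: blinZ.
  by rewrite mulr_ge0 ?opn_ge0 ?cabs_ge0.
by move=> v; rewrite rnormZ -mulrA ler_wpM2l ?cabs_ge0 ?rnorm_opn.
Qed.

Lemma opn0 : opn (0 : B -> B) = 0.
Proof.
apply/eqP; rewrite eq_le opn_ge0 ?andbT; last exact: blin0.
by apply: opn_le => //; [exact: blin0|move=> v; rewrite rnorm0 mul0r].
Qed.

Lemma opnZ a S : bounded_linear S -> opn (a *: S) = cabs a * opn S.
Proof.
move=> bS; apply/eqP; rewrite eq_le opnZ_le//=.
have [->|a0] := eqVneq a 0; first by rewrite scale0r cabs0 mul0r opn0.
have := opnZ_le a^-1 (blinZ a bS).
rewrite scalerA mulVf// scale1r cabsV mulrC ler_pdivlMr ?cabs_gt0//.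
by rewrite mulrC.
Qed.

Lemma opnN S : bounded_linear S -> opn (- S) = opn S.
Proof. by move=> bS; rewrite -scaleN1r opnZ// cabsN cabs1 mul1r. Qed.

Lemma opnB S T : bounded_linear S -> bounded_linear T -> opn (S - T) <= opn S + opn T.
Proof. by move=> bS bT; rewrite -(opnN bT) opnD// -scaleN1r; exact: blinZ. Qed.

Lemma opn_distC S T : bounded_linear S -> bounded_linear T -> opn (S - T) = opn (T - S).
Proof. by move=> bS bT; rewrite -opprB opnN//; exact: blinB. Qed.

Lemma opn_comp S T : bounded_linear S -> bounded_linear T -> opn (S \o T) <= opn S * opn T.
Proof.
move=> bS bT; apply: opn_le; first exact: blin_comp.
  by rewrite mulr_ge0 ?opn_ge0.
move=> v /=; rewrite (le_trans (rnorm_opn _ bS))// -mulrA.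
by rewrite ler_wpM2l ?opn_ge0 ?rnorm_opn.
Qed.

Lemma opn_id : opn (id : B -> B) <= 1.
Proof. by apply: opn_le => //; [exact: blin_id|move=> v; rewrite mul1r]. Qed.

Lemma opdistE S T : opdist S T = opnorm (S - T).
Proof. by []. Qed.

(** Scaled by [1 / rnorm v], the norm puts [v] at distance [1] from [0], which is what the
   separation theorem asks for. *)
Lemma norming_functional v : exists l : B -> R[i],
  [/\ forall a u w, l (a *: u + w) = a * l u + l w,
      l v = (rnorm v)%:C & forall u, cabs (l u) <= 2 * rnorm u].
Proof.
have [->|v0] := eqVneq v 0.
  exists (fun=> 0); split=> [a u w||u]; first by rewrite mulr0 addr0.
    by rewrite rnorm0.
  by rewrite cabs0 mulr_ge0// rnorm_ge0.
have n0 : 0 < rnorm v by rewrite lt_def rnorm_ge0 rnorm_eq0 v0.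
have [//|//|u w _ _|a u _|//|a _ _ -> ->|//|//|_ -> |L [L1 _ L2 L3]] :=
  @hahn_banach_separation R B setT (fun u => (rnorm v)^-1 * rnorm u) _ _ _ _ [set 0] v.
- by rewrite -mulrDr ler_wpM2l ?invr_ge0 ?rnorm_ge0 ?rnormD.
- by rewrite rnormZ mulrCA.
- by rewrite scaler0 addr0.
- by rewrite subr0 mulVf// gt_eqF.
exists (fun u => (rnorm v)%:C * L u); split=> [a u w||u].
- by rewrite L1// mulrDr mulrCA.
- by rewrite L2 mulr1.
- rewrite cabsM cabsR gtr0_norm// -ler_pdivlMl// (le_trans (L3 _ _))//.
  by rewrite mulrCA.
Qed.

End BoundedOps.

Section Completeness.
Context {R : realType} {B : completeNormedModType R[i]}.

Lemma rnorm_cauchy_cvg (u : nat -> B) (e : nat -> R) :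
  (forall k l, rnorm (u k - u l) <= e k + e l) -> e @ \oo --> (0 : R) ->
  exists v, forall k, rnorm (v - u k) <= e k.
Proof.
move=> ue e0.
have cu : cvg (u @ \oo).
  apply/cauchy_cvgP/cauchy_ballP => eps eps0.
  have [r0 epsE] : 0 < complex.Re eps /\ eps = (complex.Re eps)%:C.
    by move: eps0; case: eps => x y; rewrite ltcE /= => /andP[/eqP -> ->].
  have : \forall k \near \oo, `|0 - e k| < complex.Re eps / 2.
    by move/cvgrPdist_lt : e0; apply; rewrite divr_gt0.
  move=> [N _ NP]; exists (u @` [set n | (N <= n)%N], u @` [set n | (N <= n)%N]).
    by split; exists N => // n Nn; exists n.
  move=> [_ _] [/= [k Nk <-] [l Nl <-]]; rewrite -ball_normE /ball_ /= norm_rnorm epsE ltcR.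
  rewrite (le_lt_trans (ue _ _))// [ltRHS]splitr ltrD//.
    by have := NP k Nk; rewrite /= sub0r normrN; apply: le_lt_trans; exact: ler_norm.
  by have := NP l Nl; rewrite /= sub0r normrN; apply: le_lt_trans; exact: ler_norm.
exists (lim (u @ \oo)) => k; apply/ler_addgt0Pr => r r0.
have r2 : 0 < (r / 2)%:C :> R[i] by rewrite ltcR divr_gt0.
have hu : \forall l \near \oo, `|lim (u @ \oo) - u l| < (r / 2)%:C.
  by move/cvgrPdist_lt : cu; exact.
have he : \forall l \near \oo, `|0 - e l| < r / 2.
  by move/cvgrPdist_lt : e0; apply; rewrite divr_gt0.
have [l [/= + hl]] := @filter_ex _ _ _ _ (filterI hu he).
rewrite norm_rnorm ltcR => hul.
have -> : lim (u @ \oo) - u k = (lim (u @ \oo) - u l) + (u l - u k).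
  by rewrite addrA subrK.
rewrite (le_trans (rnormD _ _))// (splitr r) addrA [leRHS]addrC.
apply: lerD; first exact: ltW.
apply: (le_trans (ue _ _)); rewrite [e l + _]addrC lerD2l.
by move: hl; rewrite sub0r normrN => /(le_lt_trans (ler_norm _))/ltW.
Qed.

Lemma le0_cvg0 (x M : R) (e : nat -> R) : e @ \oo --> (0 : R) ->
  (forall k, x <= e k * M) -> x <= 0.
Proof.
move=> e0 h.
have : (fun k => e k * M) @ \oo --> (0 : R).
  by rewrite -(mul0r M); apply: cvgM => //; exact: cvg_cst.
move=> cM; rewrite -(cvg_lim _ cM)//; apply: limr_ge; first by apply/cvg_ex; exists 0.
exact: nearW.
Qed.

Lemma eq_cvg0 (x y : B) (M : R) (e : nat -> R) : e @ \oo --> (0 : R) ->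
  (forall k, rnorm (x - y) <= e k * M) -> x = y.
Proof.
move=> e0 h; apply/eqP; rewrite -subr_eq0 -rnorm_eq0 eq_le rnorm_ge0 andbT.
exact: le0_cvg0 e0 h.
Qed.

(** Pointwise limits exist since [B] is complete, and they inherit the rate [e] uniformly
   on the unit ball. *)
Lemma blin_complete (u : nat -> B -> B) (e : nat -> R) :
  (forall k, bounded_linear (u k)) ->
  (forall k l, opn (u k - u l) <= e k + e l) -> e @ \oo --> (0 : R) ->
  exists2 T, bounded_linear T & forall k, opn (T - u k) <= e k.
Proof.
move=> bu ue e0.
have e_ge0 k : 0 <= e k.
  have := ue k k; rewrite subrr opn0 -mulr2n pmulrn_lge0//.
have cu v : exists w, forall k, rnorm (w - u k v) <= e k * rnorm v.
  apply: (@rnorm_cauchy_cvg (fun k => u k v)).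
    move=> k l; rewrite -mulrDl.
    apply: (le_trans (rnorm_opn v (blinB (bu k) (bu l)))).
    by rewrite ler_wpM2r ?rnorm_ge0.
  by rewrite -(mul0r (rnorm v)); apply: cvgM => //; exact: cvg_cst.
have [T TP] := choice cu.
have lT : linear T.
  move=> a v w.
  apply: (eq_cvg0 (M := rnorm (a *: v + w) + (cabs a * rnorm v + rnorm w)) e0) => k.
  have -> : T (a *: v + w) - (a *: T v + T w) =
    (T (a *: v + w) - u k (a *: v + w)) - (a *: (T v - u k v) + (T w - u k w)).
    rewrite (blin_lin (bu k)) scalerBr [X in _ = _ - X]addrACA -opprD.
    by rewrite opprB addrA subrK.
  rewrite mulrDr (le_trans (rnormB _ _))// lerD// (le_trans (rnormD _ _))//.
  by rewrite mulrDr lerD// rnormZ mulrCA ler_wpM2l ?cabs_ge0.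
have bT : bounded_linear T.
  apply: (@blinP _ _ _ (e 0%N + opn (u 0%N))) => //.
    by rewrite addr_ge0 ?opn_ge0.
  move=> v; rewrite mulrDl -{1}(subrK (u 0%N v) (T v)).
  by rewrite (le_trans (rnormD _ _))// lerD// rnorm_opn.
by exists T => // k; apply: opn_le; [exact: blinB|exact: e_ge0|move=> v; exact: (TP v k)].
Qed.

(** The partial sums of the Neumann series converge at the rate of the geometric
   series. *)
Lemma neumann (K : B -> B) : bounded_linear K -> opn K < 1 ->
  exists S, [/\ bounded_linear S, forall v, S v - K (S v) = v,
     forall v, S (v - K v) = v & opn S <= (1 - opn K)^-1].
Proof.
move=> bK K1; set q := opn K in K1 *; have q0 : 0 <= q := opn_ge0 bK.
have q1 : 0 < 1 - q by rewrite subr_gt0.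
pose P k : B -> B := iter k (fun S => K \o S) id.
have bP k : bounded_linear (P k).
  elim: k => [|k IH]; [exact: blin_id|exact: blin_comp].
have nP k : opn (P k) <= q ^+ k.
  elim: k => [|k IH]; first exact: opn_id.
  by rewrite exprS (le_trans (opn_comp _ _))// ler_wpM2l.
have KP k v : K (P k v) = P k.+1 v by [].
have PK k v : P k (K v) = P k.+1 v.
  by elim: k v => [//|k IH] v; rewrite /= -/(P k) IH.
pose u k := \sum_(0 <= i < k) P i.
have bu k : bounded_linear (u k) by exact: blin_sum.
have uS k v : u k.+1 v = u k v + P k v.
  by rewrite /u big_nat_recr.
pose e k := q ^+ k / (1 - q).
have e_ge0 k : 0 <= e k by apply: divr_ge0; [exact: exprn_ge0|exact: ltW].
have ueD k m : opn (u (k + m)%N - u k) <= e k - e (k + m)%N.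
  elim: m => [|m IH]; first by rewrite addn0 !subrr opn0.
  have -> : u (k + m.+1)%N - u k = P (k + m)%N + (u (k + m)%N - u k).
    apply/funext => v; rewrite addnS.
    change (u (k + m).+1 v - u k v = P (k + m)%N v + (u (k + m)%N v - u k v)).
    by rewrite uS addrAC addrC.
  apply: (le_trans (opnD _ _)) => //; first exact: blinB.
  apply: (le_trans (lerD (nP _) IH)).
  rewrite addnS /e exprS.
  rewrite le_eqVlt; apply/orP; left; apply/eqP; move: (q ^+ _) (q ^+ _) => X Y.
  by field; rewrite gt_eqF.
have [||S bS Se] := @blin_complete u e bu.
- move=> k l; wlog kl : k l / (k <= l)%N.
    move=> h; case/orP: (leq_total k l) => kl; first exact: h.
    by rewrite (opn_distC (bu k) (bu l)) [e k + e l]addrC; exact: h.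
  rewrite opn_distC// -(subnKC kl) (le_trans (ueD _ _))//.
  by rewrite lerD2l (@le_trans _ _ 0)// oppr_le0.
- rewrite -(mul0r (1 - q)^-1); apply: cvgM; last exact: cvg_cst.
  by apply: cvg_expr; rewrite ger0_norm.
have e0 : e @ \oo --> (0 : R).
  rewrite -(mul0r (1 - q)^-1); apply: cvgM; last exact: cvg_cst.
  by apply: cvg_expr; rewrite ger0_norm.
have rS k v : rnorm (S v - u k v) <= e k * rnorm v.
  by apply: (le_trans (rnorm_opn v (blinB bS (bu k)))); rewrite ler_wpM2r ?rnorm_ge0.
have qe k : q ^+ k = e k * (1 - q) by rewrite /e divfK ?gt_eqF.
have uK k v : u k v - K (u k v) = v - P k v.
  elim: k => [|k IH]; first by rewrite /u big_nil (lin0 bK.1) subr0 subrr.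
  rewrite uS (linD bK.1) opprD addrACA IH KP.
  by rewrite addrA subrK.
have Ku k v : u k (v - K v) = v - P k v.
  elim: k => [|k IH]; first by rewrite /u big_nil subrr.
  by rewrite uS IH (linB (bP k).1) PK addrA subrK.
exists S; split => // [v|v|].
- apply: (eq_cvg0 (M := 2 * rnorm v) e0) => k.
  have -> : S v - K (S v) - v = (S v - u k v) - K (S v - u k v) - P k v.
    have -> : P k v = v - (u k v - K (u k v)) by rewrite uK opprB addrC subrK.
    rewrite (linB bK.1) (opprD (K (S v))) addrACA -(opprD (u k v)).
    by move: (u k v - _) => X; rewrite opprB [RHS]addrA subrK.
  rewrite (le_trans (rnormB _ _))//.
  have -> : e k * (2 * rnorm v) =
    e k * rnorm v + q * (e k * rnorm v) + e k * (1 - q) * rnorm v by ring.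
  rewrite lerD//; last first.
    by rewrite -qe (le_trans (rnorm_opn _ (bP k)))// ler_wpM2r ?rnorm_ge0.
  rewrite (le_trans (rnormB _ _))// lerD// (le_trans (rnorm_opn _ bK))//.
  by rewrite ler_wpM2l.
- apply: (eq_cvg0 (M := rnorm (v - K v) + (1 - q) * rnorm v) e0) => k.
  have -> : S (v - K v) - v = (S (v - K v) - u k (v - K v)) - P k v.
    by rewrite Ku opprB addrA addrAC addrK.
  rewrite (le_trans (rnormB _ _))// mulrDr lerD// mulrA -qe.
  by rewrite (le_trans (rnorm_opn _ (bP k)))// ler_wpM2r ?rnorm_ge0.
- have := Se 0%N; rewrite /e /u big_nil subr0 expr0 div1r.
  exact.
Qed.

End Completeness.

(** * The resolvent *)

Section Resolvent.
Context {R : realType} {B : normedModType R[i]}.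
Variable H : operator B.
Implicit Types (z w : R[i]) (v : B).

Definition rho z := ~ spectrum H z.

Lemma rhoP z : rho z -> is_resolvent H z (resolvent H z).
Proof.
move=> /contrapT [T HT]; rewrite /resolvent.
by case: xgetP => [S _ //|/(_ T)]; exact.
Qed.

Lemma res_blin z : bounded_linear (resolvent H z).
Proof.
rewrite /resolvent; case: xgetP => [S _ []//|_]; exact: blin0.
Qed.

Lemma res_identity z w v : rho z -> rho w ->
  resolvent H z v - resolvent H w v = (w - z) *: resolvent H z (resolvent H w v).
Proof.
move=> /rhoP[bz z1 z2] /rhoP[_ w1 _].
have [Dw wE] := w1 v.
set u := resolvent H w v in Dw wE *.
have E : z *: u - app H u = (z - w) *: u + v.
  by rewrite -[in RHS]wE addrA scalerBl subrK.
have := z2 _ Dw; rewrite E (blin_lin bz) => {1}<-.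
by rewrite opprD addrCA subrr addr0 -scaleNr opprB.
Qed.

Lemma res_comm z w v : rho z -> rho w ->
  resolvent H z (resolvent H w v) = resolvent H w (resolvent H z v).
Proof.
move=> rz rw; have [->//|zw] := eqVneq z w.
have wz0 : w - z != 0 by rewrite subr_eq0 eq_sym.
apply: (scalerI wz0); rewrite -res_identity// -opprB res_identity//.
by rewrite -scaleNr opprB.
Qed.

Lemma res_opn_dist z w : rho z -> rho w ->
  opn (resolvent H z - resolvent H w) <=
  cabs (w - z) * opn (resolvent H z) * opn (resolvent H w).
Proof.
move=> rz rw; have -> : resolvent H z - resolvent H w =
    (w - z) *: (resolvent H z \o resolvent H w).
  by apply/funext => v; exact: res_identity.
have bz := res_blin z; have bw := res_blin w.
rewrite opnZ; last exact: blin_comp.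
by rewrite -mulrA ler_wpM2l ?cabs_ge0// opn_comp.
Qed.

(** In [R w = R z + (z - w) R z R w], the last term is at most half of [R w]. *)
Lemma res_local_bound z w : rho z -> rho w ->
  cabs (w - z) * opn (resolvent H z) <= 2^-1 ->
  opn (resolvent H w) <= 2 * opn (resolvent H z).
Proof.
move=> rz rw zw; have bz := res_blin z; have bw := res_blin w.
have h : opn (resolvent H w) <= opn (resolvent H z) + 2^-1 * opn (resolvent H w).
  rewrite -{1}(subrK (resolvent H z) (resolvent H w)).
  rewrite (le_trans (opnD _ _))//; first exact: blinB.
  rewrite addrC lerD2l opn_distC// (le_trans (res_opn_dist rz rw))//.
  by rewrite ler_wpM2r// opn_ge0.
have := opn_ge0 bz; have := opn_ge0 bw; lra.
Qed.

Lemma res_opn_lip z w : rho z -> rho w ->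
  cabs (w - z) * opn (resolvent H z) <= 2^-1 ->
  opn (resolvent H z - resolvent H w) <= 2 * opn (resolvent H z) ^+ 2 * cabs (w - z).
Proof.
move=> rz rw zw; have b0 := opn_ge0 (res_blin z).
rewrite (le_trans (res_opn_dist rz rw))//.
have := res_local_bound rz rw zw; have := cabs_ge0 (w - z).
move: (opn _) (opn _) (cabs _) b0 => b a d a0 d0 ba.
rewrite (_ : 2 * a ^+ 2 * d = d * a * (2 * a)); last by ring.
by rewrite ler_wpM2l// mulr_ge0.
Qed.

End Resolvent.

(** * Measure and integration in the plane *)

Section Sections.
Context {R : realType}.
Variables (f : R * R -> R) (x y : R).

Lemma continuous_sectionr : {for (x, y), continuous f} ->
  {for y, continuous (fun v => f (x, v))}.
Proof.
move=> cf; apply: (@cvg_comp _ _ _ (fun v : R => (x, v)) f _ _ _ _ cf).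
exact: (@cvg_pair _ _ _ (nbhs y) (nbhs x) (nbhs y) _ _ _ (fun=> x) id (cvg_cst x) cvg_id).
Qed.

Lemma continuous_sectionl : {for (x, y), continuous f} ->
  {for x, continuous (fun u => f (u, y))}.
Proof.
move=> cf; apply: (@cvg_comp _ _ _ (fun u : R => (u, y)) f _ _ _ _ cf).
exact: (@cvg_pair _ _ _ (nbhs x) (nbhs x) (nbhs y) _ _ _ id (fun=> y) cvg_id (cvg_cst y)).
Qed.

End Sections.

Section Plane.
Context {R : realType}.
Notation plane := (measurableTypeR R * measurableTypeR R)%type.
Notation leb := (@lebesgue_measure R).
Notation leb2 := (leb \x leb)%E.

(** Open sets are countable unions of products of intervals with rational bounds. *)
Lemma open_measurable2 (O : set (R * R)) : open O -> measurable (O : set plane).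
Proof.
move=> oO.
pose Q (a b c d : rat) : set plane := `]ratr a, ratr b[%classic `*` `]ratr c, ratr d[%classic.
have -> : O = \bigcup_(a : rat) \bigcup_(b : rat) \bigcup_(c : rat)
    \bigcup_(d in [set d | Q a b c d `<=` O]) Q a b c d.
  apply/seteqP; split=> [[x y] Oxy|_ [a _ [b _ [c _ [d QO]]]] /QO//].
  have [[A C] [/= nA nC] ACO] : nbhs (x, y) O by exact: open_nbhs_nbhs.
  move: nA nC => /nbhs_ballP[e /= e0 eA] /nbhs_ballP[f /= f0 fC].
  have [a] : exists a, ratr a \in `]x - e, x[.
    by apply: rat_in_itvoo; rewrite ltrBlDr ltrDl.
  rewrite in_itv /= => /andP[a1 a2].
  have [b] : exists b, ratr b \in `]x, x + e[.
    by apply: rat_in_itvoo; rewrite ltrDl.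
  rewrite in_itv /= => /andP[b1 b2].
  have [c] : exists c, ratr c \in `]y - f, y[.
    by apply: rat_in_itvoo; rewrite ltrBlDr ltrDl.
  rewrite in_itv /= => /andP[c1 c2].
  have [d] : exists d, ratr d \in `]y, y + f[.
    by apply: rat_in_itvoo; rewrite ltrDl.
  rewrite in_itv /= => /andP[d1 d2].
  exists a => //; exists b => //; exists c => //; exists d; last first.
    by split; rewrite /= in_itv /= ?a2 ?b1 ?c2 ?d1.
  move=> [u v] [/=]; rewrite !in_itv /= => /andP[u1 u2] /andP[v1 v2].
  apply: ACO; split => /=; [apply: eA|apply: fC]; rewrite /ball /= ltr_norml.
    by apply/andP; split; lra.
  by apply/andP; split; lra.
do 3 (apply: bigcupT_measurable_rat => ?).
rewrite bigcup_mkcond; apply: bigcupT_measurable_rat => d; case: ifP => // _.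
by apply: measurableX; exact: measurable_itv.
Qed.

Lemma measurable_fun_at (D : set plane) (f : R * R -> R) :
  measurable D -> (forall p : R * R, D p -> {for p, continuous f}) ->
  measurable_fun D (f : plane -> measurableTypeR R).
Proof.
move=> mD cf; move=> _.
apply: (measurability _ (RGenOInfty.measurableE R)) => //.
move=> _ [_ [a ->] <-].
have -> : D `&` f @^-1` `]a, +oo[%classic =
    D `&` ((f @^-1` `]a, +oo[%classic)^° : set (R * R)).
  apply/seteqP; split=> p [Dp fp]; split => //.
    by apply: (cf p Dp); apply: open_nbhs_nbhs; split => //; exact: interval_open.
  exact: interior_subset fp.
apply: measurableI => //; apply: open_measurable2; exact: open_interior.
Qed.

Definition rect (a b c d : R) : set plane := `[a, b]%classic `*` `[c, d]%classic.

Lemma measurable_rect a b c d : measurable (rect a b c d).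
Proof. by apply: measurableX; exact: measurable_itv. Qed.

Lemma compact_rect a b c d : compact (rect a b c d : set (R * R)).
Proof. by apply: compact_setX; exact: segment_compact. Qed.

Lemma rect_fin a b c d : (leb2 (rect a b c d) < +oo)%E.
Proof.
rewrite /rect product_measure1E; [|exact: measurable_itv..].
have h (u v : R) : (leb `[u, v]%classic < +oo)%E.
  by rewrite lebesgue_measure_itv; case: ifP => //= _; rewrite ltry.
by apply: lte_mul_pinfty; rewrite ?ge0_fin_numE//; exact: h.
Qed.

Lemma integrable_rect (f : R * R -> R) a b c d :
  (forall p, rect a b c d p -> {for p, continuous f}) ->
  leb2.-integrable (rect a b c d) (EFin \o f).
Proof.
move=> cf; apply: measurable_bounded_integrable.
- exact: measurable_rect.
- exact: rect_fin.
- by apply: measurable_fun_at => //; exact: measurable_rect.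
- have cw : {within (rect a b c d : set (R * R)), continuous f}.
    by apply: continuous_in_subspaceT => p; rewrite inE; exact: cf.
  have [M [_ HM]] := compact_bounded (continuous_compact cw (@compact_rect a b c d)).
  exists M; split; first exact: num_real.
  by move=> x Mx p Dp /=; apply: (HM x Mx); exists p.
Qed.

(** Both orders of integration are needed in Green's formula. *)
Lemma Rintegral_rect (f : R * R -> R) a b c d :
  (forall p, rect a b c d p -> {for p, continuous f}) ->
  \int[leb2]_(p in rect a b c d) f p =
    \int[leb]_(x in `[a, b]) \int[leb]_(y in `[c, d]) f (x, y) /\
  \int[leb2]_(p in rect a b c d) f p =
    \int[leb]_(y in `[c, d]) \int[leb]_(x in `[a, b]) f (x, y).
Proof.
move=> cf.
pose g := f \_ (rect a b c d).
have ig : leb2.-integrable setT (EFin \o g).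
  rewrite /g -restrict_EFin; apply/integrable_restrict => //.
    exact: measurable_rect.
  by rewrite setTI; exact: integrable_rect.
have gE x y : g (x, y) = if (x \in `[a, b]%classic) && (y \in `[c, d]%classic) then f (x, y) else 0.
  by rewrite /g patchE /rect in_setX.
have E0 : (\int[leb2]_(p in rect a b c d) f p) = \int[leb2]_p g p.
  by rewrite Rintegral_mkcond.
split.
- rewrite E0 {1}/Rintegral -integral12_prod_meas1//.
  rewrite [RHS]Rintegral_mkcond /Rintegral; congr fine; apply: eq_integral => x _.
  rewrite /fubini_F patchE; case: ifPn => xab; last first.
    by rewrite integral0_eq// => y _ /=; rewrite gE (negbTE xab).
  have -> : (\int[leb]_y (EFin \o g) (x, y) = \int[leb]_(y in `[c, d]) (f (x, y))%:E)%E.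
    rewrite [RHS]integral_mkcond; apply: eq_integral => y _.
    by rewrite patchE /= gE xab /=; case: ifP.
  rewrite /= fineK//; apply: integrable_fin_num => //.
  apply: (@continuous_compact_integrable _ (fun y => f (x, y))); first exact: segment_compact.
  apply: continuous_in_subspaceT => y; rewrite inE => ycd.
  have cxy : {for (x, y), continuous f} by apply: cf; split => //=; rewrite inE in xab.
  exact: (@continuous_sectionr R f x y).
- rewrite E0 {1}/Rintegral -integral21_prod_meas1//.
  rewrite [RHS]Rintegral_mkcond /Rintegral; congr fine; apply: eq_integral => y _.
  rewrite /fubini_G patchE; case: ifPn => ycd; last first.
    by rewrite integral0_eq// => x _ /=; rewrite gE (negbTE ycd) andbF.
  have -> : (\int[leb]_x (EFin \o g) (x, y) = \int[leb]_(x in `[a, b]) (f (x, y))%:E)%E.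
    rewrite [RHS]integral_mkcond; apply: eq_integral => x _.
    by rewrite patchE /= gE ycd andbT; case: ifP.
  rewrite /= fineK//; apply: integrable_fin_num => //.
  apply: (@continuous_compact_integrable _ (fun x => f (x, y))); first exact: segment_compact.
  apply: continuous_in_subspaceT => x; rewrite inE => xab.
  have cxy : {for (x, y), continuous f} by apply: cf; split => //=; rewrite inE in ycd.
  exact: (@continuous_sectionl R f x y).
Qed.

End Plane.

(** * Green's formula *)

Section Green.
Context {R : realType}.
Notation leb := (@lebesgue_measure R).
Notation leb2 := (leb \x leb)%E.

Definition cont_on (f : R -> R) a b := forall x, a <= x <= b -> {for x, continuous f}.

Lemma cont_on_sub (f : R -> R) a b c d : a <= c -> d <= b -> cont_on f a b -> cont_on f c d.
Proof.
move=> ac db cf x /andP[cx xd]; apply: cf.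
by rewrite (le_trans ac cx) (le_trans xd db).
Qed.

Lemma cont_on_within (f : R -> R) a b : cont_on f a b -> {within `[a, b], continuous f}.
Proof.
by move=> cf; apply: continuous_in_subspaceT => x; rewrite inE /= in_itv; exact: cf.
Qed.

Lemma cont_on_integrable (f : R -> R) a b : cont_on f a b ->
  leb.-integrable `[a, b] (EFin \o f).
Proof.
move=> cf; apply: continuous_compact_integrable; first exact: segment_compact.
exact: cont_on_within.
Qed.

Lemma ftc_on (F f : R -> R) (a b : R) : a < b -> cont_on f a b ->
  (forall x, a <= x <= b -> is_derive x 1 F (f x)) ->
  \int[leb]_(x in `[a, b]) f x = F b - F a.
Proof.
move=> ab cf dF; rewrite /Rintegral (@continuous_FTC2 _ f F) //=.
- exact: cont_on_within.
- split.
  + by move=> x; rewrite in_itv => /andP[ax xb]; have [] := dF x; rewrite ?ltW.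
  + apply: cvg_at_right_filter; apply: differentiable_continuous; apply/derivable1_diffP.
    by have [] := dF a; rewrite ?lexx ?ltW.
  + apply: cvg_at_left_filter; apply: differentiable_continuous; apply/derivable1_diffP.
    by have [] := dF b; rewrite ?lexx ?ltW.
- move=> x; rewrite in_itv => /andP[ax xb].
  by rewrite derive1E; apply: derive_val; apply: dF; rewrite !ltW.
Qed.

Lemma Rint_cat (f : R -> R) (a b c : R) : a <= b -> b <= c -> cont_on f a c ->
  \int[leb]_(x in `[a, c]) f x =
  \int[leb]_(x in `[a, b]) f x + \int[leb]_(x in `[b, c]) f x.
Proof.
move=> ab bc cf.
have ic := cont_on_integrable cf.
have ibc : leb.-integrable `]b, c] (EFin \o f).
  apply: integrableS ic => //; apply: subset_itv => //; rewrite bnd_simp//.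
have := @Rintegral_itvB _ f (BLeft a) (BRight c) b ic.
rewrite Rintegral_itv_obnd_cbnd// !bnd_simp => /(_ ab bc) <-.
by rewrite addrC subrK.
Qed.

Lemma RintB (f g : R -> R) a b : cont_on f a b -> cont_on g a b ->
  \int[leb]_(x in `[a, b]) (f x - g x) =
  \int[leb]_(x in `[a, b]) f x - \int[leb]_(x in `[a, b]) g x.
Proof. by move=> cf cg; rewrite RintegralB//; exact: cont_on_integrable. Qed.

Lemma cont_onB (f g : R -> R) a b : cont_on f a b -> cont_on g a b ->
  cont_on (fun x => f x - g x) a b.
Proof. by move=> cf cg x xab; apply: cvgB; [exact: cf|exact: cg]. Qed.

Lemma Rint_le (f : R -> R) (a b M : R) : a <= b -> cont_on f a b ->
  (forall x, a <= x <= b -> `|f x| <= M) ->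
  `|\int[leb]_(x in `[a, b]) f x| <= M * (b - a).
Proof.
move=> ab cf fM.
have ic := cont_on_integrable cf.
apply: (le_trans (le_normr_Rintegral _ ic)) => //.
have cM : cont_on (cst M) a b by move=> x _; exact: cvg_cst.
have cn : cont_on (fun x => `|f x|) a b by move=> x xab; apply: cvg_norm; exact: cf.
apply: (@le_trans _ _ (\int[leb]_(x in `[a, b]) cst M x)).
  apply: le_Rintegral => //.
  - exact: (cont_on_integrable cn).
  - exact: (cont_on_integrable cM).
rewrite Rintegral_cst// (_ : fine _ = b - a)//.
transitivity (fine (leb `[a, b]%classic)) => //.
rewrite lebesgue_measure_itv /= lte_fin.
case: ifPn => [_|]; first by rewrite -EFinB.
by rewrite -leNgt => ba; rewrite (_ : b = a) ?subrr//; apply/eqP; rewrite eq_le ba ab.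
Qed.

Definition cder (g : R -> R[i]) (x : R) (l : R[i]) :=
  is_derive x 1 (fun t => complex.Re (g t)) (complex.Re l) /\
  is_derive x 1 (fun t => complex.Im (g t)) (complex.Im l).

Definition ccont (G : R * R -> R[i]) (p : R * R) :=
  {for p, continuous (fun q => complex.Re (G q))} /\
  {for p, continuous (fun q => complex.Im (G q))}.

(** Partial derivatives are given as functions, since Green's formula integrates them. *)
Definition C1at (G Gx Gy : R * R -> R[i]) (p : R * R) :=
  [/\ cder (fun u => G (u, p.2)) p.1 (Gx p), cder (fun v => G (p.1, v)) p.2 (Gy p),
     ccont G p, ccont Gx p & ccont Gy p].

(** Fubini, and the fundamental theorem of calculus in the inner variable. *)
Lemma Green_rect (G Gx Gy : R * R -> R[i]) (a b c d : R) : a < b -> c < d ->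
  (forall p, rect a b c d p -> C1at G Gx Gy p) ->
  \int[leb2]_(p in rect a b c d) (complex.Re (Gx p) - complex.Im (Gy p)) =
  (\int[leb]_(y in `[c, d]) (complex.Re (G (b, y)) - complex.Re (G (a, y)))) -
  \int[leb]_(x in `[a, b]) (complex.Im (G (x, d)) - complex.Im (G (x, c))).
Proof.
move=> ab cd GC.
have cx p : rect a b c d p -> {for p, continuous (fun q => complex.Re (Gx q))}.
  by move=> /GC[_ _ _ []].
have cy p : rect a b c d p -> {for p, continuous (fun q => complex.Im (Gy q))}.
  by move=> /GC[_ _ _ _ []].
rewrite RintegralB; [|exact: measurable_rect|exact: integrable_rect|exact: integrable_rect].
rewrite (Rintegral_rect cx).2 (Rintegral_rect cy).1; congr (_ - _).
- apply: eq_Rintegral => y; rewrite inE /= in_itv /= => ycd.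
  apply: (@ftc_on (fun u => complex.Re (G (u, y)))) => // x xab;
    have /GC[[? _] _ _ [c1 _] _] : rect a b c d (x, y) by split; rewrite /= in_itv.
  + exact: continuous_sectionl c1.
  + by [].
- apply: eq_Rintegral => x; rewrite inE /= in_itv /= => xab.
  apply: (@ftc_on (fun v => complex.Im (G (x, v)))) => // y ycd;
    have /GC[_ [_ ?] _ _ [_ c1]] : rect a b c d (x, y) by split; rewrite /= in_itv.
  + exact: continuous_sectionr c1.
  + by [].
Qed.

(** The real part of [1 / i] times the contour integral of [G] along the
   boundary of the square with center [x0] and half side [s]. *)
Definition square_int (G : R * R -> R[i]) (x0 s : R) : R :=
  (\int[leb]_(y in `[- s, s])
    (complex.Re (G (x0 + s, y)) - complex.Re (G (x0 - s, y)))) -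
  \int[leb]_(x in `[x0 - s, x0 + s])
    (complex.Im (G (x, s)) - complex.Im (G (x, - s))).

Lemma Green_square (G Gx Gy : R * R -> R[i]) (x0 s : R) : 0 < s ->
  (forall p, `|p.1 - x0| <= s -> `|p.2| <= s -> C1at G Gx Gy p) ->
  square_int G x0 s =
  \int[leb2]_(p in rect (x0 - s) (x0 + s) (- s) s) (complex.Re (Gx p) - complex.Im (Gy p)).
Proof.
move=> s0 GC; rewrite (@Green_rect G)//; [lra|lra|].
move=> [x y] [/=]; rewrite !in_itv /= => /andP[x1 x2] /andP[y1 y2].
by apply: GC => /=; rewrite ler_norml; apply/andP; split; lra.
Qed.

(** The frame is cut into two rectangles of full height and two rectangles above and
   below the hole; along the cuts the boundary terms cancel. *)
Lemma Green_frame (G Gx Gy : R * R -> R[i]) (x0 a b : R) : 0 < a -> a < b ->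
  (forall p, `|p.1 - x0| <= b -> `|p.2| <= b -> (a <= `|p.1 - x0|) || (a <= `|p.2|) ->
    C1at G Gx Gy p) ->
  let F p := complex.Re (Gx p) - complex.Im (Gy p) in
  square_int G x0 b - square_int G x0 a =
  (\int[leb2]_(p in rect (x0 - b) (x0 - a) (- b) b) F p) +
  (\int[leb2]_(p in rect (x0 + a) (x0 + b) (- b) b) F p) +
  (\int[leb2]_(p in rect (x0 - a) (x0 + a) a b) F p) +
  (\int[leb2]_(p in rect (x0 - a) (x0 + a) (- b) (- a)) F p).
Proof.
move=> a0 ab GC F.
have b0 : 0 < b := lt_trans a0 ab.
have ab' := ltW ab; have a0' := ltW a0; have b0' := ltW b0.
have nb (v : R) : - b <= v -> v <= b -> `|v| <= b by move=> ? ?; rewrite ler_norml; apply/andP.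
have ge1 (v : R) : a <= v -> a <= `|v| by move=> /le_trans; apply; exact: ler_norm.
have ge2 (v : R) : v <= - a -> a <= `|v|.
  by rewrite -normrN lerNr; exact: ge1.
have [l1 [l2 [l3 [l4 [l5 l6]]]]] : x0 - b < x0 - a /\ - b < b /\ x0 + a < x0 + b /\
  x0 - a < x0 + a /\ - b < - a /\ - a < a by clear -a0 ab; do !split; lra.
have [m1 [m2 [m3 m4]]] : x0 - a <= x0 + b /\ - a <= b /\ - b <= a /\ x0 - b <= x0 + a.
  by clear -a0 ab; do !split; lra.
have q1 x : x0 - b <= x -> x <= x0 + b -> `|x - x0| <= b.
  by move=> h1 h2; apply: nb; [rewrite lerBrDr addrC|rewrite lerBlDr addrC].
have q2 x : x0 + a <= x -> a <= `|x - x0|.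
  by move=> h1; apply: ge1; rewrite lerBrDr addrC.
have q3 x : x <= x0 - a -> a <= `|x - x0|.
  by move=> h1; apply: ge2; rewrite lerBlDr addrC.
have nx x y : x0 - b <= x -> x <= x0 + b -> - b <= y -> y <= b -> a <= `|x - x0| ->
    C1at G Gx Gy (x, y).
  by move=> h1 h2 h3 h4 h5; apply: GC; [exact: q1|exact: nb|rewrite h5].
have ny x y : x0 - b <= x -> x <= x0 + b -> - b <= y -> y <= b -> a <= `|y| ->
    C1at G Gx Gy (x, y).
  by move=> h1 h2 h3 h4 h5; apply: GC; [exact: q1|exact: nb|rewrite h5 orbT].
rewrite (@Green_rect G Gx Gy (x0 - b) (x0 - a) (- b) b)//; last first.
  move=> [x y] [/=]; rewrite !in_itv /= => /andP[x1 x2] /andP[y1 y2].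
  by apply: nx => //; [exact: le_trans x2 m1|exact: q3].
rewrite (@Green_rect G Gx Gy (x0 + a) (x0 + b) (- b) b)//; last first.
  move=> [x y] [/=]; rewrite !in_itv /= => /andP[x1 x2] /andP[y1 y2].
  by apply: nx => //; [exact: le_trans m4 x1|exact: q2].
rewrite (@Green_rect G Gx Gy (x0 - a) (x0 + a) a b)//; last first.
  move=> [x y] [/=]; rewrite !in_itv /= => /andP[x1 x2] /andP[y1 y2].
  by apply: ny => //; [exact: le_trans (ltW l1) x1|exact: le_trans x2 (ltW l3)
    |exact: le_trans m3 y1|exact: ge1].
rewrite (@Green_rect G Gx Gy (x0 - a) (x0 + a) (- b) (- a))//; last first.
  move=> [x y] [/=]; rewrite !in_itv /= => /andP[x1 x2] /andP[y1 y2].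
  by apply: ny => //; [exact: le_trans (ltW l1) x1|exact: le_trans x2 (ltW l3)
    |exact: le_trans y2 m2|exact: ge2].
pose Rx x y := complex.Re (G (x, y)).
pose Iy y x := complex.Im (G (x, y)).
have cR x : x0 - b <= x -> x <= x0 + b -> a <= `|x - x0| -> cont_on (Rx x) (- b) b.
  move=> x1 x2 xa y /andP[y1 y2].
  have [_ _ [c1 _] _ _] := nx x y x1 x2 y1 y2 xa; exact: continuous_sectionr c1.
have cI y : - b <= y -> y <= b -> a <= `|y| -> cont_on (Iy y) (x0 - b) (x0 + b).
  move=> y1 y2 ya x /andP[x1 x2].
  have [_ _ [_ c1] _ _] := ny x y x1 x2 y1 y2 ya; exact: continuous_sectionl c1.
have cRap : cont_on (Rx (x0 + a)) (- b) b by apply: cR => //; [exact: ltW|exact: q2].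
have cRam : cont_on (Rx (x0 - a)) (- b) b by apply: cR => //; [exact: ltW|exact: q3].
have l7 := ltW (lt_trans (lt_trans l1 l4) l3).
have cRbp : cont_on (Rx (x0 + b)) (- b) b by apply: cR => //; apply: q2; exact: ltW.
have cRbm : cont_on (Rx (x0 - b)) (- b) b by apply: cR => //; apply: q3; exact: ltW.
have sub : forall f, cont_on f (x0 - b) (x0 + b) -> cont_on f (x0 - a) (x0 + a).
  by move=> f; apply: cont_on_sub; exact: ltW.
have cIb : cont_on (Iy b) (x0 - b) (x0 + b) by apply: cI => //; [exact: ltW|exact: ge1].
have cIb' : cont_on (Iy (- b)) (x0 - b) (x0 + b).
  by apply: cI => //; [exact: ltW|apply: ge2; exact: ltW].
have cIap : cont_on (Iy a) (x0 - a) (x0 + a) by apply/sub/cI => //; exact: ge1.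
have cIam : cont_on (Iy (- a)) (x0 - a) (x0 + a).
  by apply/sub/cI => //; [exact: ltW|exact: ge2].
have cIbp := sub _ cIb; have cIbm := sub _ cIb'.
rewrite /square_int.
pose D y := Rx (x0 + a) y - Rx (x0 - a) y.
pose E x := Iy b x - Iy (- b) x.
have cD : cont_on D (- b) b by exact: cont_onB.
have cE : cont_on E (x0 - b) (x0 + b) by exact: cont_onB.
have D2 : \int[leb]_(y in `[- b, b]) D y = \int[leb]_(y in `[- b, - a]) D y +
    (\int[leb]_(y in `[- a, a]) D y + \int[leb]_(y in `[a, b]) D y).
  rewrite (@Rint_cat D (- b) (- a) b) ?(@Rint_cat D (- a) a b)//; [exact: ltW| |exact: ltW].
  by apply: cont_on_sub cD => //; exact: ltW.
have E2 : \int[leb]_(x in `[x0 - b, x0 + b]) E x = \int[leb]_(x in `[x0 - b, x0 - a]) E x +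
    (\int[leb]_(x in `[x0 - a, x0 + a]) E x + \int[leb]_(x in `[x0 + a, x0 + b]) E x).
  rewrite (@Rint_cat E (x0 - b) (x0 - a) (x0 + b)) ?(@Rint_cat E (x0 - a) (x0 + a) (x0 + b))//.
  - exact: ltW.
  - exact: ltW.
  - by apply: cont_on_sub cE => //; exact: ltW.
  - exact: ltW.
have D1 := RintB cRap cRam.
have E1 := RintB cIbp cIbm.
have R1 := RintB cRbp cRbm; have R2 := RintB cRam cRbm; have R3 := RintB cRbp cRap.
have I1 := RintB cIbp cIap; have I2 := RintB cIam cIbm; have I3 := RintB cIap cIam.
rewrite -/D in D1; rewrite -/E in E1; rewrite -/(E _) -/D.
change (\int[leb]_(y in `[(- b), b]) (Rx (x0 + b) y - Rx (x0 - b) y) -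
  \int[leb]_(x in `[(x0 - b), (x0 + b)]) E x -
  (\int[leb]_(y in `[(- a), a]) D y -
   \int[leb]_(x in `[(x0 - a), (x0 + a)]) (Iy a x - Iy (- a) x)) =
  \int[leb]_(y in `[(- b), b]) (Rx (x0 - a) y - Rx (x0 - b) y) -
  \int[leb]_(x in `[(x0 - b), (x0 - a)]) E x +
  (\int[leb]_(y in `[(- b), b]) (Rx (x0 + b) y - Rx (x0 + a) y) -
   \int[leb]_(x in `[(x0 + a), (x0 + b)]) E x) +
  (\int[leb]_(y in `[a, b]) D y -
   \int[leb]_(x in `[(x0 - a), (x0 + a)]) (Iy b x - Iy a x)) +
  (\int[leb]_(y in `[(- b), (- a)]) D y -
   \int[leb]_(x in `[(x0 - a), (x0 + a)]) (Iy (- a) x - Iy (- b) x))).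
rewrite R1 R2 R3 I1 I2 I3 E2 E1.
have D3 : \int[leb]_(y in `[(- a), a]) D y = \int[leb]_(y in `[(- b), b]) D y -
    \int[leb]_(y in `[(- b), (- a)]) D y - \int[leb]_(y in `[a, b]) D y by rewrite D2; ring.
rewrite D3 D1; ring.
Qed.

End Green.

(** * Holomorphic functions on the plane *)

Section Holomorphic.
Context {R : realType}.
Notation leb := (@lebesgue_measure R).
Implicit Types (G : R * R -> R[i]) (p : R * R).

Definition cpt (p : R * R) : R[i] := p.1 +i* p.2.

Lemma is_derive_quad (f : R -> R) (x l M d : R) : 0 < d ->
  (forall h, `|h| < d -> `|f (x + h) - f x - l * h| <= M * h ^+ 2) ->
  is_derive x 1 f l.
Proof.
move=> d0 H.
have cv : h^-1 *: ((f \o shift x) (h *: 1) - f x) @[h --> 0^'] --> l.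
  apply/cvgrPdist_le => e e0; near=> h.
  have h0 : h != 0 by near: h; exact: nbhs_dnbhs_neq.
  have hd : `|h| < d.
    near: h; apply: dnbhs0_lt => //.
  have he : `|h| * (`|M| + 1) <= e.
    rewrite -ler_pdivlMr; last by rewrite ltr_wpDl.
    by near: h; apply: dnbhs0_le; rewrite divr_gt0// ltr_wpDl.
  rewrite /= [h%:A]mulr1 [h + x]addrC -normrN opprB.
  have -> : h^-1 *: (f (x + h) - f x) - l = h^-1 * (f (x + h) - f x - l * h).
    by rewrite mulrBr [l * h]mulrC mulrA mulVf// mul1r.
  rewrite normrM normfV ler_pdivrMl ?normr_gt0//.
  apply: (le_trans (H _ hd)); apply: le_trans (_ : `|h| * (`|h| * (`|M| + 1)) <= _).
    rewrite mulrA -[`|h| * `|h|]expr2 real_normK ?num_real// [leRHS]mulrC.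
    by rewrite ler_wpM2r ?sqr_ge0// (le_trans (ler_norm M))// lerDl.
  by rewrite ler_wpM2l.
apply: DeriveDef; first by apply/cvg_ex; exists l.
by apply: cvg_lim => //.
Unshelve. all: by end_near. Qed.

Lemma continuous_lip (f : R * R -> R) (p : R * R) (M d : R) : 0 < d ->
  (forall q, `|q.1 - p.1| < d -> `|q.2 - p.2| < d ->
    `|f q - f p| <= M * (`|q.1 - p.1| + `|q.2 - p.2|)) ->
  {for p, continuous f}.
Proof.
move=> d0 H; apply/cvgrPdist_le => e e0.
pose r := Num.min d (e / (2 * (`|M| + 1))).
have M1 : 0 < `|M| + 1 by rewrite ltr_wpDl.
have r0 : 0 < r by rewrite lt_min d0 divr_gt0// mulr_gt0.
exists (ball p.1 r, ball p.2 r).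
  by split; exact: nbhsx_ballx.
move=> [u v] [/= hu hv].
rewrite /ball /= distrC in hu; rewrite /ball /= distrC in hv.
rewrite distrC (le_trans (H (u, v) _ _))//=.
- by rewrite (lt_le_trans hu)// ge_min lexx.
- by rewrite (lt_le_trans hv)// ge_min lexx.
- apply: (@le_trans _ _ ((`|M| + 1) * (r + r))).
    apply: (@le_trans _ _ ((`|M| + 1) * (`|u - p.1| + `|v - p.2|))).
      by rewrite ler_wpM2r ?addr_ge0// (le_trans (ler_norm M))// lerDl.
    by apply: ler_wpM2l; [exact: ltW|apply: lerD; exact: ltW].
  rewrite -mulr2n -[r *+ 2]mulr_natl mulrCA mulrA mulrC -ler_pdivlMr ?mulr_gt0//.
  by rewrite ge_min lexx orbT.
Qed.

(** A function with a second-order Taylor estimate at [z], and whose derivative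
   is Lipschitz there, satisfies the Cauchy-Riemann equations. *)
Lemma C1at_hol (g g' : R[i] -> R[i]) (p : R * R) (M d : R) : 0 < d -> 0 <= M ->
  (forall w, cabs (w - cpt p) < d ->
    cabs (g w - g (cpt p) - g' (cpt p) * (w - cpt p)) <= M * cabs (w - cpt p) ^+ 2 /\
    cabs (g' w - g' (cpt p)) <= M * cabs (w - cpt p)) ->
  C1at (g \o cpt) (g' \o cpt) (fun q => 'i%C * g' (cpt q)) p.
Proof.
case: p => x y d0 M0; set z := cpt (x, y) => H.
have lip (f : R[i] -> R[i]) (K : R) : 0 <= K -> (forall w, cabs (w - z) < d ->
    cabs (f w - f z) <= K * cabs (w - z)) -> ccont (f \o cpt) (x, y).
  move=> K0 Hf.
  have key q : `|q.1 - x| < d / 2 -> `|q.2 - y| < d / 2 ->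
      cabs (f (cpt q) - f z) <= K * (`|q.1 - x| + `|q.2 - y|).
    move=> h1 h2; have hq : cabs (cpt q - z) <= `|q.1 - x| + `|q.2 - y|.
      exact: le_trans (cabs_le _) _.
    apply: (le_trans (Hf _ _)); last by rewrite ler_wpM2l.
    by rewrite (le_lt_trans hq)// [ltRHS]splitr ltrD.
  split; apply: (@continuous_lip _ _ K (d / 2)); rewrite ?divr_gt0// => q h1 h2;
    apply: le_trans (key q h1 h2).
  - by rewrite -raddfB; exact: Re_le_cabs.
  - by rewrite -raddfB; exact: Im_le_cabs.
split.
- have HR h : `|h| < d -> cabs (g (cpt (x + h, y)) - g z - g' z * h%:C) <= M * h ^+ 2.
    move=> hd; have e : cpt (x + h, y) - z = h%:C.
      by rewrite /z /cpt /=; apply/eqP; rewrite eq_complex /= addrAC subrr add0r eqxx subrr eqxx.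
    have := H (cpt (x + h, y)); rewrite e cabsR => /(_ hd)[+ _].
    by rewrite real_normK ?num_real.
  split; apply: (@is_derive_quad _ _ _ M d) => // h hd; apply: le_trans (HR h hd).
  + rewrite mulrC -ReM_real mulrC -!raddfB; exact: Re_le_cabs.
  + rewrite (_ : _ * h = complex.Im (g' z * h%:C)); last first.
      by rewrite /= -/z; case: (g' z) => a b /=; ring.
    rewrite -!raddfB; exact: Im_le_cabs.
- have HI h : `|h| < d -> cabs (g (cpt (x, y + h)) - g z - g' z * ('i%C * h%:C)) <= M * h ^+ 2.
    move=> hd; have e : cpt (x, y + h) - z = 'i%C * h%:C.
      rewrite /z /cpt /=; apply/eqP; rewrite eq_complex /=.
      by apply/andP; split; apply/eqP; ring.
    have := H (cpt (x, y + h)); rewrite e cabsM cabsi mul1r cabsR => /(_ hd)[+ _].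
    by rewrite real_normK ?num_real.
  split; apply: (@is_derive_quad _ _ _ M d) => // h hd; apply: le_trans (HI h hd).
  + rewrite (_ : _ * h = complex.Re (g' z * ('i%C * h%:C))); last first.
      by rewrite /= -/z; case: (g' z) => a b /=; ring.
    rewrite -!raddfB; exact: Re_le_cabs.
  + rewrite (_ : _ * h = complex.Im (g' z * ('i%C * h%:C))); last first.
      by rewrite /= -/z; case: (g' z) => a b /=; ring.
    rewrite -!raddfB; exact: Im_le_cabs.
- apply: (@lip g (M * d + cabs (g' z))).
    by rewrite addr_ge0 ?cabs_ge0// mulr_ge0// ltW.
  move=> w wd; have [h _] := H w wd.
  rewrite -{1}(subrK (g' z * (w - z)) (g w - g z)) (le_trans (cabsD _ _))//.
  rewrite mulrDl cabsM lerD2r (le_trans h)// -mulrA ler_wpM2l// expr2.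
  by rewrite ler_wpM2r ?cabs_ge0// ltW.
- by apply: (@lip g' M) => // w /H[].
- apply: (@lip (fun w => 'i%C * g' w) M) => // w /H[_].
  by rewrite -mulrBr cabsM cabsi mul1r.
Qed.

Lemma cderM (f g : R -> R[i]) x (a b : R[i]) : cder f x a -> cder g x b ->
  cder (fun t => f t * g t) x (a * g x + f x * b).
Proof.
move=> [fR fI] [gR gI].
have E1 : (fun t => complex.Re (f t * g t)) = (fun t => complex.Re (f t)) * (fun t => complex.Re (g t))
   - (fun t => complex.Im (f t)) * (fun t => complex.Im (g t)).
  by apply/funext => t; rewrite !fctE; case: (f t) => ? ?; case: (g t).
have E2 : (fun t => complex.Im (f t * g t)) = (fun t => complex.Re (f t)) * (fun t => complex.Im (g t))
   + (fun t => complex.Im (f t)) * (fun t => complex.Re (g t)).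
  by apply/funext => t; rewrite !fctE; case: (f t) => ? ?; case: (g t) => ? ? /=.
split.
- rewrite E1; apply: (is_derive_eq (is_deriveB (is_deriveM fR gR) (is_deriveM fI gI))).
  rewrite /GRing.scale /=; case: (f x) a {fR fI E1 E2} => ? ? [? ?]; case: (g x) b {gR gI} => ? ? [? ?] /=.
  by ring.
- rewrite E2; apply: (is_derive_eq (is_deriveD (is_deriveM fR gI) (is_deriveM fI gR))).
  rewrite /GRing.scale /=; case: (f x) a {fR fI E1 E2} => ? ? [? ?]; case: (g x) b {gR gI} => ? ? [? ?] /=.
  by ring.
Qed.

Lemma cderD (f g : R -> R[i]) x (a b : R[i]) : cder f x a -> cder g x b ->
  cder (fun t => f t + g t) x (a + b).
Proof.
move=> [fR fI] [gR gI]; split.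
- rewrite (_ : (fun t => _) = (fun t => complex.Re (f t)) + (fun t => complex.Re (g t))); last first.
    by apply/funext => t; rewrite raddfD.
  by rewrite raddfD; exact: is_deriveD.
- rewrite (_ : (fun t => _) = (fun t => complex.Im (f t)) + (fun t => complex.Im (g t))); last first.
    by apply/funext => t; rewrite raddfD.
  by rewrite raddfD; exact: is_deriveD.
Qed.

Lemma cder_cst (c : R[i]) x : cder (fun=> c) x 0.
Proof. by split; exact: is_derive_cst. Qed.

Lemma cder_sum n (f : 'I_n -> R -> R[i]) x (a : 'I_n -> R[i]) :
  (forall i, cder (f i) x (a i)) ->
  cder (fun t => \sum_(i < n) f i t) x (\sum_(i < n) a i).
Proof.
elim: n f a => [|n IH] f a H.
  rewrite big_ord0 (_ : (fun t => _) = fun=> 0); first exact: cder_cst.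
  by apply/funext => t; rewrite big_ord0.
rewrite big_ord_recr /= (_ : (fun t => _) = fun t => \sum_(i < n) f (widen_ord (leqnSn n) i) t + f ord_max t).
  by apply: cderD => //; apply: IH.
by apply/funext => t; rewrite big_ord_recr.
Qed.

Lemma ccontM G K p : ccont G p -> ccont K p -> ccont (fun q => G q * K q) p.
Proof.
move=> [GR GI] [KR KI]; split.
- rewrite (_ : (fun q => _) = (fun q => complex.Re (G q) * complex.Re (K q) - complex.Im (G q) * complex.Im (K q))).
    by apply: cvgB; exact: cvgM.
  by apply/funext => q; case: (G q) => ? ?; case: (K q).
- rewrite (_ : (fun q => _) = (fun q => complex.Re (G q) * complex.Im (K q) + complex.Im (G q) * complex.Re (K q))).
    by apply: cvgD; exact: cvgM.
  by apply/funext => q; case: (G q) => ? ?; case: (K q) => ? ? /=.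
Qed.

Lemma ccontD G K p : ccont G p -> ccont K p -> ccont (fun q => G q + K q) p.
Proof.
move=> [GR GI] [KR KI]; split.
- rewrite (_ : (fun q => _) = (fun q => complex.Re (G q) + complex.Re (K q))); first exact: cvgD.
  by apply/funext => q; rewrite raddfD.
- rewrite (_ : (fun q => _) = (fun q => complex.Im (G q) + complex.Im (K q))); first exact: cvgD.
  by apply/funext => q; rewrite raddfD.
Qed.

Lemma ccont_cst c p : ccont (fun=> c) p.
Proof. by split; exact: cvg_cst. Qed.

Lemma ccont_sum n (G : 'I_n -> R * R -> R[i]) p :
  (forall i, ccont (G i) p) -> ccont (fun q => \sum_(i < n) G i q) p.
Proof.
elim: n G => [|n IH] G H.
  rewrite (_ : (fun t => _) = fun=> 0); first exact: ccont_cst.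
  by apply/funext => t; rewrite big_ord0.
rewrite (_ : (fun t => _) = fun t => \sum_(i < n) G (widen_ord (leqnSn n) i) t + G ord_max t).
  by apply: ccontD => //; apply: IH.
by apply/funext => t; rewrite big_ord_recr.
Qed.

Lemma C1atM G Gx Gy K Kx Ky p : C1at G Gx Gy p -> C1at K Kx Ky p ->
  C1at (fun q => G q * K q) (fun q => Gx q * K q + G q * Kx q)
    (fun q => Gy q * K q + G q * Ky q) p.
Proof.
move=> [Gdx Gdy Gc Gxc Gyc] [Kdx Kdy Kc Kxc Kyc].
have pE : (p.1, p.2) = p by case: p {Gdx Gdy Gc Gxc Gyc Kdx Kdy Kc Kxc Kyc}.
split.
- have := cderM Gdx Kdx; rewrite /= pE; exact.
- have := cderM Gdy Kdy; rewrite /= pE; exact.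
- exact: ccontM.
- by apply: ccontD; exact: ccontM.
- by apply: ccontD; exact: ccontM.
Qed.

(** The Cauchy-Riemann equations in the form in which they enter Green's formula. *)
Definition hol_at G G' p := C1at G G' (fun q => 'i%C * G' q) p.

Lemma hol_CR (a : R[i]) : complex.Re a - complex.Im ('i%C * a) = 0.
Proof. by case: a => x y /=; ring. Qed.

Lemma hol_atM G G' K K' p : hol_at G G' p -> hol_at K K' p ->
  hol_at (fun q => G q * K q) (fun q => G' q * K q + G q * K' q) p.
Proof.
move=> hG hK; have := C1atM hG hK; rewrite /hol_at.
rewrite (_ : (fun q => 'i%C * G' q * K q + _) =
  (fun q => 'i%C * (G' q * K q + G q * K' q)))//.
by apply/funext => q; ring.
Qed.

Lemma hol_at_cst c p : hol_at (fun=> c) (fun=> 0) p.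
Proof.
split; try exact: ccont_cst; try exact: cder_cst.
  by rewrite mulr0; exact: cder_cst.
Qed.

Lemma hol_at_id p : hol_at cpt (fun=> 1) p.
Proof.
apply: (@C1at_hol id (fun=> 1) p 0 1) => // w _.
by rewrite mul1r !subrr cabs0 !mul0r lexx.
Qed.

Lemma hol_at_inv (a : R[i]) p : cpt p != a ->
  hol_at (fun q => (cpt q - a)^-1) (fun q => - (cpt q - a)^-1 ^+ 2) p.
Proof.
move=> pa; set z := cpt p in pa *; have za0 : z - a != 0 by rewrite subr_eq0.
pose r := cabs (z - a); have r0 : 0 < r by rewrite cabs_gt0.
apply: (@C1at_hol (fun w => (w - a)^-1) (fun w => - (w - a)^-1 ^+ 2) p (10 / r ^+ 3) (r / 2)).
- by rewrite divr_gt0.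
- by rewrite divr_ge0// exprn_ge0// ltW.
move=> w; rewrite -/z => wz.
have wr : r / 2 <= cabs (w - a).
  have : r <= cabs (w - a) + cabs (w - z).
    rewrite /r (_ : z - a = (w - a) - (w - z)); first exact: cabsB.
    by ring.
  lra.
have wa0 : w - a != 0 by rewrite -cabs_gt0 (lt_le_trans _ wr)// divr_gt0.
have iw : cabs (w - a)^-1 <= 2 / r.
  rewrite cabsV -[2 / r]invrK invf_div lef_pV2 ?posrE// ?divr_gt0//.
  by rewrite (lt_le_trans _ wr)// divr_gt0.
have iz : cabs (z - a)^-1 = r^-1 by rewrite cabsV.
have i0 : 0 <= r^-1 by rewrite invr_ge0 ltW.
split.
- have -> : (w - a)^-1 - (z - a)^-1 - - (z - a)^-1 ^+ 2 * (w - z) =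
    (z - a)^-1 ^+ 2 * (w - a)^-1 * (w - z) ^+ 2.
    by field; rewrite za0 wa0.
  rewrite cabsM cabsM !cabsX iz ler_wpM2r ?exprn_ge0 ?cabs_ge0//.
  apply: (@le_trans _ _ (r^-1 ^+ 2 * (2 / r))).
    by rewrite ler_wpM2l// exprn_ge0.
  have -> : r^-1 ^+ 2 * (2 / r) = 2 * r^-1 ^+ 3 by ring.
  by rewrite -exprVn ler_wpM2r ?exprn_ge0//; lra.
- have -> : - (w - a)^-1 ^+ 2 - - (z - a)^-1 ^+ 2 =
    ((w - a)^-1 * (z - a)^-1 ^+ 2 + (w - a)^-1 ^+ 2 * (z - a)^-1) * (w - z).
    by field; rewrite za0 wa0.
  rewrite cabsM ler_wpM2r ?cabs_ge0// (le_trans (cabsD _ _))//.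
  rewrite [cabs (_ * _ ^+ 2)]cabsM [cabs (_ ^+ 2 * _)]cabsM !cabsX iz.
  have c0 := cabs_ge0 (w - a)^-1.
  apply: (@le_trans _ _ (2 / r * r^-1 ^+ 2 + (2 / r) ^+ 2 * r^-1)).
    by rewrite lerD// ler_wpM2r ?exprn_ge0// lerXn2r ?nnegrE ?(le_trans c0)//.
  rewrite -exprVn (_ : _ + _ = 6 * r^-1 ^+ 3); last by ring.
  by rewrite ler_wpM2r ?exprn_ge0//; lra.
Qed.

Definition on_square (x0 s : R) p :=
  [/\ `|p.1 - x0| <= s, `|p.2| <= s & `|p.1 - x0| = s \/ `|p.2| = s].

(** The contour has length [8 s]. *)
Lemma square_int_dist G K (x0 s M : R) : 0 < s ->
  (forall p, on_square x0 s p -> [/\ ccont G p, ccont K p & cabs (G p - K p) <= M]) ->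
  `|square_int G x0 s - square_int K x0 s| <= 8 * s * M.
Proof.
move=> s0 H; have s0' := ltW s0.
have nb (v : R) : - s <= v -> v <= s -> `|v| <= s by move=> ? ?; rewrite ler_norml; apply/andP.
have ns : `|s| = s /\ `|- s| = s by rewrite normrN gtr0_norm.
have x0E u : x0 + u - x0 = u by rewrite addrAC subrr add0r.
have Hx (u y : R) : u = s \/ u = - s -> - s <= y -> y <= s -> on_square x0 s (x0 + u, y).
  move=> us y1 y2; have nu : `|u| = s by case: us => ->; tauto.
  by split=> /=; rewrite ?x0E ?nu//; [exact: nb|left].
have Hy (u x : R) : u = s \/ u = - s -> x0 - s <= x -> x <= x0 + s -> on_square x0 s (x, u).
  move=> us x1 x2; have nu : `|u| = s by case: us => ->; tauto.
  split=> /=; rewrite ?nu//; last by right.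
  by apply: nb; [rewrite lerBrDr addrC|rewrite lerBlDr addrC].
pose rG u y := complex.Re (G (x0 + u, y)). pose rK u y := complex.Re (K (x0 + u, y)).
pose iG u x := complex.Im (G (x, u)). pose iK u x := complex.Im (K (x, u)).
have cr u : u = s \/ u = - s -> cont_on (rG u) (- s) s /\ cont_on (rK u) (- s) s.
  move=> us; split=> y /andP[y1 y2]; have [[cg _] [ck _] _] := H _ (Hx u y us y1 y2).
    exact: continuous_sectionr cg.
  exact: continuous_sectionr ck.
have ci u : u = s \/ u = - s -> cont_on (iG u) (x0 - s) (x0 + s) /\ cont_on (iK u) (x0 - s) (x0 + s).
  move=> us; split=> x /andP[x1 x2]; have [[_ cg] [_ ck] _] := H _ (Hy u x us x1 x2).
    exact: continuous_sectionl cg.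
  exact: continuous_sectionl ck.
have dr u : u = s \/ u = - s ->
    `|\int[leb]_(y in `[- s, s]) rG u y - \int[leb]_(y in `[- s, s]) rK u y| <= M * (2 * s).
  move=> us; have [cg ck] := cr u us.
  rewrite -RintB// (le_trans (Rint_le (M := M) _ _ _))//; first by rewrite (le_trans _ s0')// oppr_le0.
    exact: cont_onB.
  - move=> y /andP[y1 y2]; have [_ _] := H _ (Hx u y us y1 y2).
    by apply: le_trans; rewrite /rG /rK -raddfB; exact: Re_le_cabs.
  - by rewrite opprK [2 * s]mulr_natl mulr2n.
have di u : u = s \/ u = - s ->
    `|\int[leb]_(x in `[x0 - s, x0 + s]) iG u x - \int[leb]_(x in `[x0 - s, x0 + s]) iK u x| <= M * (2 * s).
  move=> us; have [cg ck] := ci u us.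
  rewrite -RintB// (le_trans (Rint_le (M := M) _ _ _))//.
  - by rewrite lerD2l (le_trans _ s0')// oppr_le0.
  - exact: cont_onB.
  - move=> x /andP[x1 x2]; have [_ _] := H _ (Hy u x us x1 x2).
    by apply: le_trans; rewrite /iG /iK -raddfB; exact: Im_le_cabs.
  - by rewrite (_ : x0 + s - (x0 - s) = 2 * s)//; ring.
have ls : s = s \/ s = - s by left.
have rs : - s = s \/ - s = - s by right.
have SE F (c : forall u, u = s \/ u = - s -> cont_on (fun y => complex.Re (F (x0 + u, y))) (- s) s /\
    cont_on (fun x => complex.Im (F (x, u))) (x0 - s) (x0 + s)) :
  square_int F x0 s =
    (\int[leb]_(y in `[- s, s]) complex.Re (F (x0 + s, y)) -
     \int[leb]_(y in `[- s, s]) complex.Re (F (x0 + - s, y))) -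
    (\int[leb]_(x in `[x0 - s, x0 + s]) complex.Im (F (x, s)) -
     \int[leb]_(x in `[x0 - s, x0 + s]) complex.Im (F (x, - s))).
  by rewrite /square_int !RintB//; [exact: (c s ls).2|exact: (c (- s) rs).2
    |exact: (c s ls).1|exact: (c (- s) rs).1].
rewrite !SE; [|by move=> u us; have := (cr u us).2; have := (ci u us).2
  |by move=> u us; have := (cr u us).1; have := (ci u us).1].
have := dr s ls; have := dr (- s) rs; have := di s ls; have := di (- s) rs.
rewrite /rG /rK /iG /iK.
move: (\int[leb]_(x in _) _) (\int[leb]_(x in _) _) (\int[leb]_(x in _) _)
  (\int[leb]_(x in _) _) (\int[leb]_(x in _) _) (\int[leb]_(x in _) _)
  (\int[leb]_(x in _) _) (\int[leb]_(x in _) _) => i1 i2 i3 i4 i5 i6 i7 i8.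
clear; rewrite !ler_norml => /andP[? ?] /andP[? ?] /andP[? ?] /andP[? ?].
by apply/andP; split; lra.
Qed.

Lemma atan_derive (s a x : R) : 0 < s ->
  is_derive x 1 (fun t => 2 * a * atan (t / s)) (a * (2 * s / (s ^+ 2 + x ^+ 2))).
Proof.
move=> s0; have d1 : is_derive x 1 (fun t : R => t / s) s^-1.
  rewrite (_ : (fun t => _) = (fun t : R => s^-1 *: t)).
    by apply: is_derive_eq; rewrite /GRing.scale /= mulr1.
  by apply/funext => t; rewrite mulrC.
have d2 : is_derive x 1 (atan \o (fun t : R => t / s)) ((1 + (x / s) ^+ 2)^-1 * s^-1).
  exact: is_derive1_comp.
rewrite (_ : (fun t => _) = (2 * a) *: (atan \o (fun t : R => t / s)))//.
apply: is_derive_eq; rewrite /GRing.scale /=.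
have sx : s ^+ 2 + x ^+ 2 != 0 by rewrite gt_eqF// ltr_wpDr ?sqr_ge0// exprn_gt0.
have sx' : 1 + (x / s) ^+ 2 != 0 by rewrite gt_eqF// ltr_wpDr ?sqr_ge0.
by field; rewrite sx (gt_eqF s0).
Qed.

(** Each side of the square contributes an arc tangent; this is the integral of [dz / z],
   up to the factor [i]. *)
Lemma square_int_inv (c : R[i]) (x0 s : R) : 0 < s ->
  square_int (fun p => c / (cpt p - x0%:C)) x0 s = 2 * pi * complex.Re c.
Proof.
move=> s0.
pose f a t := a * (2 * s / (s ^+ 2 + t ^+ 2)).
have D t : s ^+ 2 + t ^+ 2 != 0 by rewrite gt_eqF// ltr_wpDr ?sqr_ge0// exprn_gt0.
have cf a (t : R) : {for t, continuous (f a)}.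
  apply: cvgM; first exact: cvg_cst.
  apply: cvgM; first exact: cvg_cst.
  apply: cvgV => //; apply: cvgD; first exact: cvg_cst.
  exact: exprn_continuous.
have If a y : \int[leb]_(t in `[y - s, y + s]) f a (t - y) = pi * a.
  pose F (t : R) := 2 * a * atan ((t - y) / s).
  transitivity (F (y + s) - F (y - s)).
    apply: ftc_on.
    - by rewrite ltrD2l (@lt_trans _ _ 0)// oppr_lt0.
    - move=> t _; apply: (@continuous_comp _ _ _ (fun t => t - y) (f a)); last exact: cf.
      by apply: cvgB; [exact: cvg_id|exact: cvg_cst].
    - move=> t _; have h := @atan_derive s a (t - y) s0.
      have d1 : is_derive t 1 (fun t : R => t - y) 1.
        by apply: is_derive_eq; rewrite subr0.
      by have := @is_derive1_comp _ _ (fun t => t - y) t _ _ h d1; rewrite mulr1; exact.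
  rewrite /F.
  have -> : y + s - y = s by ring.
  have -> : y - s - y = - s by ring.
  rewrite mulNr mulfV ?gt_eqF// atanN atan1; lra.
have invE (u v : R) : u ^+ 2 + v ^+ 2 != 0 ->
    (u +i* v)^-1 = (u / (u ^+ 2 + v ^+ 2)) -i* (v / (u ^+ 2 + v ^+ 2)).
  move=> uv; have nz : u +i* v != 0.
    apply: contra uv; rewrite eq_complex /= => /andP[/eqP -> /eqP ->].
    by rewrite expr0n addr0.
  apply: (mulfI nz); rewrite mulfV//; apply/eqP; rewrite eq_complex /=.
have sE (u v : R) : cpt (x0 + u, v) - x0%:C = u +i* v.
  by rewrite /cpt /=; apply/eqP; rewrite eq_complex /=; apply/andP; split; apply/eqP; ring.

rewrite /square_int.
have -> : \int[leb]_(y in `[- s, s]) (complex.Re (c / (cpt (x0 + s, y) - x0%:C)) -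
    complex.Re (c / (cpt (x0 - s, y) - x0%:C))) = pi * complex.Re c.
  rewrite -(If (complex.Re c) 0) sub0r add0r; apply: eq_Rintegral => y _.
  rewrite subr0 !sE !invE ?sqrrN//; case: c => a b; rewrite /f /=.
  by have := D y; move=> ?; field.
have -> : \int[leb]_(x in `[x0 - s, x0 + s]) (complex.Im (c / (cpt (x, s) - x0%:C)) -
    complex.Im (c / (cpt (x, - s) - x0%:C))) = - (pi * complex.Re c).
  rewrite -mulrN -(If (- complex.Re c) x0); apply: eq_Rintegral => x _.
  have xE : x = x0 + (x - x0) by ring.
  rewrite [in LHS]xE !sE !invE ?sqrrN 1?addrC//; case: c => a b; rewrite /f /=.
  by have := D (x - x0); move=> ?; field.
ring.
Qed.

End Holomorphic.

(** * The almost analytic extension *)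

Section Extension.
Context {R : realType}.
Implicit Types (x y : R) (p : R * R).

Definition japR x : R := jap x%:C.

Lemma japRE x : japR x = Num.sqrt (1 + x ^+ 2).
Proof. by rewrite /japR /jap -[complex.Re `|_|]/(cabs _) cabsR real_normK// num_real. Qed.

Lemma sqr_japR x : japR x ^+ 2 = 1 + x ^+ 2.
Proof. by rewrite japRE sqr_sqrtr// addr_ge0// sqr_ge0. Qed.

Lemma japR_ge1 x : 1 <= japR x.
Proof. by rewrite japRE -[leLHS]sqrtr1 ler_sqrt ?addr_ge0 ?sqr_ge0// lerDl sqr_ge0. Qed.

Lemma japR_gt0 x : 0 < japR x. Proof. exact: lt_le_trans (japR_ge1 x). Qed.

Lemma normr_le_japR x : `|x| <= japR x.
Proof.
rewrite -ler_sqr ?nnegrE ?(ltW (japR_gt0 x))// sqr_japR real_normK ?num_real//.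
by rewrite lerDr.
Qed.

Lemma japR_le x : japR x <= 1 + `|x|.
Proof.
rewrite -ler_sqr ?nnegrE ?addr_ge0 ?(ltW (japR_gt0 x))// sqr_japR.
rewrite sqrrD expr1n mul1r real_normK ?num_real// addrAC lerDl.
by rewrite mulrn_wge0.
Qed.

Lemma powR_le_inv (b q t : R) : b < 0 -> 0 < q -> q `^ b^-1 <= t -> t `^ b <= q.
Proof.
move=> b0 q0 qt; have Q0 : 0 < q `^ b^-1 by exact: powR_gt0.
have -> : q = (q `^ b^-1) `^ b by rewrite -powRrM mulVf ?lt_eqF// powRr1// ltW.
have PN u : u `^ b = (u `^ (- b))^-1 by rewrite powRN invrK.
rewrite !PN lef_pV2 ?posrE ?powR_gt0// ?(lt_le_trans Q0)//.
by apply: ge0_ler_powR; rewrite ?nnegrE ?oppr_ge0// ltW// (lt_le_trans Q0).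
Qed.

Lemma japR_powB x b (r : nat) : japR x `^ (b - r%:R) = japR x `^ b / japR x ^+ r.
Proof.
have h : (b == r%:R) ==> (japR x != 0) by rewrite (gt_eqF (japR_gt0 x)) implybT.
by rewrite (powRB h) powR_mulrn// ltW// japR_gt0.
Qed.

Lemma is_derive_japR x : is_derive x 1 japR (x / japR x).
Proof.
have d1 : is_derive x 1 (fun t : R => 1 + t ^+ 2) (2 * x).
  by apply: is_derive_eq; rewrite /GRing.scale /=; ring.
have p0 : 0 < 1 + x ^+ 2 by rewrite ltr_wpDr ?sqr_ge0.
have := @is_derive1_comp _ Num.sqrt (fun t => 1 + t ^+ 2) x _ _ (is_derive1_sqrt p0) d1.
rewrite (_ : Num.sqrt \o _ = japR); last by apply/funext => t; rewrite /= japRE.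
rewrite -japRE => h; apply: (is_derive_eq h).
by field; rewrite gt_eqF// japR_gt0.
Qed.

Lemma is_derive_cont (f : R -> R) x l : is_derive x 1 f l -> {for x, continuous f}.
Proof.
by move=> [d _]; apply: differentiable_continuous; exact/derivable1_diffP.
Qed.

Lemma ccont_fst (g : R -> R[i]) (l : R[i]) p : cder g p.1 l -> ccont (fun q => g q.1) p.
Proof.
move=> [/is_derive_cont c1 /is_derive_cont c2]; split.
  apply: (@continuous_comp _ _ _ fst (fun t => complex.Re (g t))); [exact: cvg_fst|exact: c1].
apply: (@continuous_comp _ _ _ fst (fun t => complex.Im (g t))); [exact: cvg_fst|exact: c2].
Qed.

Lemma ccont_comp (h : R * R -> R) (g : R -> R[i]) l p :
  {for p, continuous h} -> cder g (h p) l -> ccont (g \o h) p.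
Proof.
move=> ch [/is_derive_cont c1 /is_derive_cont c2]; split.
  exact: (@continuous_comp _ _ _ h (fun t => complex.Re (g t))).
exact: (@continuous_comp _ _ _ h (fun t => complex.Im (g t))).
Qed.

Lemma ccont_real (h : R * R -> R) p : {for p, continuous h} -> ccont (fun q => (h q)%:C) p.
Proof. by move=> ch; split => //=; exact: cvg_cst. Qed.

Lemma csmooth_cder (g : R -> R[i]) (k : nat) x : csmooth g ->
  cder (cderiven k g) x (cderiven k.+1 g x).
Proof.
move=> sg; have [d1 d2] := sg k x.
by split; rewrite /= derive1E; exact/derivableP.
Qed.

Lemma cder_comp (g : R -> R[i]) (h : R -> R) x (l : R[i]) (m : R) :
  cder g (h x) l -> is_derive x 1 h m -> cder (g \o h) x (l * m%:C).
Proof.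
move=> [d1 d2] dh; split.
  apply: (is_derive_eq (is_derive1_comp d1 dh)).
  by case: l {d1 d2} => a b /=; rewrite mulr0 subr0.
apply: (is_derive_eq (is_derive1_comp d2 dh)).
by case: l {d1 d2} => a b /=; rewrite mulr0 add0r.
Qed.

Lemma cder_real (h : R -> R) x (m : R) (c : R[i]) : is_derive x 1 h m ->
  cder (fun t => c * (h t)%:C) x (c * m%:C).
Proof.
move=> dh; have dC : cder (fun t => (h t)%:C) x m%:C.
  by split => //=; exact: is_derive_cst.
have := cderM (cder_cst c x) dC; rewrite mul0r add0r; exact.
Qed.

Lemma cder_cderive (g : R -> R[i]) x l : cder g x l -> cderive g x = l.
Proof.
move=> [d1 d2]; rewrite /cderive !derive1E.
by rewrite (@derive_val _ _ _ _ _ _ _ d1) (@derive_val _ _ _ _ _ _ _ d2); case: (l).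
Qed.

Lemma is_derive_exprn (k : nat) (y : R) :
  is_derive y 1 (fun t : R => t ^+ k.+1) (k.+1%:R * y ^+ k).
Proof.
apply: DeriveDef; first exact: exprn_derivable.
by rewrite exp_derive /GRing.scale /= mulr1.
Qed.

Definition taylor_mon (r : nat) y : R[i] := ('i%C * y%:C) ^+ r / r`!%:R.

Lemma cabs_nat (k : nat) : cabs (k%:R : R[i]) = k%:R.
Proof. by rewrite -(rmorph_nat (real_complex R)) cabsR ger0_norm. Qed.

Lemma cabs_taylor_mon r y : cabs (taylor_mon r y) <= `|y| ^+ r.
Proof.
rewrite /taylor_mon cabsM cabsX cabsM cabsi mul1r cabsR cabsV cabs_nat.
by rewrite ler_piMr ?exprn_ge0// invf_le1 ?ltr0n ?fact_gt0// ler1n fact_gt0.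
Qed.

Lemma taylor_monE r : taylor_mon r = fun y => 'i%C ^+ r / r`!%:R * (y ^+ r)%:C.
Proof.
apply/funext => y; rewrite /taylor_mon exprMn_comm; last exact: mulrC.
by rewrite rmorphXn /= mulrAC.
Qed.

Lemma cder_taylor_mon r y : cder (taylor_mon r.+1) y ('i%C * taylor_mon r y).
Proof.
have dX : is_derive y 1 (fun t : R => t ^+ r.+1) (r.+1%:R * y ^+ r).
  exact: is_derive_exprn.
have := cder_real ('i%C ^+ r.+1 / r.+1`!%:R) dX.
rewrite taylor_monE; congr (cder _ _ _).
rewrite taylor_monE rmorphM /= rmorph_nat factS natrM exprS.
by field; rewrite !pnatr_eq0 -lt0n fact_gt0 /=.
Qed.

Lemma cder_taylor_mon0 y : cder (taylor_mon 0) y 0.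
Proof.
rewrite (_ : taylor_mon 0 = fun=> 1); first exact: cder_cst.
by apply/funext => t; rewrite /taylor_mon expr0 divr1.
Qed.

Lemma ccont_taylor_mon r p : ccont (fun q => taylor_mon r q.2) p.
Proof.
apply: (@ccont_comp snd (taylor_mon r) (if r is k.+1 then 'i%C * taylor_mon k p.2 else 0)).
  exact: cvg_snd.
by case: r => [|r]; [exact: cder_taylor_mon0|exact: cder_taylor_mon].
Qed.

Section Almost_analytic.
Variables (n : nat) (tau0 f : R -> R[i]).
Hypothesis sf : csmooth f.
Hypothesis ht : cutoff tau0.

Let st : csmooth tau0. Proof. by case: ht. Qed.

(** Up to unfolding, the almost analytic extension is [aa_poly * aa_cut]; the suffixes
   [x] and [y] denote partial derivatives. *)
Definition aa_poly p := \sum_(r < n.+1) cderiven r f p.1 * taylor_mon r p.2.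
Definition aa_polyx p := \sum_(r < n.+1) cderiven r.+1 f p.1 * taylor_mon r p.2.
Definition aa_polyy p :=
  \sum_(r < n.+1) cderiven r f p.1 * (if val r is k.+1 then 'i%C * taylor_mon k p.2 else 0).
Definition slope p := p.2 / japR p.1.
Definition aa_cut p := tau0 (slope p).
Definition aa_cutx p := cderive tau0 (slope p) * (- (p.2 * p.1) / japR p.1 ^+ 3)%:C.
Definition aa_cuty p := cderive tau0 (slope p) * ((japR p.1)^-1)%:C.

Definition aa p := almost_analytic n tau0 f p.1 p.2.
Definition aax p := aa_polyx p * aa_cut p + aa_poly p * aa_cutx p.
Definition aay p := aa_polyy p * aa_cut p + aa_poly p * aa_cuty p.

Lemma aaE : aa = fun p => aa_poly p * aa_cut p. Proof. by []. Qed.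

Lemma continuous_japR_fst p : {for p, continuous (fun q : R * R => japR q.1)}.
Proof.
apply: (@continuous_comp _ _ _ fst japR); first exact: cvg_fst.
exact: is_derive_cont (is_derive_japR _).
Qed.

Lemma continuous_slope p : {for p, continuous slope}.
Proof.
apply: cvgM; first exact: cvg_snd.
by apply: cvgV; [rewrite gt_eqF// japR_gt0|exact: continuous_japR_fst].
Qed.

Lemma C1at_aa p : C1at aa aax aay p.
Proof.
rewrite aaE; apply: C1atM.
- split.
  + apply: cder_sum => r; have := cderM (csmooth_cder r p.1 sf) (cder_cst (taylor_mon r p.2) p.1).
    by rewrite mulr0 addr0.
  + apply: cder_sum => r.
    have dt : cder (taylor_mon r) p.2 (if val r is k.+1 then 'i%C * taylor_mon k p.2 else 0).
      by case: r => [[|r] /= _]; [exact: cder_taylor_mon0|exact: cder_taylor_mon].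
    by have := cderM (cder_cst (cderiven r f p.1) p.2) dt; rewrite mul0r add0r.
  + apply: ccont_sum => r; apply: ccontM; last exact: ccont_taylor_mon.
    exact: ccont_fst (csmooth_cder r p.1 sf).
  + apply: ccont_sum => r; apply: ccontM; last exact: ccont_taylor_mon.
    exact: ccont_fst (csmooth_cder r.+1 p.1 sf).
  + apply: ccont_sum => r; apply: ccontM.
      exact: ccont_fst (csmooth_cder r p.1 sf).
    case: r => [[|r] /= _]; first exact: ccont_cst.
    by apply: ccontM; [exact: ccont_cst|exact: ccont_taylor_mon].
- have dJ : is_derive p.1 1 (fun u => (japR u)^-1) (- p.1 / japR p.1 ^+ 3).
    have J0 : japR p.1 != 0 by rewrite gt_eqF// japR_gt0.
    have dj := is_derive_japR p.1.
    have h := @is_deriveV _ japR p.1 _ 1 J0 dj.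
    by apply: (is_derive_eq h); rewrite /GRing.scale /=; field.
  have ds : is_derive p.1 1 (fun u => slope (u, p.2)) (- (p.2 * p.1) / japR p.1 ^+ 3).
    rewrite (_ : (fun u => _) = p.2 *: (fun u => (japR u)^-1))//.
    by apply: is_derive_eq; rewrite /GRing.scale /=; ring.
  have ds2 : is_derive p.2 1 (fun v => slope (p.1, v)) (japR p.1)^-1.
    rewrite (_ : (fun v => _) = (japR p.1)^-1 *: id); last first.
      by apply/funext => v; rewrite /slope /= mulrC.
    by apply: is_derive_eq; rewrite /GRing.scale /= mulr1.
  have dt0 : cder tau0 (slope p) (cderive tau0 (slope p)) := csmooth_cder 0 (slope p) st.
  have dt1 := csmooth_cder 1 (slope p) st.
  have pE : (p.1, p.2) = p by case: p {dJ ds ds2 dt0 dt1}.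
  split.
  + by have := @cder_comp tau0 (fun u => slope (u, p.2)) p.1 _ _ _ ds; rewrite pE; apply.
  + by have := @cder_comp tau0 (fun v => slope (p.1, v)) p.2 _ _ _ ds2; rewrite pE; apply.
  + exact: ccont_comp (@continuous_slope p) dt0.
  + apply: ccontM; first exact: ccont_comp (@continuous_slope p) dt1.
    apply: ccont_real; apply: cvgM.
      by apply: cvgN; apply: cvgM; [exact: cvg_snd|exact: cvg_fst].
    apply: cvgV; first by rewrite gt_eqF// exprn_gt0// japR_gt0.
    apply: (@continuous_comp _ _ _ (fun q : R * R => japR q.1) (fun t => t ^+ 3)).
      exact: continuous_japR_fst.
    exact: exprn_continuous.
  + apply: ccontM; first exact: ccont_comp (@continuous_slope p) dt1.
    apply: ccont_real; apply: cvgV; first by rewrite gt_eqF// japR_gt0.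
    exact: continuous_japR_fst.
Qed.

Lemma dbar_aa p : dbar (almost_analytic n tau0 f) p.1 p.2 = 2^-1 * (aax p + 'i%C * aay p).
Proof.
have [dx dy _ _ _] := C1at_aa p.
by rewrite /dbar (cder_cderive dx) (cder_cderive dy).
Qed.

(** The sum telescopes: [d/dx] raises the order of the derivative of [f], while [i d/dy]
   lowers the degree of the monomial and brings the sign [i ^ 2]. *)
Lemma aa_poly_CR p : aa_polyx p + 'i%C * aa_polyy p =
  cderiven n.+1 f p.1 * taylor_mon n p.2.
Proof.
rewrite /aa_polyx /aa_polyy big_ord_recr [X in _ + _ * X]big_ord_recl /= mulr0 add0r.
rewrite mulr_sumr addrAC -[RHS]add0r; congr (_ + _).
rewrite -big_split /= big1// => r _; rewrite add0n.
have ii : 'i%C * 'i%C = -1 :> R[i] by rewrite -expr2 sqr_i.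
move: (cderive _ _) (taylor_mon _ _) => a b.
have -> : 'i%C * (a * ('i%C * b)) = ('i%C * 'i%C) * (a * b) by ring.
by rewrite ii mulN1r subrr.
Qed.

Section Estimates.
Variables (beta C K : R).
Hypothesis C0 : 0 <= C.
Hypothesis K0 : 0 <= K.
Hypothesis fC : forall r x, (r <= n.+1)%N ->
  cabs (cderiven r f x) <= C * japR x `^ (beta - r%:R).
Hypothesis tK : forall t, cabs (tau0 t) <= K /\ cabs (cderive tau0 t) <= K.
Hypothesis t2 : forall t, 2 < `|t| -> tau0 t = 0 /\ cderive tau0 t = 0.
Hypothesis t1 : forall t, `|t| < 1 -> cderive tau0 t = 0.

Let nslope p : `|slope p| = `|p.2| / japR p.1.
Proof. by rewrite /slope normrM normfV (gtr0_norm (japR_gt0 _)). Qed.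

Lemma cabs_term r p : (r <= n.+1)%N ->
  cabs (cderiven r f p.1) * `|p.2| ^+ r <= C * japR p.1 `^ beta * `|slope p| ^+ r.
Proof.
move=> rn; rewrite nslope expr_div_n mulrA.
rewrite mulrAC ler_wpM2r ?exprn_ge0// (le_trans (fC p.1 rn))// -mulrA ler_wpM2l//.
have J0 := japR_gt0 p.1.
by rewrite japR_powB.
Qed.

Lemma aa_poly_le p : `|slope p| <= 2 ->
  cabs (aa_poly p) <= n.+1%:R * 2 ^+ n * C * japR p.1 `^ beta.
Proof.
move=> s2.
have le r : (r < n.+1)%N -> cabs (cderiven r f p.1 * taylor_mon r p.2) <= 2 ^+ n * C * japR p.1 `^ beta.
  move=> rn; rewrite cabsM (le_trans (ler_wpM2l (cabs_ge0 _) (cabs_taylor_mon r p.2)))//.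
  rewrite (le_trans (cabs_term p (ltnW rn)))//.
  rewrite (_ : 2 ^+ n * C * _ = C * japR p.1 `^ beta * 2 ^+ n); last by ring.
  rewrite ler_wpM2l ?mulr_ge0 ?powR_ge0//.
  apply: (@le_trans _ _ (2 ^+ r)); first by rewrite lerXn2r ?nnegrE.
  by rewrite ler_eXn2l ?ltr1n.
have -> : n.+1%:R * 2 ^+ n * C * japR p.1 `^ beta = \sum_(r < n.+1) (2 ^+ n * C * japR p.1 `^ beta).
  by rewrite sumr_const card_ord -[RHS]mulr_natl; ring.
rewrite /aa_poly; elim/big_ind2 : _ => [|a b c d ab cd|r _]; first by rewrite cabs0.
  by rewrite (le_trans (cabsD _ _))// lerD.
exact: le.
Qed.

Lemma aa_bound p : cabs (aa p) <= n.+1%:R * 2 ^+ n * C * K * japR p.1 `^ beta /\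
  (2 < `|slope p| -> aa p = 0).
Proof.
split; last by rewrite aaE /aa_cut => /t2[-> _]; rewrite mulr0.
have [s2|s2] := leP `|slope p| 2; last first.
  by rewrite aaE /aa_cut (t2 s2).1 mulr0 cabs0 !mulr_ge0 ?exprn_ge0 ?powR_ge0.
rewrite aaE cabsM mulrAC ler_pM ?cabs_ge0 ?aa_poly_le//.
by have [] := tK (slope p).
Qed.

(** Where the cutoff is locally constant, only the Taylor remainder is left.  Where it
   varies, the slope is between [1] and [2], so that the factor [slope ^ n] costs
   nothing. *)
Lemma dbar_bound p :
  cabs (dbar (almost_analytic n tau0 f) p.1 p.2) <=
    (C * K + n.+1%:R * 2 ^+ n * C * (3 * K)) * japR p.1 `^ (beta - 1) * `|slope p| ^+ n /\
  (2 < `|slope p| -> dbar (almost_analytic n tau0 f) p.1 p.2 = 0).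
Proof.
have J1 := japR_ge1 p.1; have J0 := japR_gt0 p.1.
have E : aax p + 'i%C * aay p =
    cderiven n.+1 f p.1 * taylor_mon n p.2 * aa_cut p +
    aa_poly p * (cderive tau0 (slope p) *
      ((- (p.2 * p.1) / japR p.1 ^+ 3)%:C + 'i%C * ((japR p.1)^-1)%:C)).
  by rewrite -aa_poly_CR /aax /aay /aa_cutx /aa_cuty; ring.
rewrite dbar_aa E; split; last first.
  by rewrite /aa_cut => /t2[-> ->]; rewrite mul0r !mulr0 addr0 mulr0.
have [s2|s2] := leP `|slope p| 2; last first.
  rewrite /aa_cut (t2 s2).1 (t2 s2).2 mul0r !mulr0 addr0 mulr0 cabs0.
  by rewrite !mulr_ge0 ?addr_ge0 ?mulr_ge0 ?exprn_ge0 ?powR_ge0.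
have [tK1 tK2] := tK (slope p).
have JE : japR p.1 `^ (beta - 1) = japR p.1 `^ beta / japR p.1.
  by have := japR_powB p.1 beta 1; rewrite expr1.
have s0 := normr_ge0 (slope p).
have B1 : cabs (cderiven n.+1 f p.1 * taylor_mon n p.2 * aa_cut p) <=
    C * K * japR p.1 `^ (beta - 1) * `|slope p| ^+ n.
  rewrite cabsM (_ : C * K * _ * _ = C * japR p.1 `^ (beta - 1) * `|slope p| ^+ n * K); last by ring.
  rewrite ler_pM ?cabs_ge0// cabsM.
  rewrite (le_trans (ler_wpM2l (cabs_ge0 _) (cabs_taylor_mon n p.2)))//.
  rewrite (le_trans (ler_wpM2r _ (fC p.1 (leqnn _))))// ?exprn_ge0//.
  rewrite nslope expr_div_n -!mulrA ler_wpM2l// mulrC [leRHS]mulrCA ler_wpM2l ?exprn_ge0//.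
  rewrite (_ : beta - n.+1%:R = (beta - 1) - n%:R); last by rewrite -natr1; ring.
  by rewrite japR_powB.
have B2 : cabs (aa_poly p * (cderive tau0 (slope p) *
      ((- (p.2 * p.1) / japR p.1 ^+ 3)%:C + 'i%C * ((japR p.1)^-1)%:C))) <=
    n.+1%:R * 2 ^+ n * C * (3 * K) * japR p.1 `^ (beta - 1) * `|slope p| ^+ n.
  have [s1|s1] := ltP `|slope p| 1.
    rewrite (t1 s1) mul0r mulr0 cabs0.
    by rewrite !mulr_ge0 ?addr_ge0 ?mulr_ge0 ?exprn_ge0 ?powR_ge0.
  rewrite cabsM.
  have D : cabs ((- (p.2 * p.1) / japR p.1 ^+ 3)%:C + 'i%C * ((japR p.1)^-1)%:C) <= 3 / japR p.1.
    rewrite (le_trans (cabsD _ _))// cabsM cabsi mul1r !cabsR.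
    rewrite [`|(japR p.1)^-1|]ger0_norm ?invr_ge0 ?(ltW J0)//.
    rewrite (_ : 3 / japR p.1 = 2 / japR p.1 + (japR p.1)^-1); last by ring.
    rewrite lerD2r normrM normfV normrN normrM normrX (gtr0_norm J0).
    have -> : `|p.2| * `|p.1| / japR p.1 ^+ 3 = `|slope p| * (`|p.1| / japR p.1) / japR p.1.
      by rewrite nslope; field; rewrite gt_eqF.
    rewrite ler_wpM2r ?invr_ge0 ?(ltW J0)// -[leRHS]mulr1 ler_pM ?mulr_ge0 ?invr_ge0 ?(ltW J0)//.
    by rewrite ler_pdivrMr// mul1r normr_le_japR.
  have D2 : cabs (cderive tau0 (slope p) *
      ((- (p.2 * p.1) / japR p.1 ^+ 3)%:C + 'i%C * ((japR p.1)^-1)%:C)) <= K * (3 / japR p.1).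
    by rewrite cabsM ler_pM ?cabs_ge0.
  apply: (@le_trans _ _ ((n.+1%:R * 2 ^+ n * C * japR p.1 `^ beta) * (K * (3 / japR p.1)))).
    by rewrite ler_pM ?cabs_ge0// aa_poly_le.
  rewrite JE -[leLHS]mulr1 (_ : _ * (K * _) = n.+1%:R * 2 ^+ n * C * (3 * K) * (japR p.1 `^ beta / japR p.1)); last by ring.
  rewrite ler_wpM2l ?exprn_ege1//.
  by rewrite !mulr_ge0 ?exprn_ge0 ?powR_ge0 ?invr_ge0 ?(ltW J0).
rewrite cabsM cabsV cabs_nat.
apply: (@le_trans _ _ (1 * (C * K * japR p.1 `^ (beta - 1) * `|slope p| ^+ n +
   n.+1%:R * 2 ^+ n * C * (3 * K) * japR p.1 `^ (beta - 1) * `|slope p| ^+ n))).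
  rewrite ler_pM ?cabs_ge0 ?invr_ge0//; first by rewrite invf_le1// ler1n.
  by rewrite (le_trans (cabsD _ _))// lerD.
by rewrite mul1r !mulrDl.
Qed.

End Estimates.

End Almost_analytic.

End Extension.

(** * An integrable majorant *)

Section Majorant.
Context {R : realType}.
Notation leb := (@lebesgue_measure R).
Notation leb2 := (leb \x leb)%E.
Notation plane := (measurableTypeR R * measurableTypeR R)%type.

Lemma cutoff_derive0 (tau0 : R -> R[i]) (t d : R) (c : R[i]) : 0 < d ->
  (forall h, `|h| < d -> tau0 (t + h) = c) -> cderive tau0 t = 0.
Proof.
move=> d0 H; have Ht : tau0 t = c by rewrite -(addr0 t) H// normr0.
apply: cder_cderive; split; apply: (@is_derive_quad _ _ _ _ 0 d) => // h hd;
  by rewrite H// Ht subrr !mul0r subrr normr0.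
Qed.

(** Outside of the compact interval [[-2, 2]], the cutoff and its derivative vanish. *)
Lemma cutoff_consts (tau0 : R -> R[i]) : cutoff tau0 ->
  [/\ exists2 K, 0 <= K & forall t, cabs (tau0 t) <= K /\ cabs (cderive tau0 t) <= K,
      forall t, 2 < `|t| -> tau0 t = 0 /\ cderive tau0 t = 0 &
      forall t, `|t| < 1 -> cderive tau0 t = 0].
Proof.
move=> [st t1 t2].
have T2 t : 2 < `|t| -> tau0 t = 0 /\ cderive tau0 t = 0.
  move=> ht; split; first by rewrite t2// ltW.
  apply: (@cutoff_derive0 _ _ (`|t| - 2) 0); first by rewrite subr_gt0.
  move=> h hd; apply: t2; have := lerB_dist t (- h); rewrite normrN opprK; lra.
split => //; last first.
  move=> t ht; apply: (@cutoff_derive0 _ _ (1 - `|t|) 1); first by rewrite subr_gt0.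
  by move=> h hd; apply: t1; have := ler_normD t h; lra.
have bd (g : R -> R[i]) : (forall t, cder g t (cderive g t)) ->
    exists2 K, 0 <= K & forall t, `|t| <= 2 -> cabs (g t) <= K.
  move=> dg.
  have c1 : {within `[(-2), 2], continuous (fun t => `|complex.Re (g t)| + `|complex.Im (g t)|)}.
    apply: continuous_subspaceT => t; have [/is_derive_cont c1 /is_derive_cont c2] := dg t.
    by apply: cvgD; apply: cvg_norm.
  have [|c _ Hc] := EVT_max _ c1; first by lra.
  exists (`|complex.Re (g c)| + `|complex.Im (g c)|); first exact: addr_ge0.
  move=> t; rewrite ler_norml => /andP[h1 h2]; apply: (le_trans (cabs_le _)).
  by apply: Hc; rewrite in_itv /= h1 h2.
have [K1 K10 HK1] := bd tau0 (fun t => csmooth_cder 0 t st).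
have [K2 K20 HK2] := bd (cderive tau0) (fun t => csmooth_cder 1 t st).
exists (K1 + K2); first exact: addr_ge0.
move=> t; have [ht|ht] := leP `|t| 2.
  by have := HK1 t ht; have := HK2 t ht; split; lra.
by have [-> ->] := T2 t ht; rewrite cabs0 addr_ge0.
Qed.

Lemma symbol_consts (beta : R) (f : R -> R[i]) n : symbol beta f ->
  exists2 C, 0 <= C & forall r x, (r <= n)%N ->
    cabs (cderiven r f x) <= C * japR x `^ (beta - r%:R).
Proof.
move=> [_ H]; elim: n => [|n [C C0 HC]].
    have [c c0 Hc] := H 0%N; exists c; first exact: ltW.
  by move=> r x; rewrite leqn0 => /eqP ->; exact: Hc.
have [c c0 Hc] := H n.+1.
exists (C + c) => [|r x]; first by rewrite addr_ge0// ltW.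
rewrite leq_eqVlt => /orP[/eqP ->|/HC h].
  by apply: (le_trans (Hc x)); rewrite ler_wpM2r ?powR_ge0// lerDr.
by apply: (le_trans (h x)); rewrite ler_wpM2r ?powR_ge0// lerDl ltW.
Qed.

(** Up to sign, the derivative of [1 / (s (1 + (k + t) ^ s))] on the half line: it is
   integrable, of order [|t| ^ (- s - 1)] at infinity and, for [k = 0], of order
   [|t| ^ (s - 1)] at [0]. *)
Definition bump (k s t : R) : R := (k + `|t|) `^ (s - 1) / (1 + (k + `|t|) `^ s) ^+ 2.

Lemma bump_ge0 k s t : 0 <= bump k s t.
Proof. by rewrite divr_ge0 ?powR_ge0// sqr_ge0. Qed.

Lemma bump_deriv (k s t : R) : 0 < s -> 0 <= k -> 0 < t ->
  is_derive t 1 (fun u => - s^-1 * (1 + (k + u) `^ s)^-1) (bump k s t).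
Proof.
move=> s0 k0 t0; have kt : 0 < k + t by rewrite ltr_wpDl.
have d1 : is_derive t 1 (fun u : R => k + u) 1.
  exact: (is_derive_eq (is_deriveD (is_derive_cst k t 1) (is_derive_id t 1)) (add0r 1)).
have d2 : is_derive t 1 (fun u : R => (k + u) `^ s) (s * (k + t) `^ (s - 1)).
  have := @is_derive1_comp _ (fun v : R => v `^ s) (fun u => k + u) t _ _ (is_derive1_powR s kt) d1.
  by rewrite mulr1; exact.
have d3 : is_derive t 1 (fun u : R => 1 + (k + u) `^ s) (s * (k + t) `^ (s - 1)).
  have := is_deriveD (is_derive_cst (1 : R) t 1) d2; rewrite add0r; exact.
have p0 : 1 + (k + t) `^ s != 0 by rewrite gt_eqF// ltr_wpDr// powR_ge0.
have d4 := @is_deriveV _ (fun u : R => 1 + (k + u) `^ s) t _ 1 p0 d3.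
rewrite (_ : (fun u => _) = (- s^-1) *: (fun u => (1 + (k + u) `^ s)^-1))//.
apply: is_derive_eq; rewrite /GRing.scale /= /bump (gtr0_norm t0).
by field; rewrite (gt_eqF s0) p0.
Qed.

Lemma bump_cont (k s t : R) : 0 <= k -> t != 0 -> {for t, continuous (bump k s)}.
Proof.
move=> k0 t0; have kt : 0 < k + `|t| by rewrite ltr_wpDl// normr_gt0.
have cp a : {for t, continuous (fun u : R => (k + `|u|) `^ a)}.
  apply: (@continuous_comp _ _ _ (fun u : R => k + `|u|) (fun v : R => v `^ a)).
    by apply: cvgD; [exact: cvg_cst|apply: cvg_norm; exact: cvg_id].
  exact: is_derive_cont (is_derive1_powR a kt).
apply: cvgM; first exact: cp.
apply: cvgV; first by rewrite gt_eqF// exprn_gt0// ltr_wpDr// powR_ge0.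
apply: (@continuous_comp _ _ _ (fun u : R => 1 + (k + `|u|) `^ s) (fun u => u ^+ 2)).
  by apply: cvgD; [exact: cvg_cst|exact: cp].
exact: exprn_continuous.
Qed.

Lemma measurable_bump k s : 0 <= k ->
  measurable_fun setT (bump k s : measurableTypeR R -> measurableTypeR R).
Proof.
move=> k0; rewrite -(setUv [set 0 : R]); apply/measurable_funU.
- exact: measurable_set1.
- by apply: measurableC; exact: measurable_set1.
split; first exact: measurable_fun_set1.
apply: open_continuous_measurable_fun.
  by rewrite openC; exact: (accessible_closed_set1 (hausdorff_accessible (@Rhausdorff R))).
by move=> t; rewrite inE /= => /eqP t0; exact: bump_cont.
Qed.

Lemma bump_integral_le (k s a b : R) : 0 < s -> 0 <= k -> 0 < a -> a < b ->
  \int[leb]_(t in `[a, b]) bump k s t <= s^-1 /\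
  \int[leb]_(t in `[- b, - a]) bump k s t <= s^-1.
Proof.
move=> s0 k0 a0 ab.
have p0 t : 0 < 1 + (k + t) `^ s by rewrite ltr_wpDr// powR_ge0.
pose F u := - s^-1 * (1 + (k + u) `^ s)^-1.
have q t : 0 <= - F t <= s^-1.
  rewrite /F mulNr opprK mulr_ge0 ?invr_ge0 ?(ltW (p0 _)) ?(ltW s0)//=.
  by rewrite ler_piMr ?invr_ge0 ?(ltW s0)// invf_le1// lerDl powR_ge0.
split.
- have -> : \int[leb]_(t in `[a, b]) bump k s t = F b - F a; last first.
    by have := q a; have := q b; lra.
  apply: ftc_on => // t /andP[at_ _].
    by apply: bump_cont => //; rewrite gt_eqF//; exact: lt_le_trans at_.
  by apply: bump_deriv => //; exact: lt_le_trans at_.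
- pose G u := - F (- u).
  have -> : \int[leb]_(t in `[- b, - a]) bump k s t = G (- a) - G (- b).
    apply: ftc_on => [|t /andP[_ ta]|t /andP[_ ta]]; first by rewrite ltrN2.
      by apply: bump_cont => //; rewrite lt_eqF// (le_lt_trans ta)// oppr_lt0.
    have t0 : 0 < - t by rewrite oppr_gt0 (le_lt_trans ta)// oppr_lt0.
    have dN : is_derive t 1 (fun u : R => - u) (- 1).
      exact: (is_deriveN (is_derive_id t 1)).
    have := @is_derive1_comp _ F (fun u : R => - u) t _ _ (bump_deriv s0 k0 t0) dN.
    move=> /is_deriveN h; apply: (is_derive_eq h).
    by rewrite mulrN1 opprK /bump normrN.
  by rewrite /G !opprK; have := q a; have := q b; lra.
Qed.

(** The explicit primitive bounds the integrals over an exhaustion of the complement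
   of [0]. *)
Lemma integrable_bump (k s : R) : 0 < s -> 0 <= k ->
  leb.-integrable setT (EFin \o bump k s).
Proof.
move=> s0 k0; have mb := measurable_bump s k0.
have mE : measurable_fun setT (EFin \o bump k s : measurableTypeR R -> \bar R) by exact/measurable_EFinP.
apply/integrableP; split => //.
have -> : (\int[leb]_x `|(EFin \o bump k s) x| = \int[leb]_x (bump k s x)%:E)%E.
  by apply: eq_integral => x _ /=; rewrite ger0_norm// bump_ge0.
pose A (i : nat) : set R := `[i.+1%:R^-1, i.+1%:R + 1]%classic.
pose B (i : nat) : set R := `[- (i.+1%:R + 1), - i.+1%:R^-1]%classic.
pose D i := B i `|` A i.
have i0 (i : nat) : 0 < i.+1%:R^-1 :> R by rewrite invr_gt0.
have i1 (i : nat) : i.+1%:R^-1 < i.+1%:R + 1 :> R.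
  by rewrite (@le_lt_trans _ _ 1)// ?invf_le1// ?ler1n// ltrDr.
have mA i : measurable (A i) by exact: measurable_itv.
have mB i : measurable (B i) by exact: measurable_itv.
have mD i : measurable (D i) by exact: measurableU.
have ndD : nondecreasing_seq D.
  move=> i j ij; apply/subsetPset.
  have v : j.+1%:R^-1 <= i.+1%:R^-1 :> R by rewrite lef_pV2 ?posrE// ler_nat.
  have w : i.+1%:R + 1 <= j.+1%:R + 1 :> R by rewrite lerD2r ler_nat.
  rewrite /D /A /B => x [|] /=; rewrite in_itv /= => /andP[h1 h2]; [left|right]; rewrite /= in_itv /=.
    by rewrite (le_trans _ h1) ?lerN2// (le_trans h2)// lerN2.
  by rewrite (le_trans v h1) (le_trans h2).
have UD : \bigcup_i D i = ~` [set 0].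
  rewrite /D /A /B; apply/seteqP; split=> [x [i _ [|]] /=|x /= /eqP x0].
  - by rewrite in_itv /= => /andP[_ h] xE; move: h; rewrite xE oppr_ge0 leNgt i0.
  - by rewrite in_itv /= => /andP[h _] xE; move: h; rewrite xE leNgt i0.
  - have n0 : 0 < `|x| by rewrite normr_gt0.
    pose N := Num.truncn (`|x| + `|x|^-1).
    have hN : `|x| + `|x|^-1 < N.+1%:R by rewrite truncnS_gt.
    have h1 : `|x| <= N.+1%:R + 1.
      by rewrite ltW// (@lt_trans _ _ (N.+1%:R))// ?ltrDl// (le_lt_trans _ hN)// lerDl invr_ge0.
    have h2 : N.+1%:R^-1 <= `|x|.
      rewrite -[leRHS]invrK lef_pV2 ?posrE ?invr_gt0// ltW// (le_lt_trans _ hN)//.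
      by rewrite lerDr.
    exists N => //; move: x0; rewrite neq_lt => /orP[x0|x0]; [left|right]; rewrite /= in_itv /=.
      by move: h1 h2; rewrite ltr0_norm// => h1 h2; rewrite lerNl h1 lerNr h2.
    by move: h1 h2; rewrite gtr0_norm// => -> ->.
have -> : (\int[leb]_x (bump k s x)%:E = \int[leb]_(x in \bigcup_i D i) (bump k s x)%:E)%E.
  rewrite UD -setTD; apply: ge0_negligible_integral => //.
  - by move=> x _; rewrite lee_fin bump_ge0.
  - exact: lebesgue_measure_set1.
have cv : (\int[leb]_(x in D i) (bump k s x)%:E)%E @[i --> \oo] -->
    (\int[leb]_(x in \bigcup_i D i) (bump k s x)%:E)%E.
  apply: ge0_nondecreasing_set_cvg_integral => //.
  - by move=> i; exact: measurable_funS measurableT (@subsetT _ _) mE.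
  - by move=> i x _; rewrite lee_fin bump_ge0.
apply: (@le_lt_trans _ _ (s^-1 + s^-1)%:E); last exact: ltry.
rewrite -(cvg_lim _ cv)//; apply: lime_le; first by apply/cvg_ex; eexists; exact: cv.
apply: nearW => i; rewrite (@ge0_integral_setU _ _ _ leb (B i) (A i) (mB i) (mA i))//; last 3 first.
- exact: measurable_funS measurableT (@subsetT _ _) mE.
- by move=> x _; rewrite lee_fin bump_ge0.
- rewrite /A /B; apply/disj_setPS => x [/=]; rewrite !in_itv /= => /andP[_ h1] /andP[h2 _].
  have := le_trans h2 h1; rewrite leNgt (@lt_trans _ _ 0)// ?oppr_lt0//.
have fi a b : 0 < a -> leb.-integrable `[a, b] (EFin \o bump k s).
  by move=> a0; apply: cont_on_integrable => x /andP[ax _]; apply: bump_cont => //; rewrite gt_eqF// (lt_le_trans a0).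
have fj a b : 0 < a -> leb.-integrable `[b, - a] (EFin \o bump k s).
  by move=> a0; apply: cont_on_integrable => x /andP[_ ax]; apply: bump_cont => //; rewrite lt_eqF// (le_lt_trans ax)// oppr_lt0.
have [b1 b2] := bump_integral_le s0 k0 (i0 i) (i1 i).
rewrite EFinD; apply: leeD.
- move: b2; rewrite -lee_fin /Rintegral fineK//.
  by apply: integrable_fin_num => //; exact: fj.
- move: b1; rewrite -lee_fin /Rintegral fineK//.
  by apply: integrable_fin_num => //; exact: fi.
Qed.

Lemma integrable_bump2 (M k1 k2 s : R) : 0 < s -> 0 <= k1 -> 0 <= k2 ->
  leb2.-integrable setT (fun p => (M * (bump k1 s p.1 * bump k2 s p.2))%:E).
Proof.
move=> s0 k10 k20.
have m1 := measurable_bump s k10; have m2 := measurable_bump s k20.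
have mb : measurable_fun setT (fun p : plane => bump k1 s p.1 * bump k2 s p.2 : measurableTypeR R).
  apply: measurable_funM.
    by apply: (measurableT_comp m1); exact: measurable_fst.
  by apply: (measurableT_comp m2); exact: measurable_snd.
under eq_fun do rewrite EFinM.
apply: integrableZl => //.
apply/integrable12ltyP; first exact/measurable_EFinP.
have I1 := integrable_bump s0 k10; have I2 := integrable_bump s0 k20.
have f2 : (\int[leb]_y (bump k2 s y)%:E \is a fin_num)%E by exact: integrable_fin_num.
have -> : (\int[leb]_x \int[leb]_y `|(bump k1 s (x, y).1 * bump k2 s (x, y).2)%:E| =
   \int[leb]_x (bump k1 s x)%:E * \int[leb]_y (bump k2 s y)%:E)%E.
  rewrite -(fineK f2) -integralZr//; apply: eq_integral => x _.
  rewrite (fineK f2) -integralZl//; apply: eq_integral => y _ /=.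
  by rewrite -EFinM ger0_norm// mulr_ge0// bump_ge0.
have f1 : (\int[leb]_y (bump k1 s y)%:E \is a fin_num)%E by exact: integrable_fin_num.
by rewrite -(fineK f1) -(fineK f2) -EFinM ltry.
Qed.

Lemma jap_le (p : R * R) : `|slope p| <= 2 -> jap (cpt p) <= 3 * japR p.1.
Proof.
move=> s2; have J0 := japR_gt0 p.1.
have y2 : `|p.2| <= 2 * japR p.1.
  by rewrite -ler_pdivrMr// -[X in _ / X](gtr0_norm J0) -normf_div.
rewrite /jap -/(cabs _) -[leRHS]ger0_norm; last by rewrite mulr_ge0// ltW.
rewrite -sqrtr_sqr ler_wsqrtr// sqr_cabs /cpt /= exprMn sqr_japR.
have : `|p.2| ^+ 2 <= (2 * japR p.1) ^+ 2 by rewrite lerXn2r ?nnegrE// mulr_ge0// ltW.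
rewrite real_normK ?num_real// exprMn sqr_japR.
have := sqr_ge0 p.1; lra.
Qed.

(** With [u = |y| / <x>], the left-hand side is at most a constant times
   [<x> ^ (beta - 1) u ^ (n - alpha) / |y|] with [u <= 2].  Part of the decay in [x] and
   of the vanishing at [u = 0] is spent on making the bound integrable in [x] at
   infinity and in [y] at [0] and at infinity. *)
Lemma dbar_majorant (n : nat) (tau0 f : R -> R[i]) (alpha : R) :
  calA f -> cutoff tau0 -> 0 <= alpha -> alpha < n%:R ->
  exists M s, [/\ 0 < s, 0 <= M & forall p : R * R, p.2 != 0 ->
    cabs (dbar (almost_analytic n tau0 f) p.1 p.2) *
      (`|p.2|^-1 * (jap (cpt p) / `|p.2|) `^ alpha) <=
    M * (bump 1 s p.1 * bump 0 s p.2)].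
Proof.
move=> [beta b0 sf] ht a0 an.
have [C C0 fC] := symbol_consts n.+1 sf.
have [[K K0 tK] t2 t1] := cutoff_consts ht.
have DB p := @dbar_bound R n tau0 f sf.1 ht beta C K C0 K0 fC tK t2 t1 p.
set M0 := C * K + _ in DB.
have M00 : 0 <= M0 by rewrite addr_ge0 ?mulr_ge0 ?exprn_ge0.
(* The decay [<x> ^ (- 2 s)] of [f] and the factor [u ^ s = |y| ^ s / <x> ^ s] together
   pay for [1 + <x> ^ s] and for [(1 + |y| ^ s) ^ 2], as [|y| <= 2 <x>]. *)
pose s := Num.min (Num.min (n%:R - alpha) 1) (- beta / 2).
have s0 : 0 < s by rewrite !lt_min subr_gt0 an ltr01/= divr_gt0// oppr_gt0.
have s1 : s <= 1 by rewrite !ge_min lexx orbT.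
have sna : s <= n%:R - alpha by rewrite !ge_min lexx.
have sb : beta <= - s - s.
  have : s <= - beta / 2 by rewrite ge_min lexx orbT.
  lra.
pose e := n%:R - alpha - s.
have e0 : 0 <= e by rewrite subr_ge0.
exists (162 * (M0 * (3 `^ alpha * 2 `^ e))), s; split => //.
  by rewrite !mulr_ge0 ?powR_ge0.
move=> p y0; have ny0 : 0 < `|p.2| by rewrite normr_gt0.
have [DB1 DB2] := DB p.
have [s2|s2] := leP `|slope p| 2; last first.
  by rewrite (DB2 s2) cabs0 mul0r !mulr_ge0 ?powR_ge0 ?bump_ge0.
set J := japR p.1 in DB1 *; have J0 : 0 < J := japR_gt0 p.1.
have J1 : 1 <= J := japR_ge1 p.1.
set u := `|slope p| in DB1 DB2 s2 *.
have uE : u = `|p.2| / J by rewrite /u /slope normrM normfV (gtr0_norm J0).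
have u0 : 0 < u by rewrite uE divr_gt0.
have yE : `|p.2| = u * J by rewrite uE divfK// gt_eqF.
have jy : jap (cpt p) / `|p.2| <= 3 / u.
  rewrite ler_pdivrMr// yE mulrA divfK ?gt_eqF//; exact: jap_le.
have japp : 0 <= jap (cpt p) by rewrite /jap sqrtr_ge0.
have Q1 : (jap (cpt p) / `|p.2|) `^ alpha <= 3 `^ alpha * u `^ (- alpha).
  apply: (@le_trans _ _ ((3 / u) `^ alpha)).
    by apply: ge0_ler_powR => //; rewrite nnegrE ?divr_ge0// ltW.
  rewrite powRM ?invr_ge0 ?(ltW u0)//.
  by rewrite ler_wpM2l ?powR_ge0// -powR_inv1 ?(ltW u0)// -powRrM mulN1r powRN.
set X := J `^ s; set Y := `|p.2| `^ s; set v := 1 + `|p.1|; set V := v `^ s.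
have v1 : 1 <= v by rewrite lerDl.
have v0 : 0 < v := lt_le_trans ltr01 v1.
have vJ : v <= 2 * J by have := normr_le_japR p.1; rewrite -/J /v; lra.
have Jv : J <= v by exact: japR_le.
have X1 : 1 <= X by rewrite -(powRr0 J); apply: ler_powR => //; exact: ltW.
have X0 : 0 < X := lt_le_trans ltr01 X1.
have two_s : 2 `^ s <= 2 :> R.
  by rewrite -[leRHS]powRr1//; apply: ler_powR => //; rewrite ler1n.
have pX (t : R) : 0 <= t -> t <= 2 * J -> t `^ s <= 2 * X.
  move=> t0 tJ; apply: (@le_trans _ _ ((2 * J) `^ s)).
    by apply: ge0_ler_powR => //; rewrite ?nnegrE ?(ltW s0)// (le_trans t0).
  by rewrite powRM// ?(ltW J0)// ler_wpM2r// (ltW X0).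
have Y2 : Y <= 2 * X by apply: pX => //; rewrite yE ler_wpM2r// ltW.
have V2 : V <= 2 * X by apply: pX => //; exact: ltW.
have XV : X <= V by apply: ge0_ler_powR; rewrite ?nnegrE// ltW.
have Y0 : 0 <= Y := powR_ge0 _ _.
have E1 : u `^ n%:R * u `^ (- alpha) = Y / X * u `^ e.
  rewrite -powRD; last by rewrite (gt_eqF u0) implybT.
  have -> : n%:R - alpha = s + e by rewrite /e; ring.
  rewrite powRD; last by rewrite (gt_eqF u0) implybT.
  congr (_ * _); rewrite /Y yE powRM ?(ltW u0) ?(ltW J0)// mulfK// gt_eqF//.
have ue : u `^ e <= 2 `^ e by apply: ge0_ler_powR; rewrite ?nnegrE// ltW.
have b1E : bump 1 s p.1 = V / v / (1 + V) ^+ 2.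
  rewrite /bump -/v -/V; congr (_ / _).
  by rewrite powRB ?(gt_eqF v0) ?implybT// powRr1// ltW.
have b2E : bump 0 s p.2 = Y / `|p.2| / (1 + Y) ^+ 2.
  rewrite /bump add0r -/Y; congr (_ / _).
  by rewrite powRB ?(gt_eqF ny0) ?implybT// powRr1.
have Jb : J `^ (beta - 1) <= X^-1 ^+ 2 / J.
  rewrite powRB ?(gt_eqF J0) ?implybT// powRr1 ?(ltW J0)//.
  rewrite ler_wpM2r ?invr_ge0 ?(ltW J0)//.
  apply: (@le_trans _ _ (J `^ (- s - s))); first exact: ler_powR.
  by rewrite powRD ?(gt_eqF J0) ?implybT// powRN -expr2.
have cb0 := cabs_ge0 (dbar (almost_analytic n tau0 f) p.1 p.2).
have iy0 : 0 <= `|p.2|^-1 by rewrite invr_ge0.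
apply: (@le_trans _ _ ((M0 * (X^-1 ^+ 2 / J) * u ^+ n) * (`|p.2|^-1 * (3 `^ alpha * u `^ (- alpha))))).
  apply: ler_pM => //; first by rewrite mulr_ge0 ?powR_ge0.
    apply: (le_trans DB1); rewrite ler_wpM2r ?exprn_ge0 ?(ltW u0)//.
    by rewrite ler_wpM2l.
  by rewrite ler_wpM2l.
have -> : M0 * (X^-1 ^+ 2 / J) * u ^+ n * (`|p.2|^-1 * (3 `^ alpha * u `^ (- alpha))) =
  M0 * 3 `^ alpha * (X^-1 ^+ 2 / J) * `|p.2|^-1 * (u `^ n%:R * u `^ (- alpha)).
  by rewrite powR_mulrn ?(ltW u0)//; ring.
rewrite E1 b1E b2E.
apply: (@le_trans _ _ (M0 * 3 `^ alpha * (X^-1 ^+ 2 / J) * `|p.2|^-1 * (Y / X * 2 `^ e))).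
  rewrite !ler_wpM2l// ?divr_ge0 ?(ltW X0)//.
  by rewrite !mulr_ge0 ?powR_ge0 ?exprn_ge0 ?invr_ge0 ?(ltW X0) ?(ltW J0).
have key : X^-1 ^+ 2 / J / X <= 162 * (V / v / (1 + V) ^+ 2 / (1 + Y) ^+ 2).
  have V0 : 0 < V := lt_le_trans X0 XV.
  have pV : 0 < (1 + V) ^+ 2 by rewrite exprn_gt0// ltr_wpDr// ltW.
  have pY : 0 < (1 + Y) ^+ 2 by rewrite exprn_gt0// ltr_wpDr.
  rewrite !mulrA ler_pdivlMr// ler_pdivlMr//.
  have h1 : (1 + V) ^+ 2 <= (3 * X) ^+ 2.
    by rewrite lerXn2r ?nnegrE ?addr_ge0 ?mulr_ge0 ?(ltW X0) ?(ltW V0)//; lra.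
  have h2 : (1 + Y) ^+ 2 <= (3 * X) ^+ 2.
    by rewrite lerXn2r ?nnegrE ?addr_ge0 ?mulr_ge0 ?(ltW X0)//; lra.
  have h3 : 0 <= X^-1 ^+ 2 / J / X by rewrite !divr_ge0 ?exprn_ge0 ?invr_ge0 ?(ltW X0) ?(ltW J0).
  apply: (@le_trans _ _ (X^-1 ^+ 2 / J / X * (3 * X) ^+ 2 * (3 * X) ^+ 2)).
    apply: ler_pM; [by rewrite mulr_ge0 ?sqr_ge0|exact: sqr_ge0|by rewrite ler_wpM2l|exact: h1].
  have -> : X^-1 ^+ 2 / J / X * (3 * X) ^+ 2 * (3 * X) ^+ 2 = 81 * X / J.
    by field; rewrite (gt_eqF X0) (gt_eqF J0).
  rewrite ler_pdivrMr// mulrAC ler_pdivlMr// -!mulrA.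
  apply: (@le_trans _ _ (81 * (X * (2 * J)))).
    by rewrite ler_wpM2l// ler_wpM2l// ltW.
  rewrite (_ : 81 * (X * (2 * J)) = 162 * (X * J)); last by ring.
  by rewrite ler_wpM2l// ler_wpM2r// ltW.
have -> : M0 * 3 `^ alpha * (X^-1 ^+ 2 / J) / `|p.2| * (Y / X * 2 `^ e) =
  (M0 * (3 `^ alpha * 2 `^ e)) * (Y / `|p.2|) * (X^-1 ^+ 2 / J / X) by ring.
have -> : 162 * (M0 * (3 `^ alpha * 2 `^ e)) * (V / v / (1 + V) ^+ 2 * (Y / `|p.2| / (1 + Y) ^+ 2)) =
  (M0 * (3 `^ alpha * 2 `^ e)) * (Y / `|p.2|) * (162 * (V / v / (1 + V) ^+ 2 / (1 + Y) ^+ 2)) by ring.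
rewrite ler_wpM2l//.
by rewrite !mulr_ge0 ?powR_ge0.
Qed.

End Majorant.

(** * The scalar Helffer-Sjostrand formula *)

Section OffAxis.
Context {R : realType}.
Notation leb := (@lebesgue_measure R).
Notation leb2 := (leb \x leb)%E.
Notation plane := (measurableTypeR R * measurableTypeR R)%type.

Definition off_axis : set plane := [set p | p.2 != 0].

Lemma open_off_axis : open (off_axis : set (R * R)).
Proof.
rewrite (_ : off_axis = snd @^-1` [set~ (0 : R)]); last first.
  by apply/seteqP; split=> p /= /eqP.
apply: open_comp; first by move=> p _; exact: cvg_snd.
by rewrite openC; exact: (accessible_closed_set1 (hausdorff_accessible (@Rhausdorff R))).
Qed.

Lemma measurable_off_axis : measurable off_axis.
Proof. exact: (open_measurable2 open_off_axis). Qed.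

Lemma axis_null : leb2 (~` off_axis) = 0%E.
Proof.
rewrite (_ : ~` off_axis = [set: R] `*` [set (0 : R)]); last first.
  apply/seteqP; split=> [p /negP|[x y] [_ /= ->]]; first by rewrite negbK => /eqP.
  by apply/negP; rewrite negbK.
rewrite product_measure1E//.
by rewrite [X in (_ * X)%E](lebesgue_measure_set1 (0 : R)) mule0.
Qed.

Lemma Rintegral_off_axis (D : set plane) (f : plane -> R) :
  measurable D -> leb2.-integrable D (EFin \o f) ->
  \int[leb2]_(p in D) f p = \int[leb2]_(p in off_axis) (f \_ D) p.
Proof.
move=> mD fi; rewrite /Rintegral; congr fine.
rewrite (@negligible_integral _ _ _ leb2 D (~` off_axis))//; last 2 first.
- by apply: measurableC; exact: measurable_off_axis.
- exact: axis_null.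
rewrite setDE setCK setIC integral_mkcondr; apply: eq_integral => p _.
by rewrite !patchE; case: ifP.
Qed.

End OffAxis.

Section FrameIndicator.
Context {R : realType}.
Notation plane := (measurableTypeR R * measurableTypeR R)%type.
Implicit Types (x y a b : R).

Lemma frame_arith x a : 0 < a ->
  [/\ (x <= x - a) = false, (x + a <= x) = false, (a <= 0) = false & (0 <= - a) = false].
Proof. by move=> a0; split; apply/negbTE; rewrite -ltNge; lra. Qed.

Lemma large_index x y : 0 <= x -> 0 < y -> exists j0, forall j, (j0 <= j)%N ->
  [/\ x <= j.+2%:R, y <= j.+2%:R, j.+1%:R^-1 < y & x != 0 -> j.+1%:R^-1 < x].
Proof.
move=> x0 y0; exists (Num.truncn (x + y + y^-1 + x^-1)) => j Nj.
have ix0 : 0 <= x^-1 by rewrite invr_ge0.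
have iy0 : 0 < y^-1 by rewrite invr_gt0.
have h : x + y + y^-1 + x^-1 < j.+1%:R.
  by rewrite (lt_le_trans (truncnS_gt _))// ler_nat.
have h' : j.+1%:R <= j.+2%:R :> R by rewrite ler_nat.
have aN (t : R) : 0 < t -> t^-1 < j.+1%:R -> j.+1%:R^-1 < t.
  by move=> t0 ht'; rewrite -[ltRHS]invrK ltf_pV2 ?posrE ?invr_gt0.
split; [lra|lra|apply: aN => //; lra|].
by move=> xx; apply: aN; [rewrite lt_neqAle eq_sym xx|lra].
Qed.

(** A point off the axis is in exactly one rectangle of a large enough frame: its first
   coordinate is either [x0] or at a distance from [x0] larger than [a]. *)
Lemma frame_indic x0 a b (p : plane) : 0 < a -> `|p.1 - x0| <= b -> `|p.2| <= b ->
  a < `|p.2| -> p.1 = x0 \/ a < `|p.1 - x0| ->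
  \1_(rect (x0 - b) (x0 - a) (- b) b) p + \1_(rect (x0 + a) (x0 + b) (- b) b) p +
  \1_(rect (x0 - a) (x0 + a) a b) p + \1_(rect (x0 - a) (x0 + a) (- b) (- a)) p = 1 :> R.
Proof.
move=> a0 h1 h2 h3 h4; rewrite !indicE.
have mem (c1 d1 e1 f1 : R) : (p \in rect c1 d1 e1 f1) = (c1 <= p.1 <= d1) && (e1 <= p.2 <= f1).
  by rewrite /rect in_setX !mem_setE !in_itv.
rewrite !mem.
move: h1 h2; rewrite !ler_norml => /andP[h11 h12] /andP[h21 h22].
have -> : x0 - b <= p.1 by lra.
have -> : p.1 <= x0 + b by lra.
rewrite h21 h22 !andbT /=.
have h4' : p.1 = x0 \/ (a < p.1 - x0 \/ p.1 - x0 < - a).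
  case: h4 => [->|]; first by left.
  by rewrite ltr_normr => /orP[h|h]; right; [left|right]; lra.
have h3' : a < p.2 \/ p.2 < - a.
  by move: h3; rewrite ltr_normr => /orP[h|h]; [left|right]; lra.
have F1 (u v : R) : u < v -> (v <= u) = false by move=> uv; rewrite leNgt uv.
have F2 (u v : R) : u < v -> u <= v by exact: ltW.
case: h4' => [xE|[h|h]].
- rewrite xE (F1 (x0 - a) x0) ?(F1 x0 (x0 + a)) ?(F2 (x0 - a) x0) ?(F2 x0 (x0 + a)); try lra.
  case: h3' => h; first by rewrite (F2 _ _ h) (F1 (- a) p.2) ?addr0 ?add0r//; lra.
  by rewrite (F2 _ _ h) (F1 p.2 a) ?addr0 ?add0r//; lra.
- rewrite (F1 (x0 - a) p.1) ?(F2 (x0 + a) p.1) ?(F1 (x0 + a) p.1) ?andbF ?addr0 ?add0r//; lra.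
- rewrite (F2 p.1 (x0 - a)) ?(F1 p.1 (x0 + a)) ?(F1 p.1 (x0 - a)) ?andbF ?addr0 ?add0r//; lra.
Qed.

End FrameIndicator.

Section ScalarFormula.
Context {R : realType}.
Notation leb := (@lebesgue_measure R).
Notation leb2 := (leb \x leb)%E.
Notation plane := (measurableTypeR R * measurableTypeR R)%type.
Variables (n : nat) (tau0 f : R -> R[i]) (x0 : R) (om : R[i]).
Hypothesis hf : calA f.
Hypothesis ht : cutoff tau0.
Hypothesis n0 : (0 < n)%N.

Let sf : csmooth f. Proof. by case: hf => b _ []. Qed.

Let F := aa n tau0 f.
Let k q : R[i] := (cpt q - x0%:C)^-1.
Let G q := om * (F q * k q).
Let Phi (p : plane) : R := complex.Re (om * (dbar (almost_analytic n tau0 f) p.1 p.2 * k p)).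

Let Gx q := om * (aax n tau0 f q * k q + F q * - k q ^+ 2).
Let Gy q := om * (aay n tau0 f q * k q + F q * ('i%C * - k q ^+ 2)).

Let C1G (p : R * R) : cpt p != x0%:C -> C1at G Gx Gy p.
Proof.
move=> px; have h1 := C1at_aa n sf ht p; have h2 := hol_at_inv px.
have := C1atM (hol_at_cst om p) (C1atM h1 h2).
rewrite (_ : (fun q => 0 * _ + om * _) = Gx); last first.
  by apply/funext => q; rewrite mul0r add0r.
rewrite (_ : (fun q => 'i%C * 0 * _ + om * _) = Gy); last first.
  by apply/funext => q; rewrite mulr0 mul0r add0r.
exact.
Qed.

Let PhiE p : complex.Re (Gx p) - complex.Im (Gy p) = 2 * Phi p.
Proof.
have E : om * (dbar (almost_analytic n tau0 f) p.1 p.2 * k p) =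
   2^-1 * (Gx p + 'i%C * Gy p).
  rewrite dbar_aa// /Gx /Gy.
  have ii : 'i%C * 'i%C = -1 :> R[i] by rewrite -expr2 sqr_i.
  have -> : 'i%C * (om * (aay n tau0 f p * k p + F p * ('i%C * - k p ^+ 2))) =
    om * ('i%C * aay n tau0 f p * k p - F p * (('i%C * 'i%C) * k p ^+ 2)) by ring.
  by rewrite ii; ring.
rewrite /Phi E (_ : 2^-1 = (2^-1)%:C :> R[i]); last by rewrite fmorphV rmorph_nat.
rewrite ReM_real raddfD /= (Im_ReN (Gy p)) opprK; by field.
Qed.

Let cpt_neq (p : R * R) : p.2 != 0 -> cpt p != x0%:C.
Proof. by apply: contra => /eqP [_ ->]. Qed.

Let PhiC (p : R * R) : cpt p != x0%:C -> {for p, continuous Phi}.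
Proof.
move=> px; have [_ _ _ [c1 _] [_ c2]] := C1G px.
rewrite (_ : Phi = fun q => 2^-1 * (complex.Re (Gx q) - complex.Im (Gy q))); last first.
  by apply/funext => q; rewrite PhiE; field.
by apply: cvgM; [exact: cvg_cst|exact: cvgB].
Qed.

Let Phi_majorant : exists2 g : plane -> R,
  leb2.-integrable setT (EFin \o g) & forall p, p.2 != 0 -> `|Phi p| <= g p.
Proof.
have n0' : 0 < n%:R :> R by rewrite ltr0n.
have [M [s [s0 M0 H]]] := @dbar_majorant R n tau0 f 0 hf ht (lexx 0) n0'.
exists (fun p => (cabs om * M) * (bump 1 s p.1 * bump 0 s p.2)).
  exact: integrable_bump2.
move=> p y0; apply: (le_trans (Re_le_cabs _)).
rewrite cabsM -mulrA ler_wpM2l ?cabs_ge0//.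
have := H p y0; rewrite powRr0 mulr1; apply: le_trans.
rewrite cabsM ler_wpM2l ?cabs_ge0// /k cabsV lef_pV2 ?posrE ?normr_gt0 ?cabs_gt0 ?subr_eq0//; last exact: cpt_neq.
by apply: le_trans (Im_le_cabs _); rewrite /cpt /= oppr0 addr0.
Qed.

Lemma integrable_scalar : leb2.-integrable off_axis (EFin \o Phi).
Proof.
have [g ig Hg] := Phi_majorant.
apply: (@le_integrable _ _ _ leb2 off_axis measurable_off_axis _ (EFin \o g)).
- apply/measurable_EFinP; apply: measurable_fun_at; first exact: measurable_off_axis.
  by move=> p /cpt_neq; exact: PhiC.
- by move=> p /= p2; rewrite lee_fin (le_trans (Hg p p2))// ler_norm.
- exact: integrableS measurableT measurable_off_axis (@subsetT _ _) ig.
Qed.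

Let F_decay : exists2 C, 0 <= C & exists2 b, b < 0 & forall p, cabs (F p) <= C * japR p.1 `^ b /\
  (2 < `|slope p| -> F p = 0).
Proof.
have [beta b0 sb] := hf.
have [C C0 fC] := symbol_consts n.+1 sb.
have [[K K0 tK] t2 t1] := cutoff_consts ht.
have H := @aa_bound R n tau0 f beta C K C0 K0 fC tK t2.
exists (n.+1%:R * 2 ^+ n * C * K); first by rewrite !mulr_ge0 ?exprn_ge0.
by exists beta.
Qed.

Let G_ccont p : cpt p != x0%:C -> ccont G p.
Proof. by case/C1G. Qed.

Let inv_ccont (c : R[i]) p : cpt p != x0%:C -> ccont (fun q => c / (cpt q - x0%:C)) p.
Proof.
by move=> px; apply: ccontM; [exact: ccont_cst|case: (hol_at_inv px)].
Qed.

Let square_neq (s : R) p : 0 < s -> on_square x0 s p -> cpt p != x0%:C /\ s <= cabs (cpt p - x0%:C).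
Proof.
move=> s0 [_ _ h]; have sE : s <= cabs (cpt p - x0%:C).
  case: h => <-.
    by apply: le_trans (Re_le_cabs _).
  by apply: le_trans (Im_le_cabs _); rewrite /cpt /= oppr0 addr0.
split => //; apply/eqP => E; move: sE; rewrite E subrr cabs0.
by rewrite leNgt s0.
Qed.

(** Near [x0] the contour integral sees only the residue. *)
Let square_small : square_int G x0 j.+1%:R^-1 @[j --> \oo] --> 2 * pi * complex.Re (om * f x0).
Proof.
have cF : ccont F (x0, 0) by case: (C1at_aa n sf ht (x0, 0)).
have F0 : F (x0, 0) = f x0.
  rewrite /F aaE /aa_cut /slope mul0r; have [_ t1 _] := ht.
  rewrite t1 ?normr0// mulr1 /aa_poly big_ord_recl /= /taylor_mon expr0 divr1 mulr1.
  rewrite big1 ?addr0// => i _; rewrite mulr0 expr0n /= mul0r mulr0//.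
apply/cvgrPdist_le => e e0.
pose d := e / (8 * (cabs om + 1) * 2).
have o1 : 0 < cabs om + 1 by rewrite ltr_wpDl ?cabs_ge0.
have d0 : 0 < d by rewrite divr_gt0// mulr_gt0// mulr_gt0.
have [cF1 cF2] := cF.
have /cvgrPdist_le /(_ d d0) h1 := cF1.
have /cvgrPdist_le /(_ d d0) h2 := cF2.
have [[A1 A2] [/= /nbhs_ballP[r1 /= r10 B1] /nbhs_ballP[r2 /= r20 B2]] hA] := filterI h1 h2.
pose r := Num.min r1 r2.
have r0 : 0 < r by rewrite lt_min r10.
have : \forall j \near \oo, j.+1%:R^-1 < r.
  have /cvgrPdist_lt /(_ r r0) := @cvg_harmonic R.
  by apply: filterS => j; rewrite sub0r normrN ger0_norm// invr_ge0.
apply: filterS => j jr; have j0 : 0 < j.+1%:R^-1 :> R by rewrite invr_gt0.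
rewrite -(square_int_inv (om * f x0) x0 j0) distrC.
have -> : e = 8 * j.+1%:R^-1 * (e / (8 * j.+1%:R^-1)).
  by rewrite mulrC divfK// mulf_neq0// gt_eqF.
apply: square_int_dist => // p hp.
have [px pj] := square_neq j0 hp.
split; [exact: G_ccont|exact: inv_ccont|].
have -> : G p - om * f x0 / (cpt p - x0%:C) = om * (F p - F (x0, 0)) / (cpt p - x0%:C).
  by rewrite F0 /G /k; ring.
have bp : A1 p.1 /\ A2 p.2.
  have [q1 q2 _] := hp; move: jr; rewrite lt_min => /andP[jr1 jr2].
  split; [apply: B1|apply: B2]; rewrite /ball /= distrC ?subr0.
    exact: le_lt_trans q1 jr1.
  exact: le_lt_trans q2 jr2.
have [/= k1 k2] := hA _ bp.
have dF : cabs (F p - F (x0, 0)) <= d + d.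
  rewrite cabs_distC (le_trans (cabs_le _))//.
  by rewrite !raddfB lerD.
rewrite cabsM cabsV ler_pdivrMr; last exact: lt_le_trans j0 pj.
rewrite cabsM.
apply: (@le_trans _ _ ((cabs om + 1) * (d + d))).
  by rewrite ler_pM ?cabs_ge0// lerDl.
have -> : (cabs om + 1) * (d + d) = e / 8.
  by rewrite /d; field; rewrite gt_eqF.
have -> : e / (8 * j.+1%:R^-1) = e / 8 / j.+1%:R^-1.
  by field.
rewrite mulrAC ler_pdivlMr// ler_wpM2l// divr_ge0// ltW//.
Qed.

(** On the support of [F], [<x>] is at least of the order of [s], so that [F] tends to
   [0] on the contour, of which [1 / (z - x0)] compensates the length. *)
Let square_large : square_int G x0 j.+2%:R @[j --> \oo] --> (0 : R).
Proof.
have [C C0 [b b0 HF]] := F_decay.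
apply/cvgrPdist_le => e e0.
pose e1 := e / (8 * (cabs om + 1) * (C + 1)).
have o1 : 0 < cabs om + 1 by rewrite ltr_wpDl ?cabs_ge0.
have C1 : 0 < C + 1 by rewrite ltr_wpDl.
have e10 : 0 < e1 by rewrite divr_gt0// !mulr_gt0.
pose N := Num.truncn (6 * e1 `^ b^-1 + 2 * `|x0|).
exists N => // j /= Nj.
set s : R := j.+2%:R; have s0 : 0 < s by [].
have sN : 6 * e1 `^ b^-1 + 2 * `|x0| <= s.
  by rewrite ltW// (lt_le_trans (truncnS_gt _))// ler_nat ltnW.
rewrite sub0r normrN.
have -> : square_int G x0 s = square_int G x0 s - square_int (fun=> 0) x0 s.
  by rewrite /square_int !subrr !Rintegral_cst// !mul0r !subr0.
apply: (@le_trans _ _ (8 * s * (e / (8 * s)))); last first.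
  by rewrite mulrC divfK// mulf_neq0// gt_eqF.
apply: square_int_dist => // p hp; have [px ps] := square_neq s0 hp.
split; [exact: G_ccont|exact: ccont_cst|rewrite subr0].
have [H1 H2] := HF p.
have [s2|s2] := ltP 2 `|slope p|.
  by rewrite /G (H2 s2) mul0r mulr0 cabs0 divr_ge0// ?mulr_ge0// ltW.
have J0 := japR_gt0 p.1.
have y2 : `|p.2| <= 2 * japR p.1.
  by rewrite -ler_pdivrMr// -[X in _ / X](gtr0_norm J0) -normf_div.
have sJ : s <= 3 * japR p.1 + `|x0|.
  apply: (le_trans ps); apply: (le_trans (cabs_le _)); rewrite /cpt /= oppr0 addr0.
  have := ler_normB p.1 x0; have := normr_le_japR p.1; lra.
have x00 := normr_ge0 x0.
have eJ : e1 `^ b^-1 <= japR p.1 by lra.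
have Jb : japR p.1 `^ b <= e1 by exact: powR_le_inv.
rewrite /G /k cabsM [cabs (F p * _)]cabsM cabsV.
apply: (@le_trans _ _ ((cabs om + 1) * ((C + 1) * e1 * s^-1))).
  apply: ler_pM; rewrite ?mulr_ge0 ?cabs_ge0 ?invr_ge0 ?cabs_ge0 ?lerDl//.
  apply: ler_pM; rewrite ?invr_ge0 ?cabs_ge0//.
    apply: (le_trans H1); apply: ler_pM; rewrite ?powR_ge0 ?lerDl//.
  by rewrite lef_pV2 ?posrE// (lt_le_trans s0).
have gen (u v w z : R) : 0 < u -> 0 < v -> 0 < w ->
    u * (v * (z / (8 * u * v)) * w^-1) = z / (8 * w).
  by move=> u0 v0 w0; field; rewrite (gt_eqF u0) (gt_eqF v0) (gt_eqF w0).
by rewrite /e1 gen.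
Qed.

Let iPatch (D : set plane) : measurable D ->
  leb2.-integrable off_axis (EFin \o ((fun p : plane => 2 * Phi p) \_ D)).
Proof.
move=> mD; rewrite -restrict_EFin; apply/integrable_restrict => //.
  exact: measurable_off_axis.
have i2 : leb2.-integrable off_axis (EFin \o (fun p => 2 * Phi p)).
  rewrite (_ : EFin \o _ = fun p => (2%:E * (EFin \o Phi) p)%E); last first.
    by apply/funext => p; rewrite /= EFinM.
  by apply: integrableZl; [exact: measurable_off_axis|exact: integrable_scalar].
apply: integrableS i2; [exact: measurable_off_axis| |exact: subIsetl].
by apply: measurableI => //; exact: measurable_off_axis.
Qed.

(** The weight [S j p] counts the closed rectangles of the frame that contain [p]: these
   overlap, but only along the cuts. *)
Let Phi_frames : exists S : nat -> plane -> R,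
 [/\ forall j, \int[leb2]_(p in off_axis) (S j p * (2 * Phi p)) =
      square_int G x0 j.+2%:R - square_int G x0 j.+1%:R^-1,
    forall j, measurable_fun setT (S j : plane -> measurableTypeR R),
    forall j p, `|S j p| <= 4 &
    forall p, p.2 != 0 -> S j p @[j --> \oo] --> (1 : R)].
Proof.
pose a (j : nat) : R := j.+1%:R^-1. pose b (j : nat) : R := j.+2%:R.
have a0 j : 0 < a j by rewrite invr_gt0.
have ab j : a j < b j.
  by rewrite /a /b (@le_lt_trans _ _ 1)// ?invf_le1// ?ler1n// ltr1n.
pose D1 j := rect (x0 - b j) (x0 - a j) (- b j) (b j).
pose D2 j := rect (x0 + a j) (x0 + b j) (- b j) (b j).
pose D3 j := rect (x0 - a j) (x0 + a j) (a j) (b j).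
pose D4 j := rect (x0 - a j) (x0 + a j) (- b j) (- a j).
pose S j (p : plane) : R := \1_(D1 j) p + \1_(D2 j) p + \1_(D3 j) p + \1_(D4 j) p.
exists S; split.
- move=> j.
  have := @Green_frame R G Gx Gy x0 (a j) (b j) (a0 j) (ab j).
  move=> ->; last first.
    move=> p _ _ h; apply: C1G; apply/eqP => E.
    have [E1 E2] : p.1 = x0 /\ p.2 = 0 by case: E.
    by move: h; rewrite E1 E2 subrr normr0 orbb leNgt a0.
  have neq (p : R * R) : (D1 j `|` D2 j `|` D3 j `|` D4 j) p -> cpt p != x0%:C.
    move=> h; apply/eqP => E; have [E1 E2] : p.1 = x0 /\ p.2 = 0 by case: E.
    have [f1 f2 f3 f4] := frame_arith x0 (a0 j).
    by case: h => [[[|]|]|] [/=]; rewrite !in_itv /= E1 E2 ?f1 ?f2 ?f3 ?f4 ?andbF.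
  have IE (D : set plane) : measurable D -> (forall p, D p -> cpt p != x0%:C) ->
      leb2.-integrable D (EFin \o (fun p => complex.Re (Gx p) - complex.Im (Gy p))) ->
      \int[leb2]_(p in D) (complex.Re (Gx p) - complex.Im (Gy p)) =
      \int[leb2]_(p in off_axis) ((fun p : plane => 2 * Phi p) \_ D) p.
    move=> mD hD iD; rewrite Rintegral_off_axis//; apply: eq_Rintegral => p _.
    by rewrite !patchE; case: ifP => // _; rewrite PhiE.
  have IR (D : set plane) a1 b1 c1 d1 : D = rect a1 b1 c1 d1 -> (forall p, D p -> cpt p != x0%:C) ->
      \int[leb2]_(p in D) (complex.Re (Gx p) - complex.Im (Gy p)) =
      \int[leb2]_(p in off_axis) ((fun p : plane => 2 * Phi p) \_ D) p.
    move=> DE hD; apply: IE => //; first by rewrite DE; exact: measurable_rect.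
    rewrite DE; apply: integrable_rect => p; rewrite -DE => /hD /C1G [_ _ _ [c1' _] [_ c2]].
    exact: cvgB.
  rewrite (IR (D1 j) _ _ _ _ erefl); last by move=> p hp; apply: neq; do 3 left.
  rewrite (IR (D2 j) _ _ _ _ erefl); last by move=> p hp; apply: neq; left; left; right.
  rewrite (IR (D3 j) _ _ _ _ erefl); last by move=> p hp; apply: neq; left; right.
  rewrite (IR (D4 j) _ _ _ _ erefl); last by move=> p hp; apply: neq; right.
  have mD1 := @measurable_rect R (x0 - b j) (x0 - a j) (- b j) (b j).
  have mD2 := @measurable_rect R (x0 + a j) (x0 + b j) (- b j) (b j).
  have mD3 := @measurable_rect R (x0 - a j) (x0 + a j) (a j) (b j).
  have mD4 := @measurable_rect R (x0 - a j) (x0 + a j) (- b j) (- a j).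
  have mO := @measurable_off_axis R.
  have i1 := iPatch mD1; have i2 := iPatch mD2; have i3 := iPatch mD3; have i4 := iPatch mD4.
  have i12 := integrableD mO i1 i2.
  have i123 := integrableD mO i12 i3.
  rewrite -RintegralD// -RintegralD// -RintegralD//.
  apply: eq_Rintegral => p _; rewrite /S !patchE !indicE -[point]/(0 : R).
  case: (p \in D1 j); case: (p \in D2 j); case: (p \in D3 j); case: (p \in D4 j) => /=; ring.
- by move=> j; do 3 (apply: measurable_funD; last by apply: measurable_indic; exact: measurable_rect);
    apply: measurable_indic; exact: measurable_rect.
- move=> j p; have b01 (q : bool) : 0 <= (q%:R : R) <= 1 by case: q; rewrite ?ler01 ?lexx.
  rewrite /S !indicE ger0_norm; last by rewrite !addr_ge0.
  move: (b01 (p \in D1 j)) (b01 (p \in D2 j)) (b01 (p \in D3 j)) (b01 (p \in D4 j)).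
  move: (_%:R) (_%:R) (_%:R) (_%:R) => a1 a2 a3 a4.
  by move=> /andP[_ e1] /andP[_ e2] /andP[_ e3] /andP[_ e4]; rewrite (_ : 4 = 1 + 1 + 1 + 1 :> R); [rewrite !lerD|ring].
- move=> p p2; apply: cvg_near_cst.
  have np : 0 < `|p.2| by rewrite normr_gt0.
  have [j0 Hj0] := large_index (normr_ge0 (p.1 - x0)) np.
  exists j0 => // j /= /Hj0[h1 h2 h3 h4]; apply: frame_indic => //.
  have [/eqP|xx] := eqVneq (p.1 - x0) 0; first by rewrite subr_eq0 => /eqP ->; left.
  by right; apply: h4; rewrite normr_eq0.
Qed.

(** Twice the integrand is the Green density of [om F / (z - x0)], with [F] the almost
   analytic extension of [f]; integrate it over frames around [x0] that exhaust the
   plane.  The outer contour integral tends to [0] by the decay of [F], the inner one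
   to the residue. *)
Lemma scalar_formula : \int[leb2]_(p in off_axis) Phi p = - pi * complex.Re (om * f x0).
Proof.
have [S [SE mS S4 S1]] := Phi_frames.
have [g ig Hg] := Phi_majorant.
have mPhi : measurable_fun off_axis (Phi : plane -> measurableTypeR R).
  apply: measurable_fun_at; first exact: measurable_off_axis.
  by move=> p /cpt_neq; exact: PhiC.
have iPhi := integrable_scalar.
have mSP j : measurable_fun off_axis (fun p : plane => S j p * (2 * Phi p) : measurableTypeR R).
  apply: measurable_funM; first exact: measurable_funS measurableT (@subsetT _ _) (mS j).
  by apply: measurable_funM => //; exact: measurable_cst.
have cv : (\int[leb2]_(p in off_axis) (S j p * (2 * Phi p))%:E)%E @[j --> \oo] -->
   (\int[leb2]_(p in off_axis) (2 * Phi p)%:E)%E.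
  have mO : measurable (off_axis : set plane) := measurable_off_axis.
  have [] := @dominated_convergence _ _ _ leb2 off_axis mO
    (fun j p => (S j p * (2 * Phi p))%:E) (fun p => (2 * Phi p)%:E) (fun p => (8 * g p)%:E).
  - by move=> j; apply/measurable_EFinP; exact: mSP.
  - by apply/measurable_EFinP; apply: measurable_funM => //; exact: measurable_cst.
  - apply: aeW => p p2; apply: cvg_EFin; first exact: nearW.
    rewrite -[X in _ --> X]mul1r; apply: cvgM; [exact: S1|exact: cvg_cst].
  - under eq_fun do rewrite EFinM.
    apply: integrableZl => //.
    exact: integrableS measurableT mO (@subsetT _ _) ig.
  - apply: aeW => p j p2 /=; rewrite lee_fin normrM.
    rewrite (_ : 8 * g p = 4 * (2 * g p)); last by ring.
    by rewrite ler_pM// normrM ger0_norm// ler_wpM2l// Hg.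
  by move=> _ _; exact.
have i2 : leb2.-integrable off_axis (fun p => (2 * Phi p)%:E).
  under eq_fun do rewrite EFinM.
  by apply: integrableZl => //; exact: measurable_off_axis.
have cvR : (\int[leb2]_(p in off_axis) (S j p * (2 * Phi p))) @[j --> \oo] -->
    \int[leb2]_(p in off_axis) (2 * Phi p).
  apply: fine_cvg; rewrite /Rintegral fineK//.
  by apply: integrable_fin_num => //; exact: measurable_off_axis.
have cvL : (\int[leb2]_(p in off_axis) (S j p * (2 * Phi p))) @[j --> \oo] -->
    0 - 2 * pi * complex.Re (om * f x0).
  under eq_fun do rewrite SE.
  exact: cvgB square_large square_small.
have : \int[leb2]_(p in off_axis) (2 * Phi p) = 0 - 2 * pi * complex.Re (om * f x0).
  by rewrite -(cvg_lim (@Rhausdorff R) cvR) -(cvg_lim (@Rhausdorff R) cvL).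
rewrite RintegralZl//; last exact: measurable_off_axis.
move: (\int[leb2]_(p in off_axis) Phi p) (complex.Re _) => I a h.
have n2 : (2 : R) != 0 by [].
by apply: (mulfI n2); rewrite h; ring.
Qed.

End ScalarFormula.

(** * Bochner integrals of operator-valued functions *)

Section MonotoneIntegral.
Context {d : measure_display} {T : measurableType d} {R : realType}.
Variable mu : {measure set T -> \bar R}.

(** Measurability is not assumed: the integral of a nonnegative function is a supremum
   over the simple functions below it. *)
Lemma le_integral_pos (f g : T -> \bar R) : (forall t, 0 <= f t)%E ->
  (forall t, f t <= g t)%E -> (\int[mu]_t f t <= \int[mu]_t g t)%E.
Proof.
move=> f0 fg; have g0 t : (0 <= g t)%E by apply: le_trans (fg t).
rewrite !ge0_integralTE//; apply: le_ereal_sup => _ [h hf <-].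
by exists h => // t; exact: le_trans (fg t).
Qed.

Import HBNNSimple.

(** Only the majorant is measurable: [opdist] of an arbitrary family of operators has no
   reason to be so. *)
Lemma le_integral_off (N : set T) (f g : T -> \bar R) : measurable N -> mu N = 0%E ->
  (forall t, 0 <= f t)%E -> (forall t, 0 <= g t)%E -> measurable_fun setT g ->
  (forall t, ~ N t -> f t <= g t)%E -> (\int[mu]_t f t <= \int[mu]_t g t)%E.
Proof.
move=> mN N0 f0 g0 mg fg; rewrite (ge0_integralTE _ f0).
apply: ge_ereal_sup => _ [h hf <-]; rewrite -integralT_nnsfun.
apply: ae_ge0_le_integral => //.
- by move=> t _; rewrite lee_fin.
- by apply/measurable_EFinP; exact: measurable_funP.
- exists N; split=> // t /= /not_implyP[_ nle]; apply: contrapT => nN.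
  by apply: nle; apply: le_trans (hf t) (fg t nN).
Qed.

Lemma integrable_indic_fin (A : set T) : measurable A -> (mu A < +oo)%E ->
  mu.-integrable setT (EFin \o (\1_A : T -> R)).
Proof.
move=> mA fA; apply/integrableP; split.
  by apply/measurable_EFinP; exact: measurable_indic.
rewrite (eq_integral (fun t => (\1_A t)%:E)); last first.
  by move=> t _; rewrite /= ger0_norm.
by rewrite integral_indic// setIT.
Qed.

Lemma integrableZ_fin (D : set T) (a : R) (f : T -> R) : measurable D ->
  mu.-integrable D (EFin \o f) -> mu.-integrable D (EFin \o (fun t => a * f t)).
Proof.
move=> mD if_; rewrite (_ : EFin \o _ = fun t => (a%:E * (EFin \o f) t)%E)//.
exact: integrableZl.
Qed.

End MonotoneIntegral.

Section RealFunctionals.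
Context {R : realType} {B : normedModType R[i]}.
Implicit Types (L : (B -> B) -> R) (C : R).

(** A real value makes a functional integrable as a scalar function.  The type [B -> B]
   also contains unbounded maps, on which nothing is required. *)
Definition rfunctional L C := [/\ 0 <= C,
  forall S T, bounded_linear S -> bounded_linear T -> L (S + T) = L S + L T,
  forall (a : R) S, bounded_linear S -> L (a%:C *: S) = a * L S &
  forall S, bounded_linear S -> `|L S| <= C * opn S].

Lemma rf0 L C : rfunctional L C -> L 0 = 0.
Proof.
by case=> _ _ /(_ 0 0 (@blin0 R B)); rewrite scale0r mul0r.
Qed.

Lemma rfB L C S T : rfunctional L C -> bounded_linear S -> bounded_linear T ->
  L (S - T) = L S - L T.
Proof.
case=> _ add hom _ bS bT; rewrite add//.
  by rewrite -scaleN1r (_ : -1 = (-1)%:C) ?hom ?mulN1r// rmorphN1.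
by rewrite -scaleN1r; exact: blinZ.
Qed.

Lemma rf_sum L C m (F : 'I_m -> B -> B) : rfunctional L C ->
  (forall i, bounded_linear (F i)) -> L (\sum_(i < m) F i) = \sum_(i < m) L (F i).
Proof.
move=> rf bF; elim: m F bF => [|m IH] F bF; first by rewrite !big_ord0 (rf0 rf).
have [_ add _ _] := rf; rewrite !big_ord_recr /= add//; last exact: blin_sum.
by rewrite IH.
Qed.

Section BoundedForm.
Variable L : (B -> B) -> R[i].
Hypothesis L_lin : forall a S T, bounded_linear S -> bounded_linear T ->
  L (a *: S + T) = a * L S + L T.

Lemma bform0 : L 0 = 0.
Proof.
by have := L_lin (-1) (@blin0 _ _) (@blin0 _ _); rewrite scaleN1r addr0 oppr0 mulN1r addNr.
Qed.

Lemma bformD S T : bounded_linear S -> bounded_linear T -> L (S + T) = L S + L T.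
Proof. by move=> bS bT; have := L_lin 1 bS bT; rewrite scale1r mul1r. Qed.

Lemma bformZ a S : bounded_linear S -> L (a *: S) = a * L S.
Proof. by move=> bS; have := L_lin a bS (@blin0 _ _); rewrite !addr0 bform0 addr0. Qed.

Lemma bformB S T : bounded_linear S -> bounded_linear T -> L (S - T) = L S - L T.
Proof.
move=> bS bT; rewrite bformD//; last by rewrite -scaleN1r; exact: blinZ.
by rewrite -scaleN1r bformZ// mulN1r.
Qed.

End BoundedForm.

Lemma eval_rfunctional (v : B) (l : B -> R[i]) C :
  (forall a u w, l (a *: u + w) = a * l u + l w) -> 0 <= C ->
  (forall u, cabs (l u) <= C * rnorm u) ->
  rfunctional (fun S => complex.Re (l (S v))) (C * rnorm v).
Proof.
move=> ll C0 lC; split; first by rewrite mulr_ge0 ?rnorm_ge0.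
- by move=> S T _ _; rewrite /= (lformD ll) raddfD.
- by move=> b S _; rewrite /= (lformZ ll) ReM_real.
- move=> S bS; apply: (le_trans (Re_le_cabs _)); apply: (le_trans (lC _)).
  by rewrite -mulrA ler_wpM2l// mulrC rnorm_opn.
Qed.

Context {d : measure_display} {T : measurableType d}.
Variable mu : {measure set T -> \bar R}.

Let EFin_mul_indic (A : set T) (c : R) : measurable A -> (mu A < +oo)%E ->
  mu.-integrable setT (EFin \o (fun t => \1_A t * c)) /\
  \int[mu]_t (\1_A t * c) = fine (mu A) * c.
Proof.
move=> mA fA.
have iA := integrable_indic_fin mA fA.
split.
  by under eq_fun do rewrite mulrC /=; exact: integrableZ_fin.
rewrite (RintegralZr _ _ iA)//; congr (_ * _).
by rewrite /Rintegral integral_indic// setIT.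
Qed.

Lemma os_fun_blin (s : @opsimple _ B _ _ mu) t : bounded_linear (os_fun s t).
Proof.
have -> : os_fun s t = \sum_(i < os_size s) (\1_(os_set i) t : R)%:C *: os_val i.
  by apply/funext => v; rewrite /os_fun fct_sumE.
by apply: blin_sum => i; apply: blinZ; exact: os_bounded.
Qed.

Lemma os_int_blin (s : @opsimple _ B _ _ mu) : bounded_linear (os_int s).
Proof.
have -> : os_int s = \sum_(i < os_size s) (fine (mu (os_set i)))%:C *: os_val i.
  by apply/funext => v; rewrite /os_int fct_sumE.
by apply: blin_sum => i; apply: blinZ; exact: os_bounded.
Qed.

Lemma rf_os L C (s : @opsimple _ B _ _ mu) : rfunctional L C ->
  mu.-integrable setT (EFin \o (fun t => L (os_fun s t))) /\
  \int[mu]_t L (os_fun s t) = L (os_int s).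
Proof.
move=> rf; have [_ _ hom _] := rf.
have E t : L (os_fun s t) = \sum_(i < os_size s) \1_(os_set i) t * L (os_val i).
  have -> : os_fun s t = \sum_(i < os_size s) (\1_(os_set i) t : R)%:C *: os_val i.
    by apply/funext => v; rewrite /os_fun fct_sumE.
  rewrite (rf_sum rf); last by move=> i; apply: blinZ; exact: os_bounded.
  by apply: eq_bigr => i _; rewrite hom//; exact: os_bounded.
have -> : L (os_int s) = \sum_(i < os_size s) fine (mu (os_set i)) * L (os_val i).
  have -> : os_int s = \sum_(i < os_size s) (fine (mu (os_set i)))%:C *: os_val i.
    by apply/funext => v; rewrite /os_int fct_sumE.
  rewrite (rf_sum rf); last by move=> i; apply: blinZ; exact: os_bounded.
  by apply: eq_bigr => i _; rewrite hom//; exact: os_bounded.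
rewrite (_ : (fun t => _) = fun t => \sum_(i < os_size s) \1_(os_set i) t * L (os_val i));
  last exact/funext.
elim: (os_size s) (@os_set _ _ _ _ _ s) (@os_val _ _ _ _ _ s)
  (@os_measurable _ _ _ _ _ s) (@os_finite _ _ _ _ _ s) => [|m IH] A V mA fA.
  split.
    rewrite (_ : EFin \o _ = cst 0%E); first exact: integrable0.
    by apply/funext => t /=; rewrite big_ord0.
  rewrite big_ord0; under eq_Rintegral do rewrite big_ord0.
  by rewrite /Rintegral integral0.
have [i1 e1] := IH (fun i => A (widen_ord (leqnSn m) i)) (fun i => V (widen_ord (leqnSn m) i))
  (fun i => mA _) (fun i => fA _).
have [i2 e2] := EFin_mul_indic (L (V ord_max)) (mA ord_max) (fA ord_max).
split.
  have i12 := integrableD measurableT i1 i2.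
  by apply: eq_integrable i12 => // t _ /=; rewrite big_ord_recr.
under eq_Rintegral do rewrite big_ord_recr.
by rewrite RintegralD// e1 e2 big_ord_recr.
Qed.

(** The difference is at most [C] times the integral of [opdist (F t) (os_fun (s k) t)],
   plus [C] times the distance from [I] to [os_int (s k)]; both tend to [0]. *)
Lemma rf_opint L C (F : T -> B -> B) I (D : set T) : rfunctional L C ->
  (forall t, bounded_linear (F t)) -> is_opint mu F I ->
  measurable D -> mu (~` D) = 0%E ->
  mu.-integrable D (EFin \o (fun t => L (F t))) ->
  L I = \int[mu]_(t in D) L (F t).
Proof.
move=> rf bF [bI [s [_ sF sI]]] mD D0 iD.
have [C0 _ _ LC] := rf.
pose c := C + 1; have c0 : 0 < c by rewrite ltr_wpDl.
have LC' S : bounded_linear S -> `|L S| <= c * opn S.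
  by move=> bS; apply: le_trans (LC _ bS) _; rewrite ler_wpM2r ?opn_ge0// lerDl.
pose u k := fine (\int[mu]_t opdist (F t) (os_fun (s k) t))%E.
pose w k := opn (I - os_int (s k)).
have w0 : w @ \oo --> (0 : R) by exact: (@fine_cvg _ _ _ _ _ 0 sI).
have u0 : u @ \oo --> (0 : R) by exact: (@fine_cvg _ _ _ _ _ 0 sF).
have uf : \forall k \near \oo, (\int[mu]_t opdist (F t) (os_fun (s k) t))%E \is a fin_num.
  by move/fine_cvgP : sF => -[].
have bnd : \forall k \near \oo, `|L I - \int[mu]_(t in D) L (F t)| <= c * w k + c * u k.
  apply: filterS uf => k uk.
  have [i1 e1] := rf_os (s k) rf.
  rewrite -(subrK (L (os_int (s k))) (L I)) -addrA.
  apply: (le_trans (ler_normD _ _)); apply: lerD.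
    rewrite -(rfB rf) //; last exact: os_int_blin.
    by apply: LC'; apply: blinB => //; exact: os_int_blin.
  have iD1 : mu.-integrable D (EFin \o (fun t => L (os_fun (s k) t))).
    exact: integrableS measurableT mD (@subsetT _ _) i1.
  have -> : L (os_int (s k)) = \int[mu]_(t in D) L (os_fun (s k) t).
    rewrite -e1 /Rintegral; congr fine.
    rewrite (@negligible_integral _ _ _ mu setT (~` D))//; last exact: measurableC.
    by rewrite setDE setCK setTI.
  rewrite -RintegralB//.
  pose h t := L (os_fun (s k) t) - L (F t).
  have iB : mu.-integrable D (EFin \o h) by exact: (integrableB mD iD1 iD).
  apply: (le_trans (le_normr_Rintegral mD iB)).
  have iN : mu.-integrable D (EFin \o (fun t => `|h t|)) by exact: (integrable_abse iB).
  rewrite mulrC -ler_pdivrMr// -RintegralZr//.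
  have iZ : mu.-integrable D (EFin \o (fun t => `|h t| / c)).
    by under eq_fun do rewrite mulrC /=; exact: integrableZ_fin.
  rewrite -lee_fin /u /Rintegral (fineK uk) (fineK (integrable_fin_num mD iZ)).
  rewrite integral_mkcond; apply: le_integral_pos => t.
    by rewrite patchE; case: ifP => // _; rewrite lee_fin divr_ge0// ltW.
  have bs := os_fun_blin (s k) t.
  rewrite opdistE opnormE; last exact: blinB.
  rewrite patchE; case: ifP => _; last by rewrite lee_fin opn_ge0//; exact: blinB.
  rewrite lee_fin ler_pdivrMr// mulrC /h -(rfB rf)// opn_distC//.
  by apply: LC'; exact: blinB.
have cv : (fun k => c * w k + c * u k) @ \oo --> (0 : R).
  by rewrite -(addr0 0) -(mulr0 c); apply: cvgD; apply: cvgM => //; exact: cvg_cst.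
have : `|L I - \int[mu]_(t in D) L (F t)| <= lim ((fun k => c * w k + c * u k) @ \oo).
  by apply: limr_ge bnd; apply/cvg_ex; exists 0.
rewrite (cvg_lim _ cv)// => h.
by apply/eqP; rewrite -subr_eq0 -normr_le0.
Qed.

End RealFunctionals.

Section SimpleApprox.
Context {R : realType} {B : normedModType R[i]}.
Notation leb := (@lebesgue_measure R).
Notation leb2 := (leb \x leb)%E.
Notation plane := (measurableTypeR R * measurableTypeR R)%type.

(** By compactness, finitely many values of [F] are within [e] of all others on [K]; the
   corresponding open sets are made disjoint to get a simple function. *)
Lemma simple_approx (F : plane -> B -> B) (K : set (R * R)) (e : R) :
  (forall t, bounded_linear (F t)) -> compact K -> measurable (K : set plane) ->
  (leb2 K < +oo)%E ->
  (forall t : R * R, K t -> \forall u \near t, opn (F u - F t) <= e) ->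
  exists s : @opsimple _ B _ _ leb2,
    [/\ forall t, K t -> opn (F t - os_fun s t) <= e,
        forall t, ~ K t -> os_fun s t = 0 &
        forall i, exists u, @os_val _ _ _ _ _ s i = F u].
Proof.
move=> bF cK mK fK near_F.
pose O (t : R * R) := interior [set u : R * R | opn (F u - F t) <= e].
have [r cov] : exists r : seq (R * R), forall t, K t -> exists2 u, u \in r & O u t.
  pose up : set_system (seq (R * R)) := fun P => exists r0 : seq (R * R), forall r : seq (R * R), {subset r0 <= r} -> P r.
  have fup : Filter up.
    split; first by exists [::].
      move=> P Q [p hp] [q hq]; exists (p ++ q) => r hr; split.
        by apply: hp => x xp; apply: hr; rewrite mem_cat xp.
      by apply: hq => x xq; apply: hr; rewrite mem_cat xq orbT.
    by move=> P Q PQ [p hp]; exists p => r /hp /PQ.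
  have /compact_near_coveringP /(_ _ up (fun r t => exists2 u, u \in r & O u t) fup) := cK.
  case=> [t Kt|r0 Hr0]; last by exists r0; exact: Hr0.
  exists (O t, [set r : seq (R * R) | t \in r]) => /=.
    split; last by exists [:: t] => r; apply; rewrite inE.
    by apply: open_nbhs_nbhs; split; [exact: open_interior|exact: near_F].
  by move=> [u r] [/= Ou tr]; exists t.
pose m := size r; pose x0 : R * R := (0, 0).
pose U k : set plane := if (k < m)%N then K `&` O (nth x0 r k) else set0.
have mU k : measurable (U k).
  rewrite /U; case: ifP => // _; apply: measurableI => //.
  by apply: open_measurable2; exact: open_interior.
pose A (i : 'I_m) := seqDU U i.
have mA i : measurable (A i).
  by apply: measurableD => //; apply: bigsetU_measurable => k _; exact: mU.
have AK i : A i `<=` K.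
  by move=> t [+ _]; rewrite /U; case: ifP => // _ [].
have fA i : (leb2 (A i) < +oo)%E.
  by apply: le_lt_trans fK; apply: le_measure; rewrite ?inE//; exact: AK.
pose s : @opsimple _ B _ _ leb2 := @OpSimple _ B _ _ leb2 m A (fun i => F (nth x0 r i)) mA fA (fun=> bF _).
have s0 t : ~ K t -> os_fun s t = 0.
  move=> nK; apply/funext => v; rewrite /os_fun big1// => i _.
  by rewrite indicE memNset ?scale0r// => /AK.
exists s; split=> //; last by move=> i; exists (nth x0 r i).
move=> t Kt; have : (\bigcup_k U k) t.
  have [u ur Ou] := cov t Kt.
  have iu : (index u r < m)%N by rewrite index_mem.
  by exists (index u r) => //; rewrite /U iu nth_index.
rewrite seqDU_bigcup_eq => -[k _ Ak].
have km : (k < m)%N by move: Ak => [+ _]; rewrite /U; case: ifP.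
have -> : os_fun s t = F (nth x0 r k).
  apply/funext => v; rewrite /os_fun (bigD1 (Ordinal km))//= big1 ?addr0.
    by rewrite indicE mem_set// scale1r.
  move=> i ik; rewrite indicE memNset ?scale0r// => Ai.
  have := @trivIset_seqDU _ U i k Logic.I Logic.I.
  move=> /(_ (ex_intro _ t (conj Ai Ak))) E.
  by move: ik; rewrite -val_eqE /= E eqxx.
by move: Ak => [+ _]; rewrite /U km => -[_ /interior_subset].
Qed.

End SimpleApprox.

Section BochnerExistence.
Context {R : realType} {B : completeNormedModType R[i]}.
Notation leb := (@lebesgue_measure R).
Notation leb2 := (leb \x leb)%E.
Notation plane := (measurableTypeR R * measurableTypeR R)%type.

(** An exhaustion of the complement of the axis: the integrand is continuous there, but
   may be unbounded near the axis. *)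
Definition slabs (k : nat) : set (R * R) :=
  rect (- k.+1%:R) k.+1%:R k.+1%:R^-1 k.+1%:R `|`
  rect (- k.+1%:R) k.+1%:R (- k.+1%:R) (- k.+1%:R^-1).

Lemma compact_slabs k : compact (slabs k).
Proof. by apply: compactU; exact: compact_rect. Qed.

Lemma measurable_slabs k : measurable (slabs k : set plane).
Proof. by apply: measurableU; exact: measurable_rect. Qed.

Lemma slabs_fin k : (leb2 (slabs k) < +oo)%E.
Proof.
apply: le_lt_trans (@rect_fin R (- k.+1%:R) k.+1%:R (- k.+1%:R) k.+1%:R).
apply: le_measure; rewrite ?inE; [exact: measurable_slabs|exact: measurable_rect|].
have k0 : 0 <= k.+1%:R^-1 :> R by [].
have k1 : 0 <= k.+1%:R :> R by [].
rewrite /slabs; move: (k.+1%:R) (k.+1%:R^-1) k0 k1 => a b b0 a0.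
move=> [x y] [] [/= hx]; rewrite in_itv /= => /andP[y1 y2]; split=> //=;
  by rewrite in_itv /=; apply/andP; split; lra.
Qed.

Lemma slabs_off k : slabs k `<=` @off_axis R.
Proof.
have k0 : 0 < k.+1%:R^-1 :> R by rewrite invr_gt0.
rewrite /slabs; move: (k.+1%:R) (k.+1%:R^-1) k0 => b a a0.
move=> [x y] [] [/= _]; rewrite in_itv /= => /andP[y1 y2]; rewrite /off_axis /=.
  by rewrite gt_eqF//; lra.
by rewrite lt_eqF//; lra.
Qed.

Lemma slabs_exhaust t : @off_axis R t -> \forall k \near \oo, slabs k t.
Proof.
move=> /= t2; have np : 0 < `|t.2| by rewrite normr_gt0.
exists (Num.truncn (`|t.1| + `|t.2| + `|t.2|^-1)) => // k /= Nk.
have i0 : 0 < `|t.2|^-1 by rewrite invr_gt0.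
have h : `|t.1| + `|t.2| + `|t.2|^-1 <= k.+1%:R.
  by rewrite ltW// (lt_le_trans (truncnS_gt _))// ler_nat.
have h1 : `|t.1| <= k.+1%:R by have := normr_ge0 t.1; lra.
have h2 : `|t.2| <= k.+1%:R by have := normr_ge0 t.1; lra.
have h3 : k.+1%:R^-1 <= `|t.2|.
  rewrite -[leRHS]invrK lef_pV2 ?posrE//; have := normr_ge0 t.1; lra.
move: h1 h2 h3; rewrite /slabs; move: (k.+1%:R) (k.+1%:R^-1) => a b h1 h2 h3.
move: h1; rewrite ler_norml => h1.
have [y0|y0] := ltP 0 t.2; [left|right]; split=> //=; rewrite in_itv /=.
  by move: h2 h3; rewrite gtr0_norm// => -> ->.
move: h2 h3; rewrite ler0_norm// => h2 h3.
by apply/andP; split; lra.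
Qed.

(** On a slab [F] is approximated uniformly by a simple function, with an error small
   with respect to the measure of the slab; off the slab [g] is the error, and its
   integral tends to [0] by dominated convergence.  The integrals of the simple functions
   are Cauchy in norm, as is seen by applying norming functionals to them. *)
Lemma opint_exists (F : plane -> B -> B) (g : plane -> R) :
  (forall t, bounded_linear (F t)) ->
  (forall t : R * R, off_axis t -> forall e, 0 < e ->
     \forall u \near t, opn (F u - F t) <= e) ->
  leb2.-integrable setT (EFin \o g) -> (forall t, 0 <= g t) ->
  (forall t, off_axis t -> opn (F t) <= g t) ->
  exists I, is_opint leb2 F I.
Proof.
move=> bF cF ig g0 Fg.
(* This makes [e k] times the measure of [slabs k] at most [1 / (k + 1)]. *)
pose e k : R := (k.+1%:R * (1 + fine (leb2 (slabs k))))^-1.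
have m0 k : 0 <= fine (leb2 (slabs k)) by rewrite fine_ge0.
have e0 k : 0 < e k by rewrite invr_gt0 mulr_gt0// ltr_pwDl.
have ek k : e k <= k.+1%:R^-1.
  by rewrite /e lef_pV2 ?posrE ?mulr_gt0 ?ltr_pwDl// ler_peMr// lerDl.
have em k : e k * fine (leb2 (slabs k)) <= k.+1%:R^-1.
  rewrite /e invfM -mulrA ler_piMr// mulrC ler_pdivrMr ?ltr_pwDl// mul1r lerDr//.
have /choice [s sP] : forall k, exists s : @opsimple _ B _ _ leb2,
    (forall t, slabs k t -> opn (F t - os_fun s t) <= e k) /\
    (forall t, ~ slabs k t -> os_fun s t = 0).
  move=> k; have [||||t /slabs_off ot|s [s1 s2 _]] := @simple_approx _ _ F (slabs k) (e k).
  - exact: bF.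
  - exact: compact_slabs.
  - exact: measurable_slabs.
  - exact: slabs_fin.
  - exact: cF.
  by exists s.
pose h k t : R := e k * \1_(slabs k) t + g t * \1_(~` slabs k) t.
have h0 k t : 0 <= h k t.
  by rewrite /h addr_ge0// mulr_ge0// ltW.
have Fh k t : off_axis t -> opn (F t - os_fun (s k) t) <= h k t.
  move=> ot; have [s1 s2] := sP k; rewrite /h !indicE in_setC.
  have [kt|kt] := pselect (slabs k t).
    by rewrite mem_set//= mulr1 mulr0 addr0; exact: s1.
  by rewrite memNset//= mulr0 mulr1 add0r s2// subr0; exact: Fg.
have mg : measurable_fun setT (g : plane -> measurableTypeR R).
  by have /integrableP[/measurable_EFinP] := ig.
have ig2 k : leb2.-integrable setT (EFin \o (fun t => g t * \1_(~` slabs k) t)).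
  apply: (@le_integrable _ _ _ leb2 setT measurableT _ (EFin \o g)) => //.
    apply/measurable_EFinP; apply: measurable_funM => //.
    by apply: measurable_indic; apply: measurableC; exact: measurable_slabs.
  move=> t _ /=; rewrite lee_fin normrM ler_piMr// indicE.
  by case: (_ \in _); rewrite ?normr1 ?normr0.
have ie2 k : leb2.-integrable setT (EFin \o (fun t => e k * \1_(slabs k) t)).
  apply: integrableZ_fin => //; apply: integrable_indic_fin.
    exact: measurable_slabs.
  exact: slabs_fin.
have ih k : leb2.-integrable setT (EFin \o h k).
  exact: (integrableD measurableT (ie2 k) (ig2 k)).
pose a k := \int[leb2]_t h k t.
have aE k : a k = e k * fine (leb2 (slabs k)) + \int[leb2]_t (g t * \1_(~` slabs k) t).
  rewrite /a /h RintegralD//; congr (_ + _).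
  rewrite RintegralZl//; last first.
    by apply: integrable_indic_fin; [exact: measurable_slabs|exact: slabs_fin].
  congr (_ * _); rewrite /Rintegral integral_indic ?setIT//; exact: measurable_slabs.
have aI k : (\int[leb2]_t (h k t)%:E)%E = (a k)%:E.
  by rewrite /a /Rintegral (fineK (integrable_fin_num measurableT (ih k))).
have harm : (fun k => k.+1%:R^-1) @ \oo --> (0 : R) by exact: cvg_harmonic.
have a0 : a @ \oo --> (0 : R).
  have -> : a = fun k => e k * fine (leb2 (slabs k)) + \int[leb2]_t (g t * \1_(~` slabs k) t).
    exact/funext.
  rewrite -(addr0 0); apply: cvgD.
    apply: (@squeeze_cvgr _ _ _ _ (fun=> 0) (fun k => k.+1%:R^-1)) => //; last exact: cvg_cst.
    by apply: nearW => k; rewrite em andbT mulr_ge0// ltW.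
  have [] := @dominated_convergence _ _ _ leb2 setT measurableT
    (fun k t => (g t * \1_(~` slabs k) t)%:E) (fun=> 0%E) (EFin \o g).
  - by move=> k; have /integrableP[] := ig2 k.
  - exact: measurable_cst.
  - exists (~` @off_axis R); split; [|exact: axis_null|].
      by apply: measurableC; exact: measurable_off_axis.
    move=> t /= nc ot; apply: nc => _; apply: cvg_near_cst.
    have := slabs_exhaust ot; apply: filterS => k kt.
    by rewrite indicE in_setC mem_set//= mulr0.
  - exact: ig.
  - apply: aeW => t k _ /=; rewrite lee_fin normrM ger0_norm// ler_piMr// indicE.
    by case: (_ \in _); rewrite ?normr1 ?normr0.
  move=> _ _; rewrite integral0 => cv.
  exact: (@fine_cvg _ _ _ _ _ 0 cv).
have bs k t := os_fun_blin (s k) t.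
have bF' k t : bounded_linear (F t - os_fun (s k) t) by exact: blinB.
have intF k : (0 <= \int[leb2]_t opdist (F t) (os_fun (s k) t) <= (a k)%:E)%E.
  apply/andP; split.
    by apply: integral_ge0 => t _; rewrite opdistE opnormE// lee_fin opn_ge0.
  rewrite -aI; apply: (@le_integral_off _ _ _ leb2 (~` @off_axis R)).
  - by apply: measurableC; exact: measurable_off_axis.
  - exact: axis_null.
  - by move=> t; rewrite opdistE opnormE// lee_fin opn_ge0.
  - by move=> t; rewrite lee_fin.
  - by have /integrableP[] := ih k.
  - by move=> t /= /contrapT ot; rewrite opdistE opnormE// lee_fin Fh.
have cauchy k l : opn (os_int (s k) - os_int (s l)) <= 2 * a k + 2 * a l.
  have bk := os_int_blin (s k); have bl := os_int_blin (s l).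
  have a_ge0 m : 0 <= a m by rewrite /a Rintegral_ge0.
  apply: opn_le; [exact: blinB|by rewrite addr_ge0// mulr_ge0|move=> v].
  have [L [L1 L2 L3]] := norming_functional ((os_int (s k) - os_int (s l)) v).
  pose Lam (S : B -> B) := complex.Re (L (S v)).
  have rf : rfunctional Lam (2 * rnorm v) := eval_rfunctional v L1 (ler0n _ 2) L3.
  have [ik ek'] := rf_os (s k) rf; have [il el'] := rf_os (s l) rf.
  have -> : rnorm ((os_int (s k) - os_int (s l)) v) = Lam (os_int (s k)) - Lam (os_int (s l)).
    by rewrite -(rfB rf)// /Lam L2.
  rewrite -ek' -el' -RintegralB//.
  have iO : measurable (@off_axis R) := measurable_off_axis.
  have iB := integrableB measurableT ik il.
  have offE (f : plane -> R) : leb2.-integrable setT (EFin \o f) ->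
      \int[leb2]_t f t = \int[leb2]_(t in @off_axis R) f t.
    move=> if_; rewrite /Rintegral; congr fine.
    rewrite (@negligible_integral _ _ _ leb2 setT (~` @off_axis R))//.
    - by rewrite setDE setCK setTI.
    - exact: measurableC.
    - exact: axis_null.
  rewrite offE//.
  pose c := 2 * rnorm v.
  have ihh : leb2.-integrable setT (EFin \o (fun t => h k t + h l t)).
    exact: (integrableD measurableT (ih k) (ih l)).
  have hkl : (2 * a k + 2 * a l) * rnorm v = \int[leb2]_t ((h k t + h l t) * c).
    by rewrite RintegralZr// RintegralD// /c -mulrDr mulrAC [RHS]mulrC.
  have ihz : leb2.-integrable setT (EFin \o (fun t => (h k t + h l t) * c)).
    by under eq_fun do rewrite mulrC /=; exact: integrableZ_fin.
  rewrite hkl offE//.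
  have iBO : leb2.-integrable (@off_axis R) (EFin \o (fun t => Lam (os_fun (s k) t) - Lam (os_fun (s l) t))).
    exact: integrableS measurableT iO (@subsetT _ _) iB.
  have iHO := integrableS measurableT iO (@subsetT _ _) ihz.
  apply: le_Rintegral => // t ot.
  rewrite -(rfB rf)//; apply: (le_trans (ler_norm _)).
  have [c0 _ _ LamC] := rf.
  apply: (le_trans (LamC _ _)); first exact: blinB.
  rewrite mulrC -/c ler_wpM2r//.
  rewrite (_ : os_fun (s k) t - os_fun (s l) t =
    (F t - os_fun (s l) t) - (F t - os_fun (s k) t)); last first.
    by rewrite opprB [RHS]addrC addrA subrK.
  by rewrite (le_trans (opnB _ _))// addrC lerD// Fh.
have ca : (fun k => 2 * a k) @ \oo --> (0 : R).
  by rewrite -(mulr0 2); apply: cvgM => //; exact: cvg_cst.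
have [I bI IP] := blin_complete (fun k => os_int_blin (s k)) cauchy ca.
exists I; split=> //; exists s; split.
- exists (~` @off_axis R); split; [|exact: axis_null|].
    by apply: measurableC; exact: measurable_off_axis.
  move=> t /= nc ot; apply: nc.
  under eq_fun do rewrite opdistE opnormE//.
  apply: cvg_EFin; first exact: nearW.
  apply: (@squeeze_cvgr _ _ _ _ (fun=> 0) (fun k => k.+1%:R^-1)) => //; last exact: cvg_cst.
  have := slabs_exhaust ot; apply: filterS => k kt.
  by rewrite opn_ge0//= (le_trans _ (ek k))//; have [s1 _] := sP k; exact: s1.
- apply: (@squeeze_cvge _ _ _ _ (fun=> 0%E) _ (fun k => (a k)%:E)) => //.
  + exact: nearW.
  + exact: cvg_cst.
  + by apply: cvg_EFin => //; exact: nearW.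
- have bIs k : bounded_linear (I - os_int (s k)) by apply: blinB => //; exact: os_int_blin.
  under eq_fun do rewrite opdistE opnormE//.
  apply: cvg_EFin; first exact: nearW.
  apply: (@squeeze_cvgr _ _ _ _ (fun=> 0) (fun k => 2 * a k)) => //; last exact: cvg_cst.
  apply: nearW => k; rewrite IP andbT opn_ge0//; apply: blinB => //; exact: os_int_blin.
Qed.

End BochnerExistence.

(** * Testing the functional calculus against functionals *)

Lemma scaler_diff (R : pzRingType) (V : lmodType R) (a b : R) (u v : V) :
  a *: u - b *: v = (a - b) *: u + b *: (u - v).
Proof. by rewrite scalerBl scalerBr addrA subrK. Qed.

Section NormContinuity.
Context {R : realType} {B : completeNormedModType R[i]}.
Variable H : operator B.

Lemma ccont_near (G : R * R -> R[i]) p (e : R) : ccont G p -> 0 < e ->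
  \forall u \near p, cabs (G u - G p) <= e.
Proof.
move=> [cR cI] e0; have e2 : 0 < e / 2 by rewrite divr_gt0.
have /cvgrPdist_le /(_ _ e2) h1 := cR.
have /cvgrPdist_le /(_ _ e2) h2 := cI.
apply: filterS (filterI h1 h2) => u [/= k1 k2].
rewrite cabs_distC (le_trans (cabs_le _))// (splitr e).
by rewrite !raddfB lerD.
Qed.

Lemma res_near (p : R * R) (e : R) : (\forall u \near p, rho H (cpt u)) -> 0 < e ->
  \forall u \near p, opn (resolvent H (cpt u) - resolvent H (cpt p)) <= e.
Proof.
move=> nr e0; set a := opn (resolvent H (cpt p)).
have a0 : 0 <= a by apply: opn_ge0; exact: res_blin.
have a1 : 0 < 2 * (a + 1) by rewrite mulr_gt0// ltr_wpDl.
have a2 : 0 < 2 * a ^+ 2 + 1 by rewrite ltr_wpDl// mulr_ge0// exprn_ge0.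
have [_ _ cp _ _] := hol_at_id p.
have rp : rho H (cpt p) by exact: (nbhs_singleton nr).
have d0 : 0 < Num.min (2 * (a + 1))^-1 (e / (2 * a ^+ 2 + 1)).
  by rewrite lt_min invr_gt0 a1 divr_gt0.
apply: filterS (filterI nr (ccont_near cp d0)) => u [ru].
rewrite le_min => /andP[d1 d2].
have ba := res_blin H (cpt u); have bp := res_blin H (cpt p).
rewrite opn_distC//; apply: (le_trans (res_opn_lip rp ru _)); rewrite -/a.
  apply: (@le_trans _ _ ((2 * (a + 1))^-1 * (a + 1))).
    by rewrite ler_pM ?cabs_ge0// lerDl.
  by rewrite invfM -mulrA mulVf ?mulr1// gt_eqF// ltr_wpDl.
apply: (@le_trans _ _ ((2 * a ^+ 2 + 1) * (e / (2 * a ^+ 2 + 1)))).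
  by rewrite ler_pM ?cabs_ge0// ?mulr_ge0 ?exprn_ge0// lerDl.
by rewrite mulrC divfK// gt_eqF.
Qed.

End NormContinuity.

Section Calculus.
Context {R : realType} {B : completeNormedModType R[i]}.
Variables (H : operator B) (c alpha : R).
Hypothesis HH : standing_hypothesis H c alpha.
Notation leb := (@lebesgue_measure R).
Notation leb2 := (leb \x leb)%E.
Notation plane := (measurableTypeR R * measurableTypeR R)%type.

Lemma rho_nonreal (z : R[i]) : complex.Im z != 0 -> rho H z.
Proof. by move=> z0 sz; move: z0; have [_ -> //] := HH; rewrite eqxx. Qed.

Lemma opn_res_le (z : R[i]) : complex.Im z != 0 ->
  opn (resolvent H z) <= c * `|complex.Im z|^-1 * (jap z / `|complex.Im z|) `^ alpha.
Proof.
move=> z0; have [_ _ _ _ /(_ z z0)] := HH.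
by rewrite opnormE ?lee_fin//; exact: res_blin.
Qed.

Lemma near_off_axis (p : R * R) : off_axis p -> \forall u \near p, @off_axis R u.
Proof. by move=> po; apply: open_nbhs_nbhs; split => //; exact: open_off_axis. Qed.

Variables (n : nat) (tau0 f : R -> R[i]).
Hypotheses (hn : alpha < n%:R) (ht : cutoff tau0) (hf : calA f).

Definition hs_integrand (p : plane) : B -> B := fun u =>
  dbar (almost_analytic n tau0 f) p.1 p.2 *: resolvent H (p.1 +i* p.2) u.

Let d p := dbar (almost_analytic n tau0 f) p.1 p.2.

Lemma hs_blin p : bounded_linear (hs_integrand p).
Proof. exact: (blinZ (d p) (res_blin H (cpt p))). Qed.

(** Off the axis both factors are continuous, the resolvent in norm. *)
Lemma hs_near (p : R * R) (e : R) : off_axis p -> 0 < e ->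
  \forall u \near p, opn (hs_integrand u - hs_integrand p) <= e.
Proof.
move=> po e0; have sf : csmooth f by case: hf => b _ [].
have cd : ccont d p.
  rewrite (_ : d = fun p => 2^-1 * (aax n tau0 f p + 'i%C * aay n tau0 f p)); last first.
    by apply/funext => q; rewrite /d dbar_aa.
  have [_ _ _ cx cy] := C1at_aa n sf ht p.
  apply: ccontM; first exact: ccont_cst.
  by apply: ccontD => //; apply: ccontM => //; exact: ccont_cst.
set a := opn (resolvent H (cpt p)).
have a0 : 0 <= a by apply: opn_ge0; exact: res_blin.
pose K := a + 1 + cabs (d p); have K0 : 0 < K by rewrite /K -addrA addrCA ltr_pwDl// addr_ge0 ?cabs_ge0.
have eK : 0 < Num.min 1 (e / K) by rewrite lt_min ltr01 divr_gt0.
have nr : \forall u \near p, rho H (cpt u).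
  by apply: filterS (near_off_axis po) => u uo; apply: rho_nonreal.
apply: filterS (filterI (ccont_near cd eK) (res_near nr eK)) => u [].
rewrite !le_min => /andP[_ du] /andP[r1 ru].
have bu := res_blin H (cpt u); have bp := res_blin H (cpt p).
have -> : hs_integrand u - hs_integrand p =
    (d u - d p) *: resolvent H (cpt u) + d p *: (resolvent H (cpt u) - resolvent H (cpt p)).
  exact: scaler_diff.
have Ru : opn (resolvent H (cpt u)) <= a + 1.
  rewrite -(subrK (resolvent H (cpt p)) (resolvent H (cpt u))) addrC.
  by rewrite (le_trans (opnD _ _))//; [exact: blinB|exact: lerD].
rewrite (le_trans (opnD _ _))//; [exact: blinZ|apply: blinZ; exact: blinB|].
rewrite !opnZ//; last exact: blinB.
rewrite (_ : e = e / K * (a + 1) + cabs (d p) * (e / K)); last first.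
  by rewrite -{1}(divfK (lt0r_neq0 K0) e); move: (e / K) => q; rewrite /K; ring.
by rewrite lerD// ?ler_wpM2l ?cabs_ge0// ler_pM ?cabs_ge0 ?opn_ge0.
Qed.

(** The resolvent bound is exactly what the vanishing of the dbar derivative on the axis
   absorbs when [alpha < n]. *)
Lemma hs_majorant : exists g : plane -> R,
  [/\ leb2.-integrable setT (EFin \o g), forall p, 0 <= g p &
      forall p, off_axis p -> opn (hs_integrand p) <= g p].
Proof.
have [_ _ c0 al0 _] := HH.
have [M [s [s0 M0 HM]]] := dbar_majorant hf ht al0 hn.
exists (fun p => c * M * (bump 1 s p.1 * bump 0 s p.2)); split.
- exact: integrable_bump2.
- by move=> p; rewrite !mulr_ge0 ?bump_ge0// ltW.
move=> p po; rewrite /hs_integrand (opnZ (d p) (res_blin H (cpt p))).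
apply: (le_trans (ler_wpM2l (cabs_ge0 _) (opn_res_le (z := cpt p) po))).
rewrite -[c * _^-1 * _]mulrA -[c * M * _]mulrA mulrCA.
by rewrite ler_wpM2l//; [exact: ltW|exact: HM].
Qed.

Lemma fcalc_weak : bounded_linear (fcalc H n tau0 f) /\
  forall L C, rfunctional L C ->
    leb2.-integrable (@off_axis R) (EFin \o (fun p => L (hs_integrand p))) /\
    L (fcalc H n tau0 f) = - pi^-1 * \int[leb2]_(p in @off_axis R) L (hs_integrand p).
Proof.
have [g [ig g0 gF]] := hs_majorant.
have [I0 I0P] := opint_exists hs_blin (fun t ot e e0 => hs_near ot e0) ig g0 gF.
have oI : is_opint leb2 hs_integrand (opint leb2 hs_integrand).
  by apply: xgetPex; exists I0.
have fE : fcalc H n tau0 f = (- pi^-1)%:C *: opint leb2 hs_integrand.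
  by apply/funext => v; rewrite /fcalc rmorphN.
have bI : bounded_linear (opint leb2 hs_integrand) by case: oI.
split; first by rewrite fE; exact: blinZ.
move=> L C rf; have [C0 _ hom LC] := rf.
have mO := @measurable_off_axis R.
have iL : leb2.-integrable (@off_axis R) (EFin \o (fun p => L (hs_integrand p))).
  have ig' : leb2.-integrable (@off_axis R) (EFin \o (fun p => C * g p)).
    apply: integrableZ_fin => //; exact: integrableS measurableT mO (@subsetT _ _) ig.
  apply: (@le_integrable _ _ _ leb2 (@off_axis R) mO _ (EFin \o (fun p => C * g p))) => //.
  - apply/measurable_EFinP; apply: measurable_fun_at => // p po.
    apply/cvgrPdist_le => e e0.
    have C1 : 0 < C + 1 by rewrite ltr_wpDl.
    have e1 : 0 < e / (C + 1) by rewrite divr_gt0.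
    apply: filterS (hs_near po e1) => u hu.
    have bu := hs_blin u; have bp := hs_blin p.
    rewrite distrC -(rfB rf)// (le_trans (LC _ _))//; first exact: blinB.
    rewrite (_ : e = (C + 1) * (e / (C + 1))); last by rewrite mulrC divfK// gt_eqF.
    by rewrite ler_pM ?lerDl// opn_ge0//; exact: blinB.
  - move=> p po /=; rewrite lee_fin (le_trans (LC _ (hs_blin p)))//.
    by rewrite (le_trans _ (ler_norm _))// ler_wpM2l// gF.
split=> //.
rewrite fE hom//; congr (_ * _).
apply: (rf_opint rf hs_blin oI) => //; exact: axis_null.
Qed.

End Calculus.

(** * Existence of a spectral value modulo an ideal *)

Section SpectralPoint.
Context {R : realType} {A : comPzRingType} (iota : {rmorphism R[i] -> A}) (N : A -> R).
Hypothesis N_ge0 : forall x, 0 <= N x.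
Hypothesis NM : forall x y, N (x * y) <= N x * N y.
Hypothesis NZ : forall a x, N (iota a * x) = cabs a * N x.
Hypothesis N_neumann : forall k, N k < 1 ->
  exists2 x, x * (1 - k) = 1 & N x <= (1 - N k)^-1.
Variables (J : set A) (L : A -> R[i]).
Hypothesis JB : forall x y, J x -> J y -> J (x - y).
Hypothesis JM : forall a x, J x -> J (a * x).
Hypothesis LD : forall x y, L (x + y) = L x + L y.
Hypothesis LZ : forall a x, L (iota a * x) = a * L x.
Hypothesis LJ : forall x, J x -> L x = 0.
Hypothesis L1 : L 1 = 1.
Hypothesis LN : forall x, cabs (L x) <= 2 * N x.

Let LB x y : L (x - y) = L x - L y.
Proof. by rewrite -mulN1r -[-1](rmorphN1 iota) LD LZ mulN1r. Qed.

Let LJB x y : J (x - y) -> L x = L y.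
Proof. by move/LJ; rewrite LB => /subr0_eq. Qed.

Let neumann_half k : N k <= 2^-1 -> exists2 x, x * (1 - k) = 1 & N x <= 2.
Proof.
move=> k2; have k1 : N k < 1 by lra.
have [x x1 xN] := N_neumann k1; exists x => //; apply: (le_trans xN).
by rewrite -[leRHS]invrK lef_pV2 ?posrE; lra.
Qed.

Variables (T : A) (c : R[i] -> A).
Hypothesis cP : forall t, J (1 - (T - iota t) * c t).

(** The resolvent identity, modulo [J]. *)
Let res_mod s t : J (c s - c t - iota (s - t) * (c s * c t)).
Proof.
have := JB (JM (c s) (cP t)) (JM (c t) (cP s)).
by congr J; rewrite rmorphB; ring.
Qed.

(** Modulo [J], [c s] is given near [t] by a Neumann series in [c t]. *)
Let c_near s t x : x * (1 - iota (s - t) * c t) = 1 -> J (c s - c t * x).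
Proof.
move=> xE; have := JM x (res_mod s t); congr J.
by rewrite -[c s in RHS]mulr1 -xE; ring.
Qed.

Let g t := L (c t).
Let g' t := L (c t * c t).

(** By the Neumann expansion, [g] has the second-order Taylor expansion of a holomorphic
   function, with derivative [g']; [L] does not see the choice of [c s] modulo [J]. *)
Let g_hol p : C1at (g \o cpt) (g' \o cpt) (fun q => 'i%C * g' (cpt q)) p.
Proof.
set t := cpt p; set k := N (c t); have k0 : 0 <= k by exact: N_ge0.
have k1 : 0 < 2 * (k + 1) by rewrite mulr_gt0// ltr_wpDl.
have k3 : 0 <= k ^+ 3 by rewrite exprn_ge0.
apply: (@C1at_hol R g g' p (12 * k ^+ 3) (2 * (k + 1))^-1).
- by rewrite invr_gt0.
- by rewrite mulr_ge0.
move=> s; rewrite -/t => st.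
have NK : N (iota (s - t) * c t) <= 2^-1.
  rewrite NZ -/k (@le_trans _ _ ((2 * (k + 1))^-1 * (k + 1)))//.
    by rewrite ler_pM ?cabs_ge0// ?lerDl// ltW.
  by rewrite invfM -mulrA mulVf ?mulr1// gt_eqF// ltr_wpDl.
have [x xE x2] := neumann_half NK.
have cs := c_near xE; have xE' : x = 1 + iota (s - t) * c t * x.
  by rewrite -{1}xE; ring.
have d0 : 0 <= cabs (s - t) by exact: cabs_ge0.
have gs : g s = L (c t * x) by exact: LJB.
have gs' : g' s = L (c t * x * (c t * x)).
  apply: LJB; have := JB (JM (c s) cs) (JM (- (c t * x)) cs).
  by congr J; ring.
have c3 : N (c t * c t * c t * x) <= k ^+ 3 * 2.
  have h2 : N (c t * c t) <= k * k by exact: NM.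
  have h3 : N (c t * c t * c t) <= k * k * k.
    by apply: (le_trans (NM _ _)); rewrite ler_wpM2r.
  apply: (le_trans (NM _ _)); rewrite (_ : k ^+ 3 = k * k * k); last by ring.
  by rewrite ler_pM.
split.
  have -> : g s - g t - g' t * (s - t) = L (iota ((s - t) ^+ 2) * (c t * c t * c t * x)).
    rewrite gs /g /g' [L (c t * c t) * _]mulrC -LZ -!LB; congr L.
    rewrite rmorphXn /=; rewrite {1}xE'; rewrite {1}xE'; ring.
  rewrite LZ cabsM cabsX mulrC ler_wpM2r ?exprn_ge0//.
  by rewrite (le_trans (LN _))//; lra.
have -> : g' s - g' t = L (iota (s - t) * (c t * c t * c t * x * (x + 1))).
  rewrite gs' /g' -LB; congr L.
  have -> : c t * x * (c t * x) - c t * c t = c t * c t * ((x - 1) * (x + 1)) by ring.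
  by rewrite {1}xE'; ring.
rewrite LZ cabsM mulrC ler_wpM2r//.
have -> : c t * c t * c t * x * (x + 1) = c t * c t * c t * x * x + c t * c t * c t * x by ring.
rewrite LD (le_trans (cabsD _ _))// (_ : 12 * k ^+ 3 = 2 * (k ^+ 3 * 2 * 2) + 2 * (k ^+ 3 * 2)); last by ring.
rewrite lerD// (le_trans (LN _))// ler_wpM2l//.
by rewrite (le_trans (NM _ _))// ler_pM.
Qed.

(** For large [t], [T - t] is invertible and [c t] is its inverse modulo [J]. *)
Let g_infty t : t != 0 -> 2 * N T <= cabs t ->
  cabs (g t - (-1) / t) <= 4 * N T / cabs t ^+ 2.
Proof.
move=> t0 tT; have ct0 : 0 < cabs t by rewrite cabs_gt0.
have NK : N (iota t^-1 * T) <= 2^-1.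
  by rewrite NZ cabsV mulrC ler_pdivrMr//; lra.
have [x xE x2] := neumann_half NK.
have ii : iota t * iota t^-1 = 1 by rewrite -rmorphM mulfV// rmorph1.
have eE : (T - iota t) * (- (iota t^-1 * x)) = 1.
  have -> : (T - iota t) * (- (iota t^-1 * x)) =
    iota t * iota t^-1 * x - iota t^-1 * T * x by ring.
  by rewrite ii mul1r -xE; ring.
have -> : g t = L (- (iota t^-1 * x)).
  apply: LJB; have := JM (iota t^-1 * x) (cP t); congr J.
  have -> : iota t^-1 * x * (1 - (T - iota t) * c t) =
    iota t^-1 * x + c t * ((T - iota t) * (- (iota t^-1 * x))) by ring.
  by rewrite eE; ring.
have -> : (-1) / t = L (- (iota t^-1 * 1)).
  have -> : - (iota t^-1 * 1) = iota (- t^-1) * 1 by rewrite rmorphN mulNr.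
  by rewrite LZ L1 mulr1 mulN1r.
rewrite -LB.
have -> : - (iota t^-1 * x) - - (iota t^-1 * 1) = iota (- t^-1 ^+ 2) * (T * x).
  have x1 : x = 1 + iota t^-1 * T * x by rewrite -{1}xE; ring.
  by rewrite rmorphN rmorphXn /= {1}x1; ring.
rewrite LZ cabsM cabsN cabsX cabsV mulrC exprVn ler_wpM2r ?invr_ge0 ?exprn_ge0 ?cabs_ge0//.
rewrite (le_trans (LN _))// (_ : 4 * N T = 2 * (N T * 2)); last by ring.
by rewrite ler_wpM2l// (le_trans (NM _ _))// ler_wpM2l.
Qed.

(** The function [t |-> L (c t)] would be entire, and equivalent to [- 1 / t] at
   infinity, against Cauchy's theorem. *)
Lemma no_global_inverse : False.
Proof.
(* The contour integral of [g + 1 / t] is at most [32 N T / s < 1], against [2 pi]. *)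
pose s := 34 * N T + 1; have s0 : 0 < s by rewrite ltr_wpDl// mulr_ge0.
have z0 : square_int (g \o cpt) 0 s = 0.
  rewrite (@Green_square R _ (g' \o cpt) (fun q => 'i%C * g' (cpt q)) 0 s s0 (fun p _ _ => g_hol p)).
  under eq_Rintegral do rewrite hol_CR.
  by rewrite /Rintegral integral0.
have := @square_int_inv R (-1) 0 s s0.
have := @square_int_dist R (g \o cpt) (fun p => -1 / (cpt p - 0%:C)) 0 s (4 * N T / s ^+ 2) s0.
move=> h E.
have {h} := h _; rewrite z0 E sub0r normrN => h.
have : `|2 * pi * complex.Re (-1 : R[i])| <= 8 * s * (4 * N T / s ^+ 2).
  apply: h => p [p1 p2 p3].
  have ps : s <= cabs (cpt p).
    move: p3; rewrite subr0 => -[] <-; first exact: (Re_le_cabs (cpt p)).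
    exact: (Im_le_cabs (cpt p)).
  have p0 : cpt p != 0.
    by apply/eqP => E0; move: ps; rewrite E0 cabs0 leNgt s0.
  split.
  - by case: (g_hol p).
  - apply: ccontM; first exact: ccont_cst.
    by have [_ _] := @hol_at_inv R 0%:C p p0.
  - rewrite subr0; apply: (le_trans (g_infty p0 _)).
      by apply: le_trans ps; rewrite /s; have := N_ge0 T; lra.
    rewrite ler_wpM2l ?mulr_ge0// lef_pV2 ?posrE ?exprn_gt0 ?cabs_gt0//.
    by rewrite lerXn2r ?nnegrE ?cabs_ge0// ltW.
rewrite raddfN /= mulrN mulr1 normrN ger0_norm; last by rewrite mulr_ge0// pi_ge0.
have -> : 8 * s * (4 * N T / s ^+ 2) = 32 * N T / s.
  by field; rewrite gt_eqF.
have : 32 * N T / s <= 1.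
  by rewrite ler_pdivrMr// /s; have := N_ge0 T; lra.
have := pi_ge2 R; lra.
Qed.

End SpectralPoint.

(** * The bicommutant of the resolvents *)

Section Bicommutant.
Context {R : realType} {B : completeNormedModType R[i]}.
Variable H : operator B.

Definition commuting (S : B -> B) := bounded_linear S /\
  forall z v, rho H z -> S (resolvent H z v) = resolvent H z (S v).

(** The bicommutant contains the resolvents, is commutative because they commute, and
   contains the inverses of its elements: this is all that is needed of an algebra
   generated by the resolvents. *)
Definition bicommuting (A : B -> B) := bounded_linear A /\
  forall S, commuting S -> forall v, A (S v) = S (A v).

Lemma bicomm_res z : rho H z -> bicommuting (resolvent H z).
Proof. by move=> rz; split=> [|S [_ cS] v]; [exact: res_blin|rewrite cS]. Qed.

Lemma commuting_bicomm A : bicommuting A -> commuting A.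
Proof.
move=> [bA cA]; split=> // z v rz; apply: cA; split; first exact: res_blin.
by move=> w u rw; exact: res_comm.
Qed.

Lemma bicomm_lin a A C : bicommuting A -> bicommuting C -> bicommuting (a *: A + C).
Proof.
move=> [bA cA] [bC cC]; split; first exact: blinD.
move=> S hS v; have [bS _] := hS.
change (a *: A (S v) + C (S v) = S (a *: A v + C v)).
by rewrite cA// cC// (blin_lin bS).
Qed.

Lemma bicomm0 : bicommuting 0.
Proof. by split=> [|S [bS _] v]; [exact: blin0|rewrite (lin0 bS.1)]. Qed.

Lemma bicomm_id : bicommuting id.
Proof. by split=> //; exact: blin_id. Qed.

Lemma bicomm_comp A C : bicommuting A -> bicommuting C -> bicommuting (A \o C).
Proof.
move=> [bA cA] [bC cC]; split; first exact: blin_comp.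
by move=> S hS v /=; rewrite cC// cA.
Qed.

Lemma bicomm_inv A C : bicommuting A -> bounded_linear C ->
  (forall v, A (C v) = v) -> (forall v, C (A v) = v) -> bicommuting C.
Proof.
move=> [bA cA] bC AC CA; split=> // S hS v.
by rewrite -[in LHS](AC v) -cA// CA.
Qed.

Definition bicommb : pred (B -> B) := fun A => `[< bicommuting A >].

(** As a type, the bicommutant is a commutative ring, in which identities modulo an
   ideal are proved by the tactic [ring]. *)
Record bicomm_alg := BicommAlg { bval :> B -> B ; _ : bicommb bval }.

HB.instance Definition _ := [isSub for bval].
HB.instance Definition _ := [Choice of bicomm_alg by <:].

Definition mkb A (h : bicommuting A) : bicomm_alg := BicommAlg (asboolT h).

Lemma bvalP (x : bicomm_alg) : bicommuting x.
Proof. by case: x => A /= /asboolP. Qed.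

Lemma bval_blin (x : bicomm_alg) : bounded_linear x.
Proof. by case: (bvalP x). Qed.

Lemma bicommD A C : bicommuting A -> bicommuting C -> bicommuting (A + C).
Proof. by move=> hA hC; have := bicomm_lin 1 hA hC; rewrite scale1r. Qed.

Lemma bicommN A : bicommuting A -> bicommuting (- A).
Proof. by move=> hA; have := bicomm_lin (-1) hA bicomm0; rewrite scaleN1r addr0. Qed.

Let add (x y : bicomm_alg) := mkb (bicommD (bvalP x) (bvalP y)).
Let opp (x : bicomm_alg) := mkb (bicommN (bvalP x)).
Let mul (x y : bicomm_alg) := mkb (bicomm_comp (bvalP x) (bvalP y)).

Let addA : associative add. Proof. by move=> x y z; apply: val_inj; exact: addrA. Qed.
Let addC : commutative add. Proof. by move=> x y; apply: val_inj; exact: addrC. Qed.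
Let add0 : left_id (mkb bicomm0) add. Proof. by move=> x; apply: val_inj; exact: add0r. Qed.
Let addN : left_inverse (mkb bicomm0) opp add.
Proof. by move=> x; apply: val_inj; exact: addNr. Qed.

HB.instance Definition _ := GRing.isZmodule.Build bicomm_alg addA addC add0 addN.

Let mulA : associative mul. Proof. by move=> x y z; exact: val_inj. Qed.
Let mulC : commutative mul.
Proof.
move=> x y; apply: val_inj; apply/funext => v /=.
by have [_ ->] := bvalP x; last exact: commuting_bicomm (bvalP y).
Qed.
Let mul1 : left_id (mkb bicomm_id) mul. Proof. by move=> x; exact: val_inj. Qed.
Let mulD : left_distributive mul add.
Proof. by move=> x y z; exact: val_inj. Qed.

HB.instance Definition _ := GRing.Zmodule_isComPzRing.Build bicomm_alg mulA mulC mul1 mulD.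

Lemma bicomm_scalar (a : R[i]) : bicommuting (a *: id).
Proof. by have := bicomm_lin a bicomm_id bicomm0; rewrite addr0. Qed.

Definition scalar (a : R[i]) : bicomm_alg := mkb (bicomm_scalar a).

Let scalarB : zmod_morphism scalar.
Proof. by move=> a b; apply: val_inj; exact: scalerBl. Qed.

Let scalarM : monoid_morphism scalar.
Proof.
split; first by apply: val_inj; exact: scale1r.
by move=> a b; apply: val_inj; apply/funext => v /=; rewrite !fctE /= scalerA.
Qed.

HB.instance Definition _ := GRing.isZmodMorphism.Build R[i] bicomm_alg scalar scalarB.
HB.instance Definition _ := GRing.isMonoidMorphism.Build R[i] bicomm_alg scalar scalarM.

Lemma bicomm_neumann (k : bicomm_alg) : opn k < 1 ->
  exists2 x : bicomm_alg, x * (1 - k) = 1 & opn x <= (1 - opn k)^-1.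
Proof.
move=> k1; have [S [bS S1 S2 Sn]] := neumann (bval_blin k) k1.
have hS : bicommuting S.
  exact: (bicomm_inv (bvalP (1 - k)) bS S1 S2).
by exists (mkb hS) => //; apply: val_inj; apply/funext => v; exact: S2.
Qed.

(** Proper ideals stay at distance [1] from the identity, by the Neumann series. *)
Lemma ideal_functional (J : set bicomm_alg) : J 0 ->
  (forall x y, J x -> J y -> J (x - y)) -> (forall a x, J x -> J (a * x)) -> ~ J 1 ->
  exists L : (B -> B) -> R[i],
    [/\ forall a S T, bounded_linear S -> bounded_linear T -> L (a *: S + T) = a * L S + L T,
        forall x : bicomm_alg, J x -> L x = 0, L id = 1 &
        forall S, bounded_linear S -> cabs (L S) <= 2 * opn S].
Proof.
move=> J0 JB JM J1.
have JD x y : J x -> J y -> J (x + y).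
  by move=> Jx Jy; rewrite -[y]opprK; apply: (JB) => //; rewrite -sub0r; exact: JB.
have [|||||||||L [L1 L2 L3 L4]] := @hahn_banach_separation R (B -> B) bounded_linear opn _ _ _ _
  [set S | exists2 x, J x & S = bval x] id.
- exact: blin0.
- by move=> a S T; exact: blinD.
- by move=> S T; exact: opnD.
- by move=> a S; exact: opnZ.
- by exists 0.
- move=> a _ _ [x Jx ->] [y Jy ->]; exists (scalar a * x + y) => //.
  by apply: JD => //; exact: JM.
- by move=> _ [x _ ->]; exact: bval_blin.
- exact: blin_id.
- move=> _ [x Jx ->]; rewrite leNgt; apply/negP => x1.
  have [y] := @bicomm_neumann (1 - x) x1.
  rewrite opprB addrC subrK => yx _; apply: J1.
  by rewrite -yx; exact: JM.
exists L; split=> // x Jx; apply: L2; by exists x.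
Qed.

(** For the ideal [J = a A] alone, [no_global_inverse] gives the value [t]; the ideal
   generated by [a] and [T - t] is then proper as well. *)
Lemma spectral_functional (a T : bicomm_alg) : ~ (exists x, x * a = 1) ->
  exists t, exists L : (B -> B) -> R[i],
    [/\ forall c S S', bounded_linear S -> bounded_linear S' -> L (c *: S + S') = c * L S + L S',
        forall x : bicomm_alg, L (bval (x * a)) = 0,
        forall x : bicomm_alg, L (bval (x * (T - scalar t))) = 0,
        L id = 1 & forall S, bounded_linear S -> cabs (L S) <= 2 * opn S].
Proof.
move=> na; pose J := [set y : bicomm_alg | exists x, y = x * a].
have J0 : J 0 by exists 0; rewrite mul0r.
have JB x y : J x -> J y -> J (x - y).
  by move=> [u ->] [v ->]; exists (u - v); rewrite mulrBl.
have JM b x : J x -> J (b * x) by move=> [u ->]; exists (b * u); rewrite mulrA.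
have J1 : ~ J 1 by move=> [x xE]; apply: na; exists x.
have [L0 [A1 A2 A3 A4]] := ideal_functional J0 JB JM J1.
have [t tP] : exists t, forall c, ~ J (1 - (T - scalar t) * c).
  apply: contrapT => /forallNP h.
  have /choice [c cP] : forall t, exists c, J (1 - (T - scalar t) * c).
    move=> t; apply: contrapT => /forallNP h'; exact: (h t).
  apply: (@no_global_inverse R bicomm_alg scalar (fun x => opn x) _ _ _ _ J
     (fun x => L0 (bval x)) _ _ _ _ _ _ _ T c cP) => //.
  - by move=> x; apply: opn_ge0; exact: bval_blin.
  - by move=> x y; apply: opn_comp; exact: bval_blin.
  - by move=> b x; apply: opnZ; exact: bval_blin.
  - exact: bicomm_neumann.
  - by move=> x y; apply: (bformD A1); exact: bval_blin.
  - by move=> b x; apply: (bformZ A1); exact: bval_blin.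
  - by move=> x; apply: A4; exact: bval_blin.
pose Jt := [set y : bicomm_alg | exists u v, y = u * a + v * (T - scalar t)].
have [||||L [L1 L2 L3 L4]] := @ideal_functional Jt.
- by exists 0, 0; rewrite !mul0r addr0.
- move=> _ _ [u [v ->]] [u' [v' ->]]; exists (u - u'), (v - v'); ring.
- move=> b _ [u [v ->]]; exists (b * u), (b * v); ring.
- move=> [u [v E]]; apply: (tP v); exists u.
  by rewrite E; ring.
exists t, L; split=> // x; apply: L2.
  by exists x, 0; rewrite mul0r addr0.
by exists 0, x; rewrite mul0r add0r.
Qed.

End Bicommutant.

(** * Cauchy's formula for the resolvent when the spectrum is bounded *)

Section ContourTools.
Context {R : realType}.

Lemma ccont_bounded (K : set (R * R)) (G : R * R -> R[i]) : compact K ->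
  (forall p, K p -> ccont G p) -> exists2 M, 0 <= M & forall p, K p -> cabs (G p) <= M.
Proof.
move=> /compact_near_coveringP cK cG.
have [|k0 _ Hk] := cK nat \oo (fun k p => cabs (G p) <= k%:R).
  move=> p Kp; have near1 := ccont_near (cG p Kp) (@ltr01 R).
  exists ([set q | cabs (G q - G p) <= 1], [set k | (Num.truncn (cabs (G p) + 1) < k)%N]) => /=.
    by split=> //; exists (Num.truncn (cabs (G p) + 1)).+1.
  move=> [q k] [/= h1 h2]; apply: (@le_trans _ _ (cabs (G p) + 1)).
    by rewrite -(subrK (G p) (G q)) (le_trans (cabsD _ _))// addrC lerD2l.
  by rewrite ltW// (lt_le_trans (truncnS_gt _))// ler_nat.
by exists k0%:R => // p Kp; exact: (Hk k0 (leqnn k0) p Kp).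
Qed.

Lemma hol_pow (D : set (R * R)) (h h' : R * R -> R[i]) m :
  (forall p, D p -> hol_at h h' p) ->
  exists P', forall p, D p -> hol_at (fun q => h q ^+ m) P' p.
Proof.
move=> hh; elim: m => [|m [P' IH]].
  by exists (fun=> 0) => p _; exact: hol_at_cst.
exists (fun q => h' q * h q ^+ m + h q * P' q) => p Dp.
have := hol_atM (hh p Dp) (IH p Dp).
by under [X in hol_at X]eq_fun do rewrite -exprS.
Qed.

Lemma hol_frame (G G' : R * R -> R[i]) (a b : R) : 0 < a -> a < b ->
  (forall p, (a <= `|p.1|) || (a <= `|p.2|) -> hol_at G G' p) ->
  square_int G 0 b = square_int G 0 a.
Proof.
move=> a0 ab hG; apply/eqP; rewrite -subr_eq0; apply/eqP.
rewrite (@Green_frame R G G' (fun q => 'i%C * G' q) 0 a b a0 ab); last first.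
  by move=> p _ _; rewrite subr0; exact: hG.
have z D : \int[(lebesgue_measure \x lebesgue_measure)%E]_(p in D)
    (complex.Re (G' p) - complex.Im ('i%C * G' p)) = 0.
  under eq_Rintegral do rewrite hol_CR.
  by rewrite /Rintegral integral0.
by rewrite !z !addr0.
Qed.

Lemma pow_near1 (w : R[i]) m : cabs w <= 2 -> cabs ((1 - w) ^+ m - 1) <= 4 ^+ m * cabs w.
Proof.
move=> w2; have w0 := cabs_ge0 w; elim: m => [|m IH].
  by rewrite !expr0 subrr cabs0 mul1r.
have -> : (1 - w) ^+ m.+1 - 1 = ((1 - w) ^+ m - 1) * (1 - w) - w.
  by rewrite exprSr; ring.
apply: (le_trans (cabsB _ _)); rewrite cabsM.
have h1 : cabs (1 - w) <= 3.
  by apply: (le_trans (cabsB _ _)); rewrite cabs1; lra.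
have h4 : 1 <= 4 ^+ m :> R by rewrite exprn_ege1// ler1n.
apply: (@le_trans _ _ (4 ^+ m * cabs w * 3 + cabs w)).
  by rewrite lerD2r ler_pM ?cabs_ge0.
have : cabs w <= 4 ^+ m * cabs w by rewrite ler_peMl.
by rewrite exprSr; move: (4 ^+ m) (cabs w) => x y; nra.
Qed.

(** On the vertical sides, [N ^ 2 - z ^ 2 = y ^ 2 - 2 i x y] is small with [y]; on the
   horizontal sides [|y| / N = 1] and the trivial bound is enough. *)
Lemma damping (N : R) p : 1 <= N -> on_square 0 N p ->
  cabs (1 - cpt p ^+ 2 * (N ^- 2)%:C) <= 3 * (`|p.2| / N).
Proof.
case: p => x y N1 [/=]; rewrite subr0 => xN yN xyN.
have N0 : 0 < N by rewrite (lt_le_trans ltr01).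
have N20 : 0 < N ^+ 2 by rewrite exprn_gt0.
have -> : 1 - cpt (x, y) ^+ 2 * (N ^- 2)%:C =
    ((N ^+ 2 - x ^+ 2 + y ^+ 2) / N ^+ 2) +i* (- (2 * x * y) / N ^+ 2).
  rewrite /cpt /=; apply/eqP; rewrite eq_complex; simpc; apply/andP; split; apply/eqP => /=.
    by field; rewrite gt_eqF.
  by field; rewrite gt_eqF.
apply: (le_trans (cabs_le _)) => /=.
rewrite !normrM [`|N ^- 2|]ger0_norm ?invr_ge0 ?(ltW N20)// -mulrDl ler_pdivrMr//.
have -> : 3 * (`|y| / N) * N ^+ 2 = 3 * (`|y| * N) by field; rewrite gt_eqF.
rewrite !normrN normrM normrM (ger0_norm (ler0n _ 2)).
rewrite -(real_normK (num_real x)) -(real_normK (num_real y)).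
have := normr_ge0 x; have := normr_ge0 y; move: (`|x|) (`|y|) xN yN xyN => a b aN bN abN b0 a0.
rewrite ger0_norm; last by nra.
case: abN => E; rewrite E in aN bN *; nra.
Qed.

Lemma damping_arith (u N c C W : R) n : u != 0 -> N != 0 ->
  (3 * u) ^+ n.+1 * (C * (c * (u * N)^-1 * (2 / u) ^+ n * W) * N^-1) =
  3 ^+ n.+1 * 2 ^+ n * c * (C * W) / N ^+ 2.
Proof.
move=> u0 N0; rewrite exprMn expr_div_n [u ^+ n.+1]exprSr.
have un : u ^+ n != 0 by rewrite expf_neq0.
move: (u ^+ n) (2 ^+ n) (3 ^+ n.+1) un => U T V un.
by field; rewrite un u0 N0.
Qed.

End ContourTools.

Section HolomorphicResolvent.
Context {R : realType} {B : completeNormedModType R[i]}.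
Variable H : operator B.
Variables (l : B -> R[i]) (Cl : R).
Hypothesis lin_l : forall a u w, l (a *: u + w) = a * l u + l w.
Hypothesis Cl0 : 0 <= Cl.
Hypothesis bnd_l : forall u, cabs (l u) <= Cl * rnorm u.

Let lD := lformD lin_l.
Let lZ := lformZ lin_l.
Let lB := lformB lin_l.

Notation Rs := (resolvent H).

(** The resolvent identity, applied twice, gives a Taylor expansion of order two with the
   derivative [- R z (R z v)]. *)
Lemma res_hol (v : B) (p : R * R) (d : R) : 0 < d ->
  (forall w, cabs (w - cpt p) < d -> rho H w) ->
  hol_at (fun q => l (Rs (cpt q) v)) (fun q => - l (Rs (cpt q) (Rs (cpt q) v))) p.
Proof.
set z := cpt p => d0 rw; set a := opn (Rs z).
have a0 : 0 <= a by apply: opn_ge0; exact: res_blin.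
have a1 : 0 < 2 * (a + 1) by rewrite mulr_gt0// ltr_wpDl.
have V0 := rnorm_ge0 v; set V := rnorm v in V0.
have M0 : 0 <= 6 * a ^+ 3 * (Cl * V) by rewrite !mulr_ge0// exprn_ge0.
apply: (@C1at_hol R (fun w => l (Rs w v)) (fun w => - l (Rs w (Rs w v))) p
  (6 * a ^+ 3 * (Cl * V)) (Num.min d (2 * (a + 1))^-1)) => //.
  by rewrite lt_min d0 invr_gt0.
move=> w; rewrite -/z lt_min => /andP[wd wa].
have rz : rho H z by apply: rw; rewrite subrr cabs0.
have rw' : rho H w by exact: rw.
have bw := res_blin H w; have bz := res_blin H z.
have b2 : opn (Rs w) <= 2 * a.
  apply: res_local_bound => //; apply: (@le_trans _ _ ((2 * (a + 1))^-1 * (a + 1))).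
    by rewrite ler_pM ?cabs_ge0// ?lerDl// ltW.
  by rewrite invfM -mulrA mulVf ?mulr1// gt_eqF// ltr_wpDl.
have c0 := cabs_ge0 (w - z).
have nz u : rnorm (Rs z u) <= a * rnorm u by exact: rnorm_opn.
have nw u : rnorm (Rs w u) <= 2 * a * rnorm u.
  by apply: (le_trans (rnorm_opn u bw)); rewrite ler_wpM2r// rnorm_ge0.
have a20 : 0 <= 2 * a by rewrite mulr_ge0.
have zw u : Rs w u - Rs z u = (z - w) *: Rs w (Rs z u) by exact: res_identity.
split.
  have -> : l (Rs w v) - l (Rs z v) - - l (Rs z (Rs z v)) * (w - z) =
      (w - z) ^+ 2 * l (Rs w (Rs z (Rs z v))).
    rewrite -lB zw lZ mulNr opprK.
    have -> : Rs w (Rs z v) = Rs z (Rs z v) + (z - w) *: Rs w (Rs z (Rs z v)).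
      by rewrite -zw addrC subrK.
    by rewrite lD lZ; ring.
  rewrite cabsM cabsX mulrC ler_wpM2r ?exprn_ge0//.
  apply: (le_trans (bnd_l _)).
  apply: (@le_trans _ _ (Cl * (2 * a * (a * (a * V))))).
    rewrite ler_wpM2l// (le_trans (nw _))// ler_wpM2l// (le_trans (nz _))// ler_wpM2l//.
  have : 0 <= a ^+ 3 * (Cl * V) by rewrite !mulr_ge0// exprn_ge0.
  have -> : Cl * (2 * a * (a * (a * V))) = 2 * (a ^+ 3 * (Cl * V)) by ring.
  by rewrite -mulrA; move: (a ^+ 3 * _) => x; lra.
have -> : - l (Rs w (Rs w v)) - - l (Rs z (Rs z v)) =
    (w - z) * (l (Rs w (Rs w (Rs z v))) + l (Rs w (Rs z (Rs z v)))).
  rewrite opprK addrC -lB -lD.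
  have -> : Rs z (Rs z v) - Rs w (Rs w v) =
     - ((Rs w (Rs z v) - Rs z (Rs z v)) + (Rs w (Rs w v) - Rs w (Rs z v))).
    by rewrite -[LHS]opprB [in RHS]addrC addrA subrK.
  rewrite zw -(linB bw.1) zw (linZ bw.1) -scalerDr -scaleNr opprB lZ.
  by congr (_ * l _); rewrite addrC.
rewrite cabsM mulrC ler_wpM2r// (le_trans (cabsD _ _))//.
apply: (@le_trans _ _ (Cl * (2 * a * (2 * a * (a * V))) + Cl * (2 * a * (a * (a * V))))).
  apply: lerD; apply: (le_trans (bnd_l _)); rewrite ler_wpM2l//.
    by rewrite (le_trans (nw _))// ler_wpM2l// (le_trans (nw _))// ler_wpM2l.
  by rewrite (le_trans (nw _))// ler_wpM2l// (le_trans (nz _))// ler_wpM2l.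
by rewrite le_eqVlt; apply/orP; left; apply/eqP; ring.
Qed.

Variables (c alpha : R) (n : nat).
Hypothesis HH : standing_hypothesis H c alpha.
Hypothesis hn : alpha <= n%:R.
Variables (r s : R).
Hypothesis r0 : 0 <= r.
Hypothesis rs : r < s.
Hypothesis sH : forall x : R, spectrum H x%:C -> `|x| <= r.

Lemma rho_out z : r < `|complex.Re z| \/ complex.Im z != 0 -> rho H z.
Proof.
move=> out sz; have [_ /(_ z sz) iz _ _ _] := HH.
case: out => [|]; last by rewrite iz eqxx.
by rewrite ltNge => /negP; apply; apply: sH; case: z sz iz => x y /= + y0; rewrite y0.
Qed.

Lemma near_out (p : R * R) : (s <= `|p.1|) || (s <= `|p.2|) ->
  exists2 d, 0 < d & forall w, cabs (w - cpt p) < d -> rho H w.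
Proof.
move=> sp; exists (s - r); first by rewrite subr_gt0.
move=> w wd; apply: rho_out; case/orP: sp => sp; [left|right].
  have h := le_lt_trans (Re_le_cabs _) wd; rewrite raddfB /= in h.
  have := ler_distD (complex.Re w) p.1 0; rewrite !subr0 distrC => h2.
  by have := rs; lra.
have h := le_lt_trans (Im_le_cabs _) wd; rewrite raddfB /= in h.
have := ler_distD (complex.Im w) p.2 0; rewrite !subr0 distrC => h2.
by rewrite -normr_gt0; have := rs; have := r0; lra.
Qed.

Let s0 : 0 < s. Proof. exact: le_lt_trans r0 rs. Qed.

Let contour : set (R * R) := (rect s s (- s) s `|` rect (- s) (- s) (- s) s) `|`
   (rect (- s) s s s `|` rect (- s) s (- s) (- s)).

Let compact_contour : compact contour.
Proof. by apply: compactU; apply: compactU; exact: compact_rect. Qed.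

Let on_contour p : on_square 0 s p -> contour p.
Proof.
case: p => x y [/=]; rewrite subr0 => h1 h2 h3.
have h (u : R) : `|u| <= s -> u \in `[- s, s] by rewrite ler_norml in_itv.
have e (u : R) : `|u| = s -> u = s \/ u = - s.
  by move=> us; have := ger0P u; case: (ger0P u) us => _ <- _; [left|right; rewrite opprK].
case: h3 => /e[] ->; [left; left|left; right|right; left|right; right];
  split => //=; rewrite ?in_itv /= ?lexx//; exact: h.
Qed.

Let contour_out p : contour p -> (s <= `|p.1|) || (s <= `|p.2|).
Proof.
have ns : `|- s| = s by rewrite normrN gtr0_norm.
have ps : `|s| = s by rewrite gtr0_norm.
have e (u v : R) : u <= v <= u -> v = u by move=> h; apply/eqP; rewrite eq_le andbC.
case: p => x y [] [] [/=]; rewrite !in_itv /=.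
- by move=> /e -> _; rewrite ps lexx.
- by move=> /e -> _; rewrite ns lexx.
- by move=> _ /e ->; rewrite ps lexx orbT.
- by move=> _ /e ->; rewrite ns lexx orbT.
Qed.

Let out_neq p : (s <= `|p.1|) || (s <= `|p.2|) -> cpt p != 0.
Proof.
move=> h; apply/eqP => E; have [E1 E2] : p.1 = 0 /\ p.2 = 0 by case: E.
by move: h; rewrite E1 E2 normr0 orbb leNgt s0.
Qed.

Let damp (N : R) (q : R * R) : R[i] := 1 - cpt q ^+ 2 * (N ^- 2)%:C.

Let damp_hol N p : hol_at (damp N) (fun q => - (2 * cpt q * (N ^- 2)%:C)) p.
Proof.
set a : R[i] := (N ^- 2)%:C.
apply: (@C1at_hol R (fun w => 1 - w ^+ 2 * a) (fun w => - (2 * w * a)) p (2 * cabs a) 1) => //.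
  by rewrite mulr_ge0 ?cabs_ge0.
move=> w _; set z := cpt p; split.
  have -> : 1 - w ^+ 2 * a - (1 - z ^+ 2 * a) - - (2 * z * a) * (w - z) = - (a * (w - z) ^+ 2) by ring.
  rewrite cabsN cabsM cabsX ler_wpM2r ?exprn_ge0 ?cabs_ge0//.
  by have := cabs_ge0 a; lra.
have -> : - (2 * w * a) - - (2 * z * a) = - (2%:R%:C * (a * (w - z))).
  by rewrite rmorph_nat; ring.
by rewrite cabsN !cabsM cabsR ger0_norm// mulrA.
Qed.

(** The difference between [R z v] and [v / z] is [R z (H v) / z].  On a square of half
   side [N] its modulus is of order [1 / N], but for the negative powers of [|y| / N] that
   come from the resolvent bound near the axis.  The factor [(1 - z ^ 2 / N ^ 2) ^ m]
   compensates these powers on the large square, and tends to [1] on the small one. *)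
Lemma contour_formula v : dom H v ->
  square_int (fun q => l (Rs (cpt q) v)) 0 s = 2 * pi * complex.Re (l v).
Proof.
move=> Dv; rewrite -(square_int_inv (l v) 0 s0).
set G := fun q => l (Rs (cpt q) v); set E := fun q => l v / (cpt q - 0%:C).
pose G' q := - l (Rs (cpt q) (Rs (cpt q) v)).
pose E' (q : R * R) := 0 * (cpt q - 0%:C)^-1 + l v * - (cpt q - 0%:C)^-1 ^+ 2.
have hG p : (s <= `|p.1|) || (s <= `|p.2|) -> hol_at G G' p.
  by move=> /near_out[d d0 hd]; exact: res_hol hd.
have hE p : (s <= `|p.1|) || (s <= `|p.2|) -> hol_at E E' p.
  move=> /out_neq p0; apply: (hol_atM (hol_at_cst (l v) p)); exact: hol_at_inv.
have cG p : contour p -> ccont G p by move=> /contour_out /hG[].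
have cE p : contour p -> ccont E p by move=> /contour_out /hE[].
have [MG MG0 bG] := ccont_bounded compact_contour cG.
have [ME ME0 bE] := ccont_bounded compact_contour cE.
set w := app H v; set W := rnorm w; have W0 : 0 <= W := rnorm_ge0 w.
have GE q : rho H (cpt q) -> cpt q != 0 -> G q - E q = l (Rs (cpt q) w) / cpt q.
  move=> rq q0; have [bR _ /(_ v Dv)] := rhoP rq.
  rewrite (linB bR.1) (linZ bR.1) => h.
  have := congr1 l h; rewrite lB lZ /G /E subr0 => hl.
  by apply: (mulIf q0); rewrite mulrBl !divfK// mulrC -hl /w; ring.
have [_ _ c0 al0 _] := HH.
(* One factor compensates [1 / |y|], and [n] factors the power [alpha]. *)
pose m := n.+1.
pose C1 := 8 * s * (4 ^+ m * 2 * MG) + 8 * s * (4 ^+ m * 2 * ME) + 8 * (3 ^+ m * 2 ^+ n * c * (Cl * W)).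
apply/eqP; rewrite -subr_eq0 -normr_le0; apply/eqP/eqP.
apply: (@le0_cvg0 R _ C1 (fun k => k.+1%:R^-1)); first exact: cvg_harmonic.
move=> k; set kk : R := k.+1%:R^-1.
(* This size is larger than [1], [s] and [k], and [s / N <= 1 / (k + 1)]. *)
pose N : R := k.+1%:R * (s + 1).
have k1 : 1 <= k.+1%:R :> R by rewrite ler1n.
have kk0 : 0 < kk by rewrite invr_gt0.
have kkE : kk * k.+1%:R = 1 by rewrite mulVf.
have N1 : 1 <= N by rewrite /N; have := s0; nra.
have sN : s < N by rewrite /N; have := s0; nra.
have N0 : 0 < N by exact: lt_trans sN.
have Nkk : N^-1 <= kk.
  by rewrite lef_pV2 ?posrE// /N; have := s0; nra.
have sNk : s / N <= kk.
  by rewrite ler_pdivrMr// /N mulrA kkE mul1r lerDl.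
have [P' hP] := @hol_pow R setT (damp N) _ m (fun p _ => damp_hol N p).
pose D q := damp N q ^+ m.
have fr (K K' : R * R -> R[i]) : (forall p, (s <= `|p.1|) || (s <= `|p.2|) -> hol_at K K' p) ->
    square_int (fun q => D q * K q) 0 N = square_int (fun q => D q * K q) 0 s.
  move=> hK; apply: (hol_frame s0 sN) => p ps.
  exact: (hol_atM (hP p Logic.I) (hK p ps)).
have cD (K : R * R -> R[i]) p : ccont K p -> ccont (fun q => D q * K q) p.
  by move=> cK; apply: ccontM => //; have [] := hP p Logic.I.
have near_s (K : R * R -> R[i]) MK : 0 <= MK -> (forall p, contour p -> ccont K p) ->
    (forall p, contour p -> cabs (K p) <= MK) ->
    `|square_int (fun q => D q * K q) 0 s - square_int K 0 s| <= 8 * s * (4 ^+ m * (2 * kk) * MK).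
  move=> MK0 cK bK; apply: square_int_dist => // p ps.
  have cp := on_contour ps; have [p1 p2 _] := ps; rewrite subr0 in p1.
  split; [exact: (cD _ _ (cK p cp))|exact: cK|].
  have -> : D p * K p - K p = (D p - 1) * K p by ring.
  have zz : cabs (cpt p ^+ 2 * (N ^- 2)%:C) <= 2 * kk.
    rewrite cabsM cabsX sqr_cabs cabsR ger0_norm ?invr_ge0 ?exprn_ge0 ?(ltW N0)//.
    apply: (@le_trans _ _ (2 * (s / N) ^+ 2)).
      rewrite expr_div_n mulrA ler_wpM2r ?invr_ge0 ?exprn_ge0 ?(ltW N0)//=.
      rewrite -(real_normK (num_real p.1)) -(real_normK (num_real p.2)).
      by have := normr_ge0 p.1; have := normr_ge0 p.2; nra.
    have sN0 : 0 <= s / N by rewrite divr_ge0// ltW// s0.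
    have kk1 : kk <= 1 by rewrite /kk invf_le1.
    by nra.
  rewrite cabsM ler_pM ?cabs_ge0 ?bK//.
  have kk1 : kk <= 1 by rewrite /kk invf_le1.
  apply: (le_trans (pow_near1 m _)); first by apply: (le_trans zz); lra.
  by rewrite ler_wpM2l ?exprn_ge0.
have far : `|square_int (fun q => D q * G q) 0 N - square_int (fun q => D q * E q) 0 N| <=
    8 * N * (3 ^+ m * 2 ^+ n * c * (Cl * W) / N ^+ 2).
  apply: square_int_dist => // p ps.
  have [p1 p2 p3] := ps; rewrite subr0 in p1 p3.
  have po : (s <= `|p.1|) || (s <= `|p.2|).
    by case: p3 => ->; rewrite (ltW sN) ?orbT.
  have p0 := out_neq po.
  split; [by apply: cD; case: (hG p po)|by apply: cD; case: (hE p po)|].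
  have rp : rho H (cpt p) by have [d d0] := near_out po; apply; rewrite subrr cabs0.
  rewrite -mulrBr GE// !cabsM cabsV cabsX.
  have zN : N <= cabs (cpt p).
    by case: p3 => <-; [exact: (Re_le_cabs (cpt p))|exact: (Im_le_cabs (cpt p))].
  have dp := damping N1 ps.
  have B0 : 0 <= 3 ^+ m * 2 ^+ n * c * (Cl * W) / N ^+ 2.
    by rewrite !mulr_ge0 ?invr_ge0 ?exprn_ge0 ?(ltW N0)// ltW.
  have [y0|y0] := eqVneq p.2 0.
    have -> : cabs (damp N p) = 0.
      apply/eqP; rewrite eq_le cabs_ge0 andbT; apply: (le_trans dp).
      by rewrite y0 normr0 mul0r mulr0.
    by rewrite expr0n /= mul0r.
  set u := `|p.2| / N in dp.
  have ny0 : 0 < `|p.2| by rewrite normr_gt0.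
  have u0 : 0 < u by rewrite divr_gt0.
  have u1 : u <= 1 by rewrite ler_pdivrMr// mul1r.
  have yE : `|p.2| = u * N by rewrite divfK// gt_eqF.
  have jN : jap (cpt p) <= 2 * N.
    rewrite /jap -/(cabs (cpt p)) -[leRHS]ger0_norm; last by rewrite mulr_ge0// ltW.
    rewrite -sqrtr_sqr ler_wsqrtr// sqr_cabs /=.
    rewrite -(real_normK (num_real p.1)) -(real_normK (num_real p.2)).
    by have := normr_ge0 p.1; have := normr_ge0 p.2; nra.
  have oR : opn (Rs (cpt p)) <= c * (u * N)^-1 * (2 / u) ^+ n.
    have := opn_res_le HH (z := cpt p) y0; move/le_trans; apply.
    have uN0 : 0 <= u * N by rewrite mulr_ge0// ltW.
    rewrite /= yE; apply: ler_wpM2l; first by rewrite mulr_ge0 ?invr_ge0// ltW.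
    have J0 : 0 <= jap (cpt p) / (u * N) by rewrite divr_ge0 ?sqrtr_ge0// mulr_ge0// ltW.
    have ju : jap (cpt p) / (u * N) <= 2 / u.
      have -> : 2 / u = 2 * N / (u * N) by field; rewrite !gt_eqF.
      by rewrite ler_wpM2r// invr_ge0 mulr_ge0// ltW.
    have u2 : 1 <= 2 / u by rewrite ler_pdivlMr//; lra.
    rewrite -powR_mulrn; last by rewrite divr_ge0// ltW.
    apply: (@le_trans _ _ ((2 / u) `^ alpha)).
      by apply: ge0_ler_powR => //; rewrite nnegrE// divr_ge0// ltW.
    by apply: ler_powR.
  have lw : cabs (l (Rs (cpt p) w)) <= Cl * (c * (u * N)^-1 * (2 / u) ^+ n * W).
    apply: (le_trans (bnd_l _)); rewrite ler_wpM2l//.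
    apply: (le_trans (rnorm_opn _ (res_blin H (cpt p)))).
    by rewrite ler_wpM2r.
  apply: (@le_trans _ _ ((3 * u) ^+ m * (Cl * (c * (u * N)^-1 * (2 / u) ^+ n * W) * N^-1))).
    apply: ler_pM; rewrite ?exprn_ge0 ?mulr_ge0 ?invr_ge0 ?cabs_ge0//.
      by rewrite lerXn2r ?nnegrE ?cabs_ge0// mulr_ge0// ltW.
    by apply: ler_pM; rewrite ?invr_ge0 ?cabs_ge0// lef_pV2 ?posrE// (lt_le_trans N0).
  rewrite le_eqVlt; apply/orP; left; apply/eqP.
  by apply: damping_arith; rewrite gt_eqF.
rewrite (fr G G' hG) (fr E E' hE) in far.
have nG := near_s G MG MG0 cG bG; have nE := near_s E ME ME0 cE bE.
have -> : square_int G 0 s - square_int E 0 s =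
  - (square_int (fun q => D q * G q) 0 s - square_int G 0 s) +
  (square_int (fun q => D q * E q) 0 s - square_int E 0 s) +
  (square_int (fun q => D q * G q) 0 s - square_int (fun q => D q * E q) 0 s) by ring.
apply: (le_trans (ler_normD _ _)); apply: (@le_trans _ _
  (8 * s * (4 ^+ m * (2 * kk) * MG) + 8 * s * (4 ^+ m * (2 * kk) * ME) + 
   8 * N * (3 ^+ m * 2 ^+ n * c * (Cl * W) / N ^+ 2))).
  apply: lerD => //; apply: (le_trans (ler_normD _ _)); rewrite normrN; exact: lerD.
have -> : kk * C1 = 8 * s * (4 ^+ m * (2 * kk) * MG) + 8 * s * (4 ^+ m * (2 * kk) * ME) +
   8 * (3 ^+ m * 2 ^+ n * c * (Cl * W)) * kk by rewrite /C1; ring.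
rewrite lerD2l.
have -> : 8 * N * (3 ^+ m * 2 ^+ n * c * (Cl * W) / N ^+ 2) =
   8 * (3 ^+ m * 2 ^+ n * c * (Cl * W)) * N^-1 by field; rewrite gt_eqF.
by rewrite ler_wpM2l// !mulr_ge0 ?exprn_ge0// ltW.
Qed.

End HolomorphicResolvent.

(** * The identity as a limit of combinations of resolvents *)

Lemma regroup8 (K : pzRingType) (V : lmodType K) (k : K) (x1 x2 x3 x4 x5 x6 x7 x8 : V) :
  (x1 - x2 + k *: (x3 - x4)) - (x5 - x6 + k *: (x7 - x8)) =
  ((x1 - x5) - (x2 - x6)) + k *: ((x3 - x7) - (x4 - x8)).
Proof.
rewrite opprD addrACA -scalerBr !opprD !opprK.
by congr (_ + k *: _); rewrite addrACA.
Qed.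

Section Density.
Context {R : realType} {B : completeNormedModType R[i]}.

Lemma dense_opn_le (D : set B) (W : B -> B) (K : R) : dense D -> bounded_linear W ->
  0 <= K -> (forall v, D v -> rnorm (W v) <= K * rnorm v) -> opn W <= K.
Proof.
move=> dD bW K0 h; apply: opn_le => // v.
have oW := opn_ge0 bW.
apply/ler_addgt0Pr => e e0.
pose d := e / (K + opn W + 1).
have S0 : 0 < K + opn W + 1 by rewrite ltr_wpDl// addr_ge0.
have d0 : 0 < d by rewrite divr_gt0.
have d0C : 0 < d%:C :> R[i] by rewrite ltcR.
have nb : nbhs v (ball v d%:C) by exact: nbhsx_ballx.
have [u [Ou Du]] : interior (ball v d%:C) `&` D !=set0.
  by apply: dD; [exists v|exact: open_interior].
have uv : rnorm (v - u) <= d.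
  have /interior_subset := Ou; rewrite -ball_normE /ball_ /= norm_rnorm ltcR.
  exact: ltW.
rewrite -(subrK u v) (linD bW.1) (le_trans (rnormD _ _))//.
have h1 : rnorm (W (v - u)) <= opn W * d.
  by apply: (le_trans (rnorm_opn _ bW)); rewrite ler_wpM2l.
have h2 : rnorm (W u) <= K * rnorm v + K * d.
  apply: (le_trans (h u Du)); rewrite -mulrDr ler_wpM2l//.
  rewrite -{1}(subrK v u) addrC (le_trans (rnormD _ _))// lerD2l.
  by rewrite rnorm_distC.
rewrite subrK; apply: (le_trans (lerD h1 h2)).
rewrite addrCA lerD2l (_ : e = (K + opn W + 1) * d).
  by rewrite -mulrDl ler_wpM2r ?(ltW d0)// addrC lerDl.
by rewrite /d mulrC divfK// gt_eqF.
Qed.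

End Density.

Section BoundedSpectrum.
Context {R : realType} {B : completeNormedModType R[i]}.
Variables (H : operator B) (c alpha : R) (n : nat).
Hypothesis HH : standing_hypothesis H c alpha.
Hypothesis hn : alpha <= n%:R.
Variables (r s : R).
Hypothesis r0 : 0 <= r.
Hypothesis rs : r < s.
Hypothesis sH : forall x : R, spectrum H x%:C -> `|x| <= r.
Notation leb := (@lebesgue_measure R).
Notation leb2 := (leb \x leb)%E.
Notation plane := (measurableTypeR R * measurableTypeR R)%type.
Notation Rs := (resolvent H).

Let s0 : 0 < s. Proof. exact: le_lt_trans r0 rs. Qed.

(** The four sides of the square are gathered on a single parameter, so that one simple
   function approximates the whole contour integral. *)
Definition contour_fun (t : plane) : B -> B :=
  (Rs (cpt (s, t.1)) - Rs (cpt (- s, t.1))) +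
  'i%C *: (Rs (cpt (t.1, s)) - Rs (cpt (t.1, - s))).

Lemma contour_fun_blin t : bounded_linear (contour_fun t).
Proof.
apply: blinA; first by apply: blinB; exact: res_blin.
by apply: blinZ; apply: blinB; exact: res_blin.
Qed.

Let near_rho p : (s <= `|p.1|) || (s <= `|p.2|) -> \forall u \near p, rho H (cpt u).
Proof.
move=> /(near_out HH r0 rs sH)[d d0 hd].
have [_ _ cp _ _] := hol_at_id p.
have d2 : 0 < d / 2 by rewrite divr_gt0.
apply: filterS (ccont_near cp d2) => u h; apply: hd; apply: (le_lt_trans h).
by rewrite ltr_pdivrMr// ltr_pMr// ltr1n.
Qed.

Lemma contour_fun_near (t : R * R) e : 0 < e -> \forall u \near t, opn (contour_fun u - contour_fun t) <= e.
Proof.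
move=> e0; have e4 : 0 < e / 4 by rewrite divr_gt0.
have ns : `|- s| = s by rewrite normrN gtr0_norm.
have ps : `|s| = s by rewrite gtr0_norm.
have nv a : `|a| = s -> \forall u \near t, opn (Rs (cpt (a, u.1)) - Rs (cpt (a, t.1))) <= e / 4.
  move=> aE; have h : \forall q \near (a, t.1), opn (Rs (cpt q) - Rs (cpt (a, t.1))) <= e / 4.
    by apply: res_near => //; apply: near_rho; rewrite /= aE lexx.
  have cv : (fun u : R * R => (a, u.1)) @ t --> (a, t.1).
    exact: (@cvg_pair _ _ _ (nbhs t) (nbhs a) (nbhs t.1) _ _ _ (fun=> a) fst (cvg_cst a) cvg_fst).
  exact: cv h.
have nh a : `|a| = s -> \forall u \near t, opn (Rs (cpt (u.1, a)) - Rs (cpt (t.1, a))) <= e / 4.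
  move=> aE; have h : \forall q \near (t.1, a), opn (Rs (cpt q) - Rs (cpt (t.1, a))) <= e / 4.
    by apply: res_near => //; apply: near_rho; rewrite /= aE lexx orbT.
  have cv : (fun u : R * R => (u.1, a)) @ t --> (t.1, a).
    exact: (@cvg_pair _ _ _ (nbhs t) (nbhs t.1) (nbhs a) _ _ _ fst (fun=> a) cvg_fst (cvg_cst a)).
  exact: cv h.
apply: filterS (filterI (filterI (nv s ps) (nv (- s) ns)) (filterI (nh s ps) (nh (- s) ns))).
move=> u [[h1 h2] [h3 h4]].
have bl p q : bounded_linear (Rs (cpt p) - Rs (cpt q)) by apply: blinB; exact: res_blin.
rewrite (_ : contour_fun u - contour_fun t =
  ((Rs (cpt (s, u.1)) - Rs (cpt (s, t.1))) - (Rs (cpt (- s, u.1)) - Rs (cpt (- s, t.1)))) +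
  'i%C *: ((Rs (cpt (u.1, s)) - Rs (cpt (t.1, s))) - (Rs (cpt (u.1, - s)) - Rs (cpt (t.1, - s))))); last first.
  exact: regroup8.
have bb1 := blinB (bl (s, u.1) (s, t.1)) (bl (- s, u.1) (- s, t.1)).
have bb2 := blinB (bl (u.1, s) (t.1, s)) (bl (u.1, - s) (t.1, - s)).
apply: (le_trans (opnD bb1 (blinZ _ bb2))).
rewrite opnZ// cabsi mul1r (_ : e = (e / 4 + e / 4) + (e / 4 + e / 4)); last by field.
by apply: lerD; apply: (le_trans (opnB _ _)) => //; exact: lerD.
Qed.

Let K : set (R * R) := rect (- s) s 0 1.

Let Kvol : fine (leb2 K) = 2 * s.
Proof.
rewrite /K /rect product_measure1E; [|exact: measurable_itv..].
have h (u v : R) : u < v -> leb `[u, v]%classic = (v - u)%:E.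
  by move=> uv; rewrite lebesgue_measure_itv /= lte_fin uv.
transitivity (fine ((s - - s)%:E * (1 - 0)%:E)%E); last by rewrite -EFinM /=; ring.
by congr fine; congr (_ * _)%E; apply: h => //; rewrite gtrN.
Qed.

(** Both sides are integrals over the rectangle [K], whose second coordinate is a dummy
   variable that turns line integrals into plane integrals. *)
Lemma contour_riemann (l : B -> R[i]) (Cl e : R) (v : B) (S : @opsimple _ B _ _ leb2) :
  (forall a u w, l (a *: u + w) = a * l u + l w) -> 0 <= Cl ->
  (forall u, cabs (l u) <= Cl * rnorm u) -> dom H v ->
  (forall t, K t -> opn (contour_fun t - os_fun S t) <= e) ->
  (forall t, ~ K t -> os_fun S t = 0) ->
  `|complex.Re (l (os_int S v)) - 2 * pi * complex.Re (l v)| <= Cl * rnorm v * e * (2 * s).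
Proof.
move=> lin_l Cl0 bl Dv Se S0.
pose Lam (T : B -> B) := complex.Re (l (T v)).
have rf : rfunctional Lam (Cl * rnorm v) := eval_rfunctional v lin_l Cl0 bl.
have [C0 _ _ LC] := rf.
have [iS eS] := rf_os S rf.
have mK : measurable (K : set plane) by exact: measurable_rect.
have cF t : {for t, continuous (fun t => Lam (contour_fun t))}.
  apply/cvgrPdist_le => d d0.
  have C1 : 0 < Cl * rnorm v + 1 by rewrite ltr_wpDl.
  have d1 : 0 < d / (Cl * rnorm v + 1) by rewrite divr_gt0.
  apply: filterS (contour_fun_near t d1) => u hu.
  have bu := contour_fun_blin u; have bt := contour_fun_blin t.
  rewrite distrC -(rfB rf)// (le_trans (LC _ _))//; first exact: blinB.
  rewrite (_ : d = (Cl * rnorm v + 1) * (d / (Cl * rnorm v + 1))).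
    by rewrite ler_pM ?lerDl// opn_ge0//; exact: blinB.
  by rewrite mulrC divfK// gt_eqF.
rewrite -(contour_formula lin_l Cl0 bl HH hn r0 rs sH Dv).
set G := fun q => l (Rs (cpt q) v).
have cG p : (s <= `|p.1|) || (s <= `|p.2|) -> ccont G p.
  by move=> /(near_out HH r0 rs sH)[d d0 hd]; have [] := res_hol lin_l Cl0 bl v d0 hd.
have ns : `|- s| = s by rewrite normrN gtr0_norm.
have ps : `|s| = s by rewrite gtr0_norm.
have -> : square_int G 0 s = \int[leb2]_(t in K) Lam (contour_fun t).
  have [-> _] := Rintegral_rect (fun p (_ : rect (- s) s 0 1 p) => cF p).
  rewrite /square_int !add0r -RintB.
  - apply: eq_Rintegral => x _.
    rewrite (_ : (fun y => _) = fun=> Lam (contour_fun (x, 0))); last exact/funext.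
    have m1 : fine (leb `[0, 1]%classic) = 1.
      by rewrite lebesgue_measure_itv /= lte_fin ltr01 oppr0 adde0.
    transitivity (Lam (contour_fun (x, 0)) * fine (leb `[0, 1]%classic)); last first.
      by rewrite -Rintegral_cst.
    rewrite m1 mulr1.
    rewrite /Lam /contour_fun /=.
    change (complex.Re (G (s, x)) - complex.Re (G (- s, x)) -
      (complex.Im (G (x, s)) - complex.Im (G (x, - s))) =
      complex.Re (l ((Rs (cpt (s, x)) v - Rs (cpt (- s, x)) v) +
         'i%C *: (Rs (cpt (x, s)) v - Rs (cpt (x, - s)) v)))).
    rewrite (lformD lin_l) (lformZ lin_l) !(lformB lin_l) -/(G (s, x)) -/(G (- s, x)) -/(G (x, s)) -/(G (x, - s)).
    by move: (G _) (G _) (G _) (G _) => [? ?] [? ?] [? ?] [? ?] /=; ring.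
  - move=> x _; apply: cvgB; apply: (continuous_sectionr (f := fun q => complex.Re (G q))).
      by have [] := cG (s, x); first by rewrite /= ps lexx.
    by have [] := cG (- s, x); first by rewrite /= ns lexx.
  - move=> x _; apply: cvgB; apply: (continuous_sectionl (f := fun q => complex.Im (G q))).
      by have [] := cG (x, s); first by rewrite /= ps lexx orbT.
    by have [] := cG (x, - s); first by rewrite /= ns lexx orbT.
have -> : complex.Re (l (os_int S v)) = \int[leb2]_(t in K) Lam (os_fun S t).
  rewrite -/(Lam (os_int S)) -eS /Rintegral integral_mkcond [in RHS]integral_mkcond.
  congr fine; apply: eq_integral => t _; rewrite !patchE in_setT /=.
  case: ifPn => // /negP; rewrite inE => nK; rewrite S0//.
  by rewrite (rf0 rf).
have iF : leb2.-integrable K (EFin \o (fun t => Lam (contour_fun t))).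
  by apply: integrable_rect => p _; exact: cF.
have iSK : leb2.-integrable K (EFin \o (fun t => Lam (os_fun S t))).
  exact: integrableS measurableT mK (@subsetT _ _) iS.
rewrite -RintegralB//.
have iB := integrableB mK iSK iF.
apply: (le_trans (le_normr_Rintegral mK iB)).
have iA := integrable_abse iB.
have iC : leb2.-integrable K (EFin \o (fun=> Cl * rnorm v * e)).
  by apply: integrable_rect => p _; exact: cvg_cst.
rewrite -Kvol -Rintegral_cst//.
apply: le_Rintegral => // t Kt.
have bs := os_fun_blin S t; have bt := contour_fun_blin t.
rewrite -(rfB rf)//; apply: (le_trans (LC _ _)); first exact: blinB.
by rewrite ler_wpM2l// opn_distC// Se.
Qed.

(** On the dense domain of [H], the Riemann sums of the contour integral are close to
   [2 pi] in norm, uniformly on bounded sets; [L] vanishes on these sums. *)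
Lemma kills_identity (L : (B -> B) -> R[i]) :
  (forall a S T, bounded_linear S -> bounded_linear T -> L (a *: S + T) = a * L S + L T) ->
  (forall S, bounded_linear S -> cabs (L S) <= 2 * opn S) ->
  (forall z, rho H z -> L (Rs z) = 0) -> L id = 0.
Proof.
move=> Llin Lb LR.
have L0 := bform0 Llin; have LD := bformD Llin.
have LZ := bformZ Llin; have LB := bformB Llin.
have LR' z : L (Rs z) = 0.
  have [/LR//|] := pselect (rho H z).
  move=> /contrapT sz; rewrite /resolvent; case: xgetP => [T _ hT|_]; last exact: L0.
  by exfalso; apply: sz; exists T.
have LF t : L (contour_fun t) = 0.
  rewrite LD; [|by apply: blinB; exact: res_blin|by apply: blinZ; apply: blinB; exact: res_blin].
  rewrite LZ; last by apply: blinB; exact: res_blin.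
  by rewrite !LB ?LR' ?subrr ?mulr0 ?addr0//; exact: res_blin.
apply/eqP; rewrite -cabs_eq0; apply/negPn/negP => x0.
have xg : 0 < cabs (L id) by rewrite lt_def x0 cabs_ge0.
(* With this [e], the estimate [2 pi |L id| <= 2 (4 s e)] is contradictory. *)
pose e := cabs (L id) / (8 * s).
have e0 : 0 < e by rewrite divr_gt0// mulr_gt0.
have [||||t Kt|S [Se S0 SF]] := @simple_approx R B contour_fun K e.
- exact: contour_fun_blin.
- exact: compact_rect.
- exact: measurable_rect.
- exact: rect_fin.
- exact: contour_fun_near.
have LS : L (os_int S) = 0.
  have -> : os_int S = \sum_(i < os_size S) (fine (leb2 (os_set i)))%:C *: os_val i.
    by apply/funext => v; rewrite /os_int fct_sumE.
  suff [] : bounded_linear (\sum_(i < os_size S) (fine (leb2 (os_set i)))%:C *: os_val i) /\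
    L (\sum_(i < os_size S) (fine (leb2 (os_set i)))%:C *: os_val i) = 0 by [].
  elim/big_ind : _ => [|T T' [bT lT] [bT' lT']|i _]; first by split=> //; exact: blin0.
    by split; [exact: blinA|rewrite LD// lT lT' addr0].
  have [u ->] := SF i; split; first by apply: blinZ; exact: contour_fun_blin.
  by rewrite LZ ?LF ?mulr0//; exact: contour_fun_blin.
have [[_ dD _] _ _ _ _] := HH.
pose p2 : R[i] := (2 * pi)%:C.
have bW : bounded_linear (os_int S - p2 *: id).
  by apply: blinB; [exact: os_int_blin|apply: blinZ; exact: blin_id].
have W4 : opn (os_int S - p2 *: id) <= 4 * s * e.
  apply: (dense_opn_le dD bW) => [|v Dv].
    by rewrite mulr_ge0 ?(ltW e0)// mulr_ge0// (ltW s0).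
  have [l [l1 l2 l3]] := norming_functional ((os_int S - p2 *: id) v).
  have := contour_riemann l1 _ l3 Dv Se S0 => /(_ (ler0n _ _)) h.
  apply: (@le_trans _ _ (2 * rnorm v * e * (2 * s))); last first.
    by rewrite le_eqVlt; apply/orP; left; apply/eqP; ring.
  apply: le_trans h.
  have <- : complex.Re (l ((os_int S - p2 *: id) v)) = rnorm ((os_int S - p2 *: id) v) by rewrite l2.
  apply: le_trans (ler_norm _); rewrite le_eqVlt; apply/orP; left; apply/eqP.
  have -> : (os_int S - p2 *: id) v = (- p2) *: v + os_int S v.
    by rewrite scaleNr addrC.
  by rewrite l1 raddfD /= mulNr raddfN /= ReM_real addrC.
have := Lb _ bW; rewrite LB; [|exact: os_int_blin|apply: blinZ; exact: blin_id].
rewrite LS LZ; last exact: blin_id.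
rewrite sub0r cabsN cabsM cabsR ger0_norm ?mulr_ge0 ?pi_ge0// => h.
have := le_trans h (ler_wpM2l (ler0n _ 2) W4).
have -> : 2 * (4 * s * e) = cabs (L id) by rewrite /e; field; rewrite gt_eqF.
have := pi_ge2 R; move: (cabs _) xg pi => x xg p p2'; nra.
Qed.

End BoundedSpectrum.

(** * The spectral inclusion *)

Section Evaluation.
Context {R : realType} {B : completeNormedModType R[i]}.
Variables (H : operator B) (c alpha : R).
Hypothesis HH : standing_hypothesis H c alpha.
Variables (n : nat) (tau0 f : R -> R[i]).
Hypotheses (hn : alpha < n%:R) (ht : cutoff tau0) (hf : calA f).
Notation leb := (@lebesgue_measure R).
Notation leb2 := (leb \x leb)%E.
Notation Rs := (resolvent H).

Lemma eq_Re_mul (a b : R[i]) : (forall om, complex.Re (om * a) = complex.Re (om * b)) -> a = b.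
Proof.
move=> h; have := h 1; have := h 'i%C; rewrite !mul1r.
case: a b {h} => [a1 a2] [b1 b2] /=; rewrite !mul0r !mul1r !sub0r.
by move=> /oppr_inj -> ->.
Qed.

(** Every operator commuting with the resolvents commutes with their integral; as
   composition with [S] is continuous, this is tested on functionals. *)
Lemma fcalc_bicommuting : bicommuting H (fcalc H n tau0 f).
Proof.
have [bF weak] := fcalc_weak HH hn ht hf.
split=> // S [bS cS] v.
set F := fcalc H n tau0 f in bF weak *.
have [l [l1 l2 l3]] := norming_functional (F (S v) - S (F v)).
pose Lam (T : B -> B) := complex.Re (l (T (S v) - S (T v))).
have oS := opn_ge0 bS; have v0 := rnorm_ge0 v.
have rf : rfunctional Lam (4 * opn S * rnorm v).
  split; first by rewrite !mulr_ge0.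
  - move=> T T' _ _; rewrite /Lam !fctE /= (linD bS.1) opprD addrACA (lformD l1) raddfD//.
  - move=> b T _; rewrite /Lam.
    change (complex.Re (l (b%:C *: T (S v) - S (b%:C *: T v))) = b * complex.Re (l (T (S v) - S (T v)))).
    by rewrite (linZ bS.1) -scalerBr (lformZ l1) ReM_real.
  - move=> T bT; apply: (le_trans (Re_le_cabs _)); apply: (le_trans (l3 _)).
    have oT := opn_ge0 bT.
    have h1 : rnorm (T (S v)) <= opn T * (opn S * rnorm v).
      by apply: (le_trans (rnorm_opn _ bT)); rewrite ler_wpM2l// rnorm_opn.
    have h2 : rnorm (S (T v)) <= opn S * (opn T * rnorm v).
      by apply: (le_trans (rnorm_opn _ bS)); rewrite ler_wpM2l// rnorm_opn.
    have := rnormB (T (S v)) (S (T v)).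
    have -> : 4 * opn S * rnorm v * opn T = 2 * (opn T * (opn S * rnorm v) + opn S * (opn T * rnorm v)) by ring.
    by move=> h; rewrite ler_wpM2l// (le_trans h)// lerD.
have [_ E] := weak _ _ rf.
have z0 : Lam F = 0.
  rewrite E (_ : \int[_]_(p in _) _ = 0) ?mulr0//.
  rewrite (@eq_Rintegral _ _ _ leb2 (@off_axis R) (fun=> 0)).
    by rewrite /Rintegral integral0.
  move=> p; rewrite inE => po; rewrite /Lam /hs_integrand (linZ bS.1) cS; last first.
    exact: (rho_nonreal HH).
  by rewrite subrr (lform0 l1).
apply/eqP; rewrite -subr_eq0 -rnorm_eq0.
by move: z0; rewrite /Lam l2 /= => ->.
Qed.

Variable L : (B -> B) -> R[i].
Hypothesis Llin : forall a S T, bounded_linear S -> bounded_linear T ->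
  L (a *: S + T) = a * L S + L T.
Hypothesis Lb : forall S, bounded_linear S -> cabs (L S) <= 2 * opn S.

Lemma functional_Re om : rfunctional (fun S => complex.Re (om * L S)) (cabs om * 2).
Proof.
split; first by rewrite mulr_ge0 ?cabs_ge0.
- by move=> S T bS bT; rewrite (bformD Llin)// mulrDr raddfD.
- by move=> a S bS; rewrite (bformZ Llin)// mulrCA ReM_real.
- move=> S bS; apply: (le_trans (Re_le_cabs _)); rewrite cabsM -mulrA.
  by rewrite ler_wpM2l ?cabs_ge0// Lb.
Qed.

Lemma functional_fcalc (k : R * R -> R[i]) :
  (forall p, @off_axis R p -> L (Rs (cpt p)) = k p) ->
  forall om, complex.Re (om * L (fcalc H n tau0 f)) =
    - pi^-1 * \int[leb2]_(p in @off_axis R)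
      complex.Re (om * (dbar (almost_analytic n tau0 f) p.1 p.2 * k p)).
Proof.
move=> Lk om; have [_ weak] := fcalc_weak HH hn ht hf.
have [_ ->] := weak _ _ (functional_Re om); congr (_ * _).
apply: eq_Rintegral => p; rewrite inE => po.
rewrite (_ : hs_integrand H n tau0 f p =
  dbar (almost_analytic n tau0 f) p.1 p.2 *: Rs (cpt p))//.
by rewrite (bformZ Llin) ?Lk//; exact: res_blin.
Qed.

Lemma functional_eval (x : R) : (forall z : R[i], complex.Im z != 0 -> L (Rs z) = (z - x%:C)^-1) ->
  L (fcalc H n tau0 f) = f x.
Proof.
move=> Lx; apply: eq_Re_mul => om.
rewrite (@functional_fcalc (fun p => (cpt p - x%:C)^-1)); last by move=> p po; exact: Lx.
have [_ _ _ al0 _] := HH.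
have n0 : (0 < n)%N by rewrite -(ltr0n R); exact: le_lt_trans hn.
rewrite scalar_formula//.
by rewrite mulrA mulrNN mulVf ?mul1r// gt_eqF// pi_gt0.
Qed.

Lemma functional_vanish : (forall z : R[i], complex.Im z != 0 -> L (Rs z) = 0) ->
  L (fcalc H n tau0 f) = 0.
Proof.
move=> L0; apply: eq_Re_mul => om; rewrite (@functional_fcalc (fun=> 0)).
  under eq_Rintegral do rewrite mulr0 mulr0.
  by rewrite /Rintegral integral0 !mulr0.
by move=> p po; exact: L0.
Qed.

End Evaluation.

Section Decay.
Context {R : realType}.

Lemma calA_decay (f : R -> R[i]) (e : R) : calA f -> 0 < e ->
  exists r, forall x, r < `|x| -> cabs (f x) < e.
Proof.
move=> [b b0 sf] e0; have [C C0 fC] := symbol_consts 0 sf.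
have C1 : 0 < C + 1 by rewrite ltr_wpDl.
pose q := e / (C + 1); have q0 : 0 < q by rewrite divr_gt0.
exists (q `^ b^-1) => x hx.
have J : q `^ b^-1 < japR x by apply: (lt_le_trans hx); exact: normr_le_japR.
have Jb : japR x `^ b <= q by apply: powR_le_inv => //; exact: ltW.
have := fC 0%N x (leqnn _); rewrite subr0 /= => /le_lt_trans; apply.
apply: (@le_lt_trans _ _ (C * q)); first by rewrite ler_wpM2l.
by rewrite -[ltRHS](divfK (lt0r_neq0 C1)) mulrC ltr_pM2l// ltrDl.
Qed.

Lemma closure_cabs (A : set R[i]) (a : R[i]) :
  (forall e, 0 < e -> exists2 b, A b & cabs (a - b) < e) -> closure (A : set R[i]^o) a.
Proof.
move=> h U /nbhs_ballP[e /= e0 eU].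
have [r0 eE] : 0 < complex.Re e /\ e = (complex.Re e)%:C.
  by move: e0; case: e {eU} => x y; rewrite ltcE /= => /andP[/eqP -> ->].
have [b Ab ab] := h _ r0; exists b; split=> //; apply: eU.
by rewrite -ball_normE /ball_ /= normc_cabs eE ltcR.
Qed.

End Decay.

Theorem theorem4p4 (R : realType) (B : completeNormedModType R[i])
    (H : operator B) (c alpha : R) (HH : standing_hypothesis H c alpha)
    (n : nat) (hn : alpha < n%:R)
    (tau0 : R -> R[i]) (htau0 : cutoff tau0)
    (phi : R[i] * (R -> R[i])) (hphi : calAhat phi) :
  spectrum (total_operator (hat_calc H n tau0 phi)) `<=`
  closure ([set hat_fun phi x | x in [set x : R | spectrum H x%:C]]
           : set R[i]^o).
Proof.
move=> mu smu; set f := phi.2; set F := fcalc H n tau0 f.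
have hf : calA f := hphi.
have bicF : bicommuting H F := fcalc_bicommuting HH hn htau0 hf.
have bF : bounded_linear F by case: bicF.
pose z0 : R[i] := 'i%C.
have rz0 : rho H z0 by apply: (rho_nonreal HH); rewrite /= oner_eq0.
pose T : bicomm_alg H := mkb (bicomm_res rz0).
pose a : bicomm_alg H := scalar H (mu - phi.1) - mkb bicF.
have aE v : a v = mu *: v - hat_calc H n tau0 phi v.
  rewrite /hat_calc -/f -/F opprD [- _ - _]addrC addrA -scalerBl.
  by [].
have na : ~ exists x, x * a = 1.
  move=> [x xE]; apply: smu; exists (bval x).
  have E1 v : x (a v) = v by have := congr1 (fun y : bicomm_alg H => y v) xE.
  have E2 v : a (x v) = v.
    by have := xE; rewrite mulrC => /(congr1 (fun y : bicomm_alg H => y v)).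
  split; first exact: bval_blin.
    by move=> v; split=> //; rewrite -[RHS]E2 aE.
  by move=> v _; rewrite -[RHS]E1 aE.
have [t [L [Llin La LT L1 Lb]]] := spectral_functional T na.
have LD := bformD Llin; have LZ := bformZ Llin.
have muE : mu = L F + phi.1.
  have := La 1; rewrite mul1r.
  have -> : bval a = (-1) *: F + (mu - phi.1) *: id by rewrite scaleN1r addrC.
  rewrite Llin//; last by apply: blinZ; exact: blin_id.
  rewrite (LZ (mu - phi.1) id)//; last exact: blin_id.
  rewrite L1 mulr1 mulN1r => h.
  by rewrite -[L F]addr0 -h; ring.
have LR z : rho H z -> L (resolvent H z) * (1 - t * (z0 - z)) = t.
  move=> rz; pose S : bicomm_alg H := mkb (bicomm_res rz).
  have bS : bounded_linear S by exact: bval_blin.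
  have SE : S = (1 + scalar H (z0 - z) * S) * T.
    apply: val_inj; apply/funext => v /=.
    change (resolvent H z v = resolvent H z0 v + (z0 - z) *: resolvent H z (resolvent H z0 v)).
    by rewrite -res_identity// addrC subrK.
  have := LT (1 + scalar H (z0 - z) * S).
  have -> : (1 + scalar H (z0 - z) * S) * (T - scalar H t) =
      S - (scalar H t * 1 + scalar H (t * (z0 - z)) * S).
    by rewrite rmorphM /= {2}SE; ring.
  have -> : bval (S - (scalar H t * 1 + scalar H (t * (z0 - z)) * S)) =
     (- 1) *: (t *: id + (t * (z0 - z)) *: bval S) + bval S.
    by rewrite addrC scaleN1r.
  rewrite Llin//; last by apply: blinA; apply: blinZ => //; exact: blin_id.
  rewrite LD; [|by apply: blinZ; exact: blin_id|exact: blinZ].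
  rewrite !LZ//; last exact: blin_id.
  rewrite L1 mulr1 mulN1r => h; rewrite mulrBr mulr1 -[RHS]addr0 -h.
  change (L (bval S) - L (bval S) * (t * (z0 - z)) =
    t + (- (t + t * (z0 - z) * L (bval S)) + L (bval S))).
  by move: (L (bval S)) => q; ring.
have [t0|t0] := eqVneq t 0.
- have LR0 z : rho H z -> L (resolvent H z) = 0.
    by move=> /LR; rewrite t0 mul0r subr0 mulr1.
  have mu1 : mu = phi.1.
    rewrite muE (functional_vanish HH hn htau0 hf Llin Lb) ?add0r// => z /(rho_nonreal HH).
    exact: LR0.
  apply: closure_cabs => e e0; have [r rP] := calA_decay hf e0.
  have [[x sx rx]|nx] := pselect (exists2 x, spectrum H x%:C & r < `|x|).
    exists (hat_fun phi x); first by exists x.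
      by rewrite /hat_fun mu1 opprD addrA subrr sub0r cabsN; exact: rP.
  exfalso.
  have sH x : spectrum H x%:C -> `|x| <= `|r|.
    move=> sx; rewrite leNgt; apply/negP => rx; apply: nx; exists x => //.
    exact: le_lt_trans (ler_norm r) rx.
  have := kills_identity HH (ltW hn) (normr_ge0 r) (ltr_pwDl ltr01 (lexx `|r|)) sH Llin Lb LR0.
  by rewrite L1 => /eqP; rewrite oner_eq0.
(* [T - t] is invertible as soon as [x] is in the resolvent set. *)
pose x := z0 - t^-1.
have xs : spectrum H x.
  apply: contrapT => /LR; rewrite /x subKr mulfV// subrr mulr0.
  by move=> t0'; move: t0; rewrite -t0' eqxx.
have xr : x = (complex.Re x)%:C.
  have [_ /(_ _ xs) ix _ _ _] := HH.
  by rewrite {1}(complexE x) ix mulr0 addr0.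
apply: subset_closure; exists (complex.Re x); first by rewrite /= -xr.
rewrite /hat_fun muE addrC; congr (_ + _).
symmetry; apply: (functional_eval HH hn htau0 hf Llin Lb) => z iz.
have := LR z (rho_nonreal HH iz); rewrite -xr.
have zx : z - x != 0.
  rewrite subr_eq0; apply/eqP => zx; move: iz; rewrite zx xr /=. 
  by rewrite eqxx.
have -> : 1 - t * (z0 - z) = t * (z - x).
  by rewrite /x; field.
rewrite mulrCA => h; have {}h : L (resolvent H z) * (z - x) = 1.
  by apply: (mulfI t0); rewrite h mulr1.
by apply: (mulIf zx); rewrite h mulVf.
Qed.
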